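(* Let $0<p\le 1$ and let $Y$ be a regular complex Banach space. (i) The map $S_e$ that assigns to each monomial $z\mapsto xz^n$ the trigonometric monomial $t\mapsto x\cos(2\pi nt)$, $n\in\mathbb{N}_0$, $x\in Y$, extends to an isomorphism from $H_p(\mathbb{D},Y)$ onto $H_{p,e}(\mathbb{T},Y)$. (ii) The map $S_o$ that assigns to each monomial $z\mapsto xz^n$ the trigonometric monomial $t\mapsto x\sin(2\pi nt)$, $n\in\mathbb{N}$, $x\in Y$, extends to an isomorphism from $H_{p,0}(\mathbb{D},Y)$ onto $H_{p,o}(\mathbb{T},Y)$.
   Context: A complex Banach space is regular if it is isomorphic to the complexification of a real Banach space. $\mathbb{D}$ is the open unit disc of $\mathbb{C}$. $H_p(\mathbb{D},Y)$ is the quasi-Banach space of all analytic $F\colon\mathbb{D}\to Y$ with $\sup_{0\le r<1}\big(\int_{-1/2}^{1/2}\|F(re^{2\pi i t})\|_Y^p\,dt\big)^{1/p}<\infty$, and $H_{p,0}(\mathbb{D},Y)=\{F\in H_p(\mathbb{D},Y):F(0)=0\}$. Functions on the torus $\mathbb{T}$ are regarded as $1$-periodic functions on $\mathbb{R}$; $I=[-1/2,1/2)$. $\mathcal{D}'(\mathbb{T},Y)$ is the space of continuous linear maps from $\mathcal{C}^{(\infty)}(\mathbb{T},\mathbb{C})$ (usual Fréchet topology) into $Y$; an integrable $1$-periodic function $f$ is regarded as the distribution $g\mapsto\int_I fg$. For $0\le r<1$ and $t\in\mathbb{R}$, $P_r(t)=\operatorname{Re}\frac{1+re^{2\pi it}}{1-re^{2\pi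 it}}$ and $Q_r(t)=\operatorname{Im}\frac{1+re^{2\pi it}}{1-re^{2\pi it}}$. For $f\in\mathcal{D}'(\mathbb{T},Y)$, $(P_r*f)(t)=f(P_r(t-\cdot))$, and likewise for $Q_r$. $H_p(\mathbb{T},Y)$ is the quasi-Banach space of all $f\in\mathcal{D}'(\mathbb{T},Y)$ with $$\|f\|_{H_p(\mathbb{T},Y)}=\sup_{0\le r<1}\Big(\int_I\|P_r*f\|_Y^p+\|Q_r*f\|_Y^p\Big)^{1/p}<\infty.$$ $H_{p,e}(\mathbb{T},Y)$ and $H_{p,o}(\mathbb{T},Y)$ are its subspaces of even and odd distributions, respectively ($f$ is even, resp. odd, if $f(g(-\,\cdot))=f(g)$, resp. $f(g(-\,\cdot))=-f(g)$, for all test functions $g$). *)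

(* Defs.v *)
From HB Require Import structures.
From mathcomp Require Import all_boot all_order all_algebra.
From mathcomp Require Import all_classical all_reals all_analysis.
From mathcomp Require Import complex ring.

Set Implicit Arguments.
Unset Strict Implicit.
Unset Printing Implicit Defensive.

Import Order.TTheory GRing.Theory Num.Theory.
Import numFieldNormedType.Exports.

Local Open Scope complex_scope.
Local Open Scope ring_scope.
Local Open Scope classical_set_scope.

Section real_norm.
Variables (R : realType) (Y : normedModType R[i]).

(* The norm of a normed space over [R[i]] is a nonnegative real in [R[i]]. *)
Definition rnorm (y : Y) : R := complex.Re `|y|.

End real_norm.

(* [A] and [B] are linear subspaces, with (quasi-)norms [nA] and [nB]. For
   these, continuity of a linear map is boundedness. Only the values of [T] on
   [A] are constrained. *)
Section isomorphism.
Variables (R : realType) (V W : lmodType R[i]).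

Definition is_isomorphism (A : set V) (nA : V -> \bar R)
    (B : set W) (nB : W -> \bar R) (T : V -> W) : Prop :=
  [/\ (forall (a : R[i]) u v, A u -> A v -> T (a *: u + v) = a *: T u + T v),
      set_bij A B T,
      (exists C : R, forall u, A u -> (nB (T u) <= C%:E * nA u)%E) &
      (exists C : R, forall u, A u -> (nA u <= C%:E * nB (T u))%E)].

End isomorphism.

(* [(x, y) : complexification X] stands for x + iy. *)
Definition complexification (R : realType) (X : normedModType R) : Type :=
  (X * X)%type.

Section complexification.
Variables (R : realType) (X : normedModType R).

HB.instance Definition _ := GRing.Zmodule.on (complexification X).

Definition cplx_scale (a : R[i]) (u : complexification X) :
    complexification X :=
  (complex.Re a *: u.1 - complex.Im a *: u.2,
   complex.Re a *: u.2 + complex.Im a *: u.1).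

Lemma cplx_scaleA a b u :
  cplx_scale a (cplx_scale b u) = cplx_scale (a * b) u.
Proof.
case: a b u => [a a'] [b b'] [x y]; rewrite /cplx_scale /=.
rewrite !scalerBr !scalerDr !scalerBl !scalerDl !scalerA.
by congr pair; rewrite ?opprD (AC (2*2) ((1*4)*(2*3))).
Qed.

Lemma cplx_scale1 : left_id 1 cplx_scale.
Proof.
by case=> x y; rewrite /cplx_scale /= !scale1r !scale0r subr0 addr0.
Qed.

Lemma cplx_scaleDr : right_distributive cplx_scale +%R.
Proof.
move=> a [x y] [x' y']; rewrite /cplx_scale /= !scalerDr.
by congr pair; rewrite ?opprD addrACA.
Qed.

Lemma cplx_scaleDl u : {morph cplx_scale^~ u : a b / a + b}.
Proof.
move=> [a a'] [b b']; case: u => x y; rewrite /cplx_scale /= !scalerDl.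
by congr pair; rewrite ?opprD addrACA.
Qed.

HB.instance Definition _ := GRing.Zmodule_isLmodule.Build R[i]
  (complexification X) cplx_scaleA cplx_scale1 cplx_scaleDr cplx_scaleDl.

(* Taylor's complexification norm; all the usual complexification norms are
   equivalent to it. *)
Definition cplx_norm (u : complexification X) : R :=
  sup [set `|cos t *: u.1 + sin t *: u.2| | t in [set: R]].

End complexification.

Definition regular_banach (R : realType) (Y : normedModType R[i]) : Prop :=
  exists (X : completeNormedModType R) (J : complexification X -> Y),
    is_isomorphism setT (fun u => (cplx_norm u)%:E)
                   setT (fun y => (rnorm y)%:E) J.

Section circle.
Variable R : realType.

Definition cis (t : R) : R[i] := cos (2 * pi * t) +i* sin (2 * pi * t).

Definition period_itv : set R := `[- 2^-1, 2^-1[%classic.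

End circle.

Section disc.
Variable R : realType.

Definition disc : Type := {z : R[i] | `|z| < 1}.

Lemma norm0_lt1 : `|0 : R[i]| < 1.
Proof. by rewrite normr0 ltr01. Qed.

Definition disc0 : disc := exist _ 0 norm0_lt1.

(* For 0 <= r < 1 this is r e^{2 pi i t}, by [val_polar]; the default [disc0]
   is never reached below. *)
Definition polar (r t : R) : disc := insubd disc0 (r%:C * cis t).

Lemma normc_cis (t : R) : `|cis t| = 1.
Proof. by rewrite normc_def /= cos2Dsin2 sqrtr1. Qed.

Lemma val_polar (r t : R) : 0 <= r < 1 -> val (polar r t) = r%:C * cis t.
Proof.
move=> /andP[r0 r1]; rewrite /polar val_insubd ifT//.
by rewrite normrM normc_cis mulr1 normc_def /= expr0n addr0 sqrtr_sqr
  ger0_norm// ltcR.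
Qed.

Section hardy.
Variable Y : normedModType R[i].

Definition analytic (F : disc -> Y) : Prop :=
  forall z0 : disc, exists (a : nat -> Y) (d : R), 0 < d /\
    forall z : disc, `|val z - val z0| < d%:C ->
      series (fun n => (val z - val z0) ^+ n *: a n) n @[n --> \oo] --> F z.

Definition hardyD_norm (p : R) (F : disc -> Y) : \bar R :=
  ereal_sup [set ((\int[lebesgue_measure]_(t in @period_itv R)
                     (rnorm (F (polar r t)) `^ p)%:E) `^ p^-1)%E
            | r in `[0, 1[%classic].

Definition hardyD (p : R) : set (disc -> Y) :=
  [set F | analytic F /\ (hardyD_norm p F < +oo)%E].

Definition hardyD0 (p : R) : set (disc -> Y) :=
  [set F | hardyD p F /\ F disc0 = 0].

Definition monomial (n : nat) (x : Y) : disc -> Y := fun z => val z ^+ n *: x.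

End hardy.
End disc.

Section test_functions.
Variable R : realType.

Definition smooth (u : R -> R) : Prop := forall n t, derivable (u^`(n)) t 1.

Definition test_pred : pred (R -> R[i]) := fun g =>
  `[< [/\ smooth (fun t => complex.Re (g t)),
          smooth (fun t => complex.Im (g t)) &
          forall t, g (t + 1) = g t] >].

Lemma smooth_coind (P : (R -> R) -> Prop) :
  (forall u, P u -> (forall t, derivable u t 1) /\ P u^`()) ->
  forall u, P u -> smooth u.
Proof.
move=> HP u Pu n; have : P u^`(n).
  by elim: n => [//|n IHn]; rewrite derive1nS; exact: (HP _ IHn).2.
by move=> /HP[].
Qed.

Lemma smooth_is_derive u (t : R) : smooth u -> is_derive t 1 u (derive1 u t).
Proof. by move=> su; rewrite derive1E; apply/derivableP; exact: (su 0%N). Qed.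

Lemma smooth_derive u : smooth u -> smooth (derive1 u).
Proof. by move=> su n t; rewrite -derive1Sn; exact: su. Qed.

Lemma is_derive_ext (u : R -> R) du : (forall t : R, is_derive t 1 u (du t)) ->
  (forall t : R, derivable u t 1) /\ (derive1 u) = du.
Proof.
move=> D; split=> [t|]; first exact: ex_derive.
by apply/funext => t; rewrite derive1E; exact: derive_val.
Qed.

Lemma smooth_lin (a b : R) u v : smooth u -> smooth v ->
  smooth (fun t => a * u t + b * v t).
Proof.
move=> su sv.
pose P w := exists u v : R -> R,
  [/\ smooth u, smooth v & w = fun t => a * u t + b * v t].
apply: (@smooth_coind P); last by exists u, v.
move=> _ [{su}u [{sv}v [su sv ->]]].
have [|dw ->] := @is_derive_ext (fun t => a * u t + b * v t)
    (fun t => a * derive1 u t + b * derive1 v t).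
  move=> t; apply: is_deriveD; apply: is_deriveZ; exact: smooth_is_derive.
split=> //; exists (derive1 u), (derive1 v); split; [exact: smooth_derive..|by []].
Qed.

Lemma smooth_reflect u : smooth u -> smooth (fun t => u (- t)).
Proof.
move=> su.
pose P w := exists (c : R) (u : R -> R), smooth u /\ w = fun t => c * u (- t).
apply: (@smooth_coind P); last first.
  by exists 1, u; split=> //; apply/funext => t; rewrite mul1r.
move=> _ [c [{su}u [su ->]]].
have [|dw ->] := @is_derive_ext (fun t => c * u (- t))
    (fun t => - c * derive1 u (- t)).
  move=> t; rewrite mulNr -mulrN; apply: is_deriveZ; rewrite -mulrN1.
  by apply: (@is_derive1_comp _ u -%R t); exact: smooth_is_derive.
split=> //; exists (- c), (derive1 u); split; [exact: smooth_derive|by []].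
Qed.

Lemma smooth_cst (c : R) : smooth (fun _ : R => c).
Proof.
apply: (@smooth_coind (fun w => exists c, w = fun _ : R => c)); last by exists c.
move=> _ [{}c ->].
have [dw ->] := is_derive_ext (fun t => is_derive_cst c t 1).
by split=> //; exists 0.
Qed.

Lemma test_pred_submod_closed : submod_closed test_pred.
Proof.
split=> [|a g h].
  by apply/asboolP; split; [exact: smooth_cst..|].
move=> /asboolP[rg ig pg] /asboolP[rh ih ph]; apply/asboolP; split.
- have /= := @smooth_lin 1 1 _ _
    (@smooth_lin (complex.Re a) (- complex.Im a) _ _ rg ig) rh.
  congr smooth; apply/funext => t; rewrite !mul1r mulNr.
  rewrite -[(a *: g + h) t]/(a * g t + h t).
  by case: a (g t) (h t) => [a a'] [x x'] [y y'].
- have /= := @smooth_lin 1 1 _ _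
    (@smooth_lin (complex.Re a) (complex.Im a) _ _ ig rg) ih.
  congr smooth; apply/funext => t; rewrite !mul1r.
  rewrite -[(a *: g + h) t]/(a * g t + h t).
  by case: a (g t) (h t) => [a a'] [x x'] [y y'].
- by move=> t; rewrite !fctE /= pg ph.
Qed.

HB.instance Definition _ := GRing.isSubmodClosed.Build R[i] (R -> R[i])
  test_pred test_pred_submod_closed.

Definition test_fun : Type := {g : R -> R[i] | test_pred g}.

HB.instance Definition _ := SubChoice.on test_fun.
HB.instance Definition _ := [SubChoice_isSubLmodule of test_fun by <:].

(* The default value 0 is never reached below: [to_test] is only applied to
   test functions, by [test_pred_reflect], [test_pred_poisson] and
   [test_pred_cpoisson]. *)
Definition to_test (g : R -> R[i]) : test_fun := insubd 0 g.

Lemma val_to_test g : test_pred g -> val (to_test g) = g.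
Proof. by move=> tg; rewrite val_insubd tg. Qed.

Definition reflect_fun (g : test_fun) : test_fun :=
  to_test (fun t => val g (- t)).

Lemma test_pred_reflect (g : test_fun) : test_pred (fun t => val g (- t)).
Proof.
case: g => g /= /asboolP[rg ig pg]; apply/asboolP; split.
- exact: (smooth_reflect rg).
- exact: (smooth_reflect ig).
- by move=> t; rewrite opprD -(pg (- t - 1)) subrK.
Qed.

Definition test_derive (j : nat) (g : test_fun) (t : R) : R[i] :=
  derive1n j (fun s => complex.Re (val g s)) t
  +i* derive1n j (fun s => complex.Im (val g s)) t.

End test_functions.

Section kernels.
Variable R : realType.
Implicit Types r s t : R.

Definition herglotz r t : R[i] := (1 + r%:C * cis t) / (1 - r%:C * cis t).
Definition poisson r t : R := complex.Re (herglotz r t).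
Definition cpoisson r t : R := complex.Im (herglotz r t).

Definition kernel_den r t : R :=
  (1 - r * cos (2 * pi * t)) ^+ 2 + (r * sin (2 * pi * t)) ^+ 2.

Lemma kernel_den_gt0 r t : 0 <= r < 1 -> 0 < kernel_den r t.
Proof.
move=> /andP[r0 r1]; rewrite /kernel_den.
apply: ltr_wpDr; first exact: sqr_ge0.
rewrite exprn_gt0// subr_gt0 (le_lt_trans _ r1)// ler_piMr// cos_le1.
Qed.

Lemma herglotzE r t : 0 <= r < 1 ->
  herglotz r t = ((1 - r ^+ 2) / kernel_den r t)
    +i* (2 * r * sin (2 * pi * t) / kernel_den r t).
Proof.
move=> r01; have := kernel_den_gt0 t r01; rewrite /herglotz /cis.
move: (cos2Dsin2 (2 * pi * t)); rewrite /kernel_den.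
move: (cos _) (sin _) => c s cs D0.
move: D0; set D := (X in 0 < X) => D0.
have w0 : 1 - r%:C * (c +i* s) != 0 :> R[i].
  apply/negP => /eqP[] /=; rewrite !mul0r subr0 addr0 sub0r => e1 /eqP.
  rewrite oppr_eq0 => /eqP e2.
  by move: D0; rewrite /D e1 e2 expr0n addr0 ltxx.
apply: (mulIf w0); rewrite divfK//; simpc.
have Dn := lt0r_neq0 D0.
have s2 : s ^+ 2 = 1 - c ^+ 2 by rewrite -cs addrC addKr.
apply/eqP; rewrite eq_complex /=; apply/andP; split; apply/eqP.
- have N : (1 + r * c) * D = (1 - r ^+ 2) * (1 - r * c) + 2 * r * s * (r * s).
    by rewrite /D; ring: s2.
  by rewrite -[LHS](mulfK Dn) N; ring.
- have N : r * s * D = - ((1 - r ^+ 2) * (r * s)) + 2 * r * s * (1 - r * c).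
    by rewrite /D; ring: s2.
  by rewrite -[LHS](mulfK Dn) N; ring.
Qed.

Inductive kernel_alg r s : (R -> R) -> Prop :=
| KCst c : kernel_alg r s (fun=> c)
| KCos : kernel_alg r s (fun t => cos (2 * pi * (s - t)))
| KSin : kernel_alg r s (fun t => sin (2 * pi * (s - t)))
| KInv : kernel_alg r s (fun t => (kernel_den r (s - t))^-1)
| KAdd u v : kernel_alg r s u -> kernel_alg r s v ->
    kernel_alg r s (fun t => u t + v t)
| KMul u v : kernel_alg r s u -> kernel_alg r s v ->
    kernel_alg r s (fun t => u t * v t).

Lemma smooth_kernel_alg r s u : 0 <= r < 1 -> kernel_alg r s u -> smooth u.
Proof.
move=> r01; apply: (@smooth_coind _ (kernel_alg r s)) => {u} u.
have dth t : is_derive t 1 (fun t => 2 * pi * (s - t)) (- (2 * pi)).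
  have ds : is_derive t 1 (fun t => s - t) (0 - 1) by apply: is_deriveB.
  by rewrite -mulrN1 -sub0r; apply: is_deriveZ.
have dcos t : is_derive t 1 (fun t => cos (2 * pi * (s - t)))
    (2 * pi * sin (2 * pi * (s - t))).
  have := is_derive1_comp (is_derive_cos _) (dth t).
  by congr is_derive; ring.
have dsin t : is_derive t 1 (fun t => sin (2 * pi * (s - t)))
    (- (2 * pi) * cos (2 * pi * (s - t))).
  have := is_derive1_comp (is_derive_sin _) (dth t).
  by congr is_derive; ring.
have dden t : is_derive t 1 (fun t => kernel_den r (s - t))
    (- (2 * 2 * pi * r) * sin (2 * pi * (s - t))).
  have dc : is_derive t 1 (fun t => 1 - r * cos (2 * pi * (s - t)))
      (0 - r * (2 * pi * sin (2 * pi * (s - t)))).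
    by apply: is_deriveB; apply: is_deriveZ.
  have ds : is_derive t 1 (fun t => r * sin (2 * pi * (s - t)))
      (r * (- (2 * pi) * cos (2 * pi * (s - t)))).
    by apply: is_deriveZ.
  have := is_deriveD (is_deriveX 2 dc) (is_deriveX 2 ds).
  by congr is_derive; rewrite /GRing.scale /=; ring.
suff : kernel_alg r s u -> exists2 du,
    (forall t : R, is_derive t 1 u (du t)) & kernel_alg r s du.
  by move=> H /H[du /is_derive_ext[? <-]].
elim=> [c||||{}u v _ [du Du Kdu] _ [dv Dv Kdv]|{}u v Ku [du Du Kdu] Kv [dv Dv Kdv]].
- by exists (fun=> 0); [move=> t; exact: is_derive_cst|exact: KCst].
- exists (fun t => 2 * pi * sin (2 * pi * (s - t))) => //.
  by apply: KMul; [exact: KCst|exact: KSin].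
- exists (fun t => - (2 * pi) * cos (2 * pi * (s - t))) => //.
  by apply: KMul; [exact: KCst|exact: KCos].
- exists (fun t => (2 * 2 * pi * r) * sin (2 * pi * (s - t)) *
      ((kernel_den r (s - t))^-1 * (kernel_den r (s - t))^-1)).
    move=> t; have d0 := lt0r_neq0 (kernel_den_gt0 (s - t) r01).
    have := @is_deriveV _ (fun t => kernel_den r (s - t)) _ _ _ d0 (dden t).
    by congr is_derive; rewrite /GRing.scale /= expr2 invfM; ring.
  by apply: KMul; apply: KMul; [exact: KCst|exact: KSin|exact: KInv..].
- exists (fun t => du t + dv t); last exact: KAdd.
  by move=> t; exact: is_deriveD.
- exists (fun t => u t * dv t + v t * du t).
    by move=> t; exact: is_deriveM.
  by apply: KAdd; apply: KMul.
Qed.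

Lemma cisD1 t : cis (t + 1) = cis t.
Proof.
by rewrite /cis mulrDr mulr1 -[X in _ + X]mulrC mulr_natr sinD2pi cosD2pi.
Qed.

Lemma test_pred_poisson r s : 0 <= r < 1 ->
  test_pred (fun t => (poisson r (s - t))%:C).
Proof.
move=> r01; apply/asboolP; split => /=; last 2 first.
- exact: smooth_cst.
- by move=> t; rewrite /poisson /herglotz -(cisD1 (s - (t + 1))) opprD addrA subrK.
- apply: (@smooth_kernel_alg r s) => //.
  have -> : (fun t => poisson r (s - t)) =
      (fun t => (1 - r ^+ 2) * (kernel_den r (s - t))^-1).
    by apply/funext => t; rewrite /poisson herglotzE.
  by apply: KMul; [exact: KCst|exact: KInv].
Qed.

Lemma test_pred_cpoisson r s : 0 <= r < 1 ->
  test_pred (fun t => (cpoisson r (s - t))%:C).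
Proof.
move=> r01; apply/asboolP; split => /=; last 2 first.
- exact: smooth_cst.
- by move=> t; rewrite /cpoisson /herglotz -(cisD1 (s - (t + 1))) opprD addrA subrK.
- apply: (@smooth_kernel_alg r s) => //.
  have -> : (fun t => cpoisson r (s - t)) =
      (fun t => (2 * r) * sin (2 * pi * (s - t)) * (kernel_den r (s - t))^-1).
    by apply/funext => t; rewrite /cpoisson herglotzE.
  by apply: KMul; [apply: KMul; [exact: KCst|exact: KSin]|exact: KInv].
Qed.

End kernels.

Section distributions.
Variables (R : realType) (Y : normedModType R[i]).

(* Continuity is for the Frechet topology of the seminorms
   g |-> sup_t |g^(j)(t)|; the hypothesis on [h] says that these are at most
   [d] at h - g for j <= k. *)
Definition test_distribution : set (test_fun R -> Y) :=
  [set f | linear f /\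
    forall (g : test_fun R) (e : R), 0 < e ->
      exists (k : nat) (d : R), 0 < d /\
        forall h : test_fun R,
          (forall j t, (j <= k)%N -> `|test_derive j (h - g) t| <= d%:C) ->
          rnorm (f h - f g) < e].

Definition convol (k : R -> R) (f : test_fun R -> Y) (t : R) : Y :=
  f (to_test (fun s => (k (t - s))%:C)).

Definition hardyT_norm (p : R) (f : test_fun R -> Y) : \bar R :=
  ereal_sup [set ((\int[lebesgue_measure]_(t in @period_itv R)
                     (rnorm (convol (poisson r) f t) `^ p
                      + rnorm (convol (cpoisson r) f t) `^ p)%:E) `^ p^-1)%E
            | r in `[0, 1[%classic].

Definition hardyT (p : R) : set (test_fun R -> Y) :=
  [set f | test_distribution f /\ (hardyT_norm p f < +oo)%E].

Definition even_dist (f : test_fun R -> Y) : Prop :=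
  forall g, f (reflect_fun g) = f g.

Definition odd_dist (f : test_fun R -> Y) : Prop :=
  forall g, f (reflect_fun g) = - f g.

Definition hardyTe (p : R) : set (test_fun R -> Y) :=
  [set f | hardyT p f /\ even_dist f].

Definition hardyTo (p : R) : set (test_fun R -> Y) :=
  [set f | hardyT p f /\ odd_dist f].

Definition periodic_integral (f : R -> R[i]) : R[i] :=
  (\int[lebesgue_measure]_(t in @period_itv R) complex.Re (f t))
  +i* (\int[lebesgue_measure]_(t in @period_itv R) complex.Im (f t)).

(* The distribution g |-> int_I f g of f : t |-> phi(t) x. The Bochner integral
   of f g is the scalar integral of phi g, times x. *)
Definition fun_dist (phi : R -> R) (x : Y) : test_fun R -> Y :=
  fun g => periodic_integral (fun t => (phi t)%:C * val g t) *: x.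

Definition cos_monomial (n : nat) (x : Y) : test_fun R -> Y :=
  fun_dist (fun t => cos (2 * pi * n%:R * t)) x.

Definition sin_monomial (n : nat) (x : Y) : test_fun R -> Y :=
  fun_dist (fun t => sin (2 * pi * n%:R * t)) x.

End distributions.

(* Main.v *)
Require Import Defs.
From mathcomp Require Import all_boot all_order all_algebra.
From mathcomp Require Import all_classical all_reals all_analysis.
From mathcomp Require Import complex.
From mathcomp Require Import ring lra zify.

(* Write F(z) = sum a_n z^n and z = r e^(2 pi i t). The Poisson and conjugate Poisson means of
   sum a_n cos(2 pi n t) are A = (F(z) + F(conj z)) / 2 and B = (F(z) - F(conj z)) / (2 i);
   those of sum a_n sin(2 pi n t) are B and - A. As F(z) = A + i B and t^p is subadditive,
   the H_p norms on the disc and on the torus are equivalent.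
   It remains to see that F |-> sum a_n cos(2 pi n t) is a bijection. On the disc side, a
   function in H_p has Taylor coefficients of polynomial growth, so that the trigonometric
   series is a distribution. On the torus side, the Fourier coefficients of a distribution
   grow polynomially, so that they are the Taylor coefficients of a function on the disc, and
   the Fourier series of a test function converges to it with all its derivatives, so that a
   distribution is the sum of its Fourier series. *)

Set Implicit Arguments.
Unset Strict Implicit.
Unset Printing Implicit Defensive.

Import Order.TTheory GRing.Theory Num.Theory.
Import numFieldNormedType.Exports.

Local Open Scope complex_scope.
Local Open Scope ring_scope.
Local Open Scope classical_set_scope.

(** Analyticity only provides local power series. Averages over roots of unity take the place of
    Cauchy's formula, both in the coefficient estimates and in the passage from local series to one
    Taylor series on the whole disc. For p < 1 the H_p norm does not bound the coefficients
    directly, because the mean of |F| is not controlled by the mean of |F|^p alone. It is after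
    multiplication by a (1-p)-th power of a majorant of |F|; this leads to an inequality between
    majorants on two circles in which the larger one occurs with an exponent below 1, and such an
    inequality improves itself to a bound by a power of 1/(1-r). On the torus side Fourier
    convergence is extracted from the Poisson kernel itself: its expansion in powers of r has an
    explicit remainder, bounded uniformly in the order of truncation. The same expansion, read as an
    identity between test functions, gives the Poisson means of a distribution as power series in r.
    The even and the odd case share one proof, indexed by a boolean that selects sines. *)

Lemma realC_inj (R : realType) (r s : R) : r%:C = s%:C -> r = s.
Proof. by case. Qed.

Lemma le_of_eq (R : realType) (x y : R) : x = y -> x <= y.
Proof. by move->. Qed.

(** * Absolute values of complex numbers and roots of unity *)

Section norms.
Variable R : realType.
Implicit Types (z w : R[i]) (r s t : R).

Definition cabs z : R := complex.Re `|z|.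

Lemma cabsE z : `|z| = (cabs z)%:C.
Proof. by rewrite /cabs normc_def. Qed.

Lemma cabs_ge0 z : 0 <= cabs z.
Proof. by rewrite -lecR -cabsE; exact: normr_ge0. Qed.

Lemma cabsM z w : cabs (z * w) = cabs z * cabs w.
Proof. by apply: realC_inj; rewrite -cabsE normrM !cabsE rmorphM. Qed.

Lemma cabsX z n : cabs (z ^+ n) = cabs z ^+ n.
Proof. by apply: realC_inj; rewrite -cabsE normrX !cabsE rmorphXn. Qed.

Lemma cabs_real r : cabs r%:C = `|r|.
Proof. by rewrite /cabs normc_def /= expr0n addr0 sqrtr_sqr. Qed.

Lemma cabsD z w : cabs (z + w) <= cabs z + cabs w.
Proof. by rewrite -lecR -cabsE rmorphD/= -!cabsE ler_normD. Qed.

Lemma cabsN z : cabs (- z) = cabs z.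
Proof. by rewrite /cabs normrN. Qed.

Lemma cabs0 : cabs 0 = 0.
Proof. by rewrite /cabs normr0. Qed.

Lemma cabs_nat n : cabs n%:R = n%:R.
Proof. by rewrite -(rmorph_nat (real_complex R)) cabs_real normr_nat. Qed.

Lemma cabs_cis t : cabs (cis t) = 1.
Proof. by rewrite /cabs normc_cis. Qed.

Lemma cabs_polar r t : 0 <= r -> cabs (r%:C * cis t) = r.
Proof. by move=> r0; rewrite cabsM cabs_cis mulr1 cabs_real ger0_norm. Qed.

Lemma normc_lt1 z : (`|z| < 1) = (cabs z < 1).
Proof. by rewrite cabsE -ltcR. Qed.

Lemma cisD s t : cis (s + t) = cis s * cis t.
Proof.
by rewrite /cis mulrDr cosD sinD; simpc; congr (_ +i* _); rewrite addrC.
Qed.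

Lemma cis0 : cis 0 = 1 :> R[i].
Proof. by rewrite /cis mulr0 cos0 sin0. Qed.

Lemma cis_natM n t : cis (n%:R * t) = cis t ^+ n.
Proof.
elim: n => [|n IH]; first by rewrite mul0r cis0.
by rewrite exprS -IH -cisD mulrSr mulrDl mul1r addrC.
Qed.

Lemma cis1 : cis 1 = 1 :> R[i].
Proof. by have := cisD1 (0 : R); rewrite add0r cis0. Qed.

Lemma cis_nat n : cis n%:R = 1 :> R[i].
Proof. by rewrite -[n%:R]mulr1 cis_natM cis1 expr1n. Qed.

(** If [cis x = 1] then [cos (2 pi x) = 1], and the double-angle formula forces [sin (pi x) = 0],
    which is impossible for [0 < x < 1]. *)
Lemma cis_neq1 k N : (0 < k < N)%N -> cis (k%:R / N%:R) != 1 :> R[i].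
Proof.
move=> /andP[k0 kN].
have N0 : 0 < N%:R :> R by rewrite ltr0n (leq_trans _ kN).
apply/eqP => -[+ _].
have -> : 2 * pi * (k%:R / N%:R) = (pi * (k%:R / N%:R)) *+ 2 :> R.
  by rewrite mulr2n; ring.
rewrite cos_mulr2n => h.
have s0 : 0 < sin (pi * (k%:R / N%:R) : R).
  apply: sin_gt0_pi; apply/andP; split.
    by rewrite mulr_gt0 ?pi_gt0// divr_gt0// ltr0n.
  by rewrite gtr_pMr ?pi_gt0// ltr_pdivrMr// mul1r ltr_nat.
have := sin2cos2 (pi * (k%:R / N%:R) : R).
have -> : cos (pi * (k%:R / N%:R) : R) ^+ 2 = 1.
  by move: h; rewrite -mulr_natl; lra.
by rewrite subrr => /eqP; rewrite sqrf_eq0 => /eqP s00; move: s0; rewrite s00 ltxx.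
Qed.

Lemma cis_sum k N : (0 < k < N)%N ->
  \sum_(j < N) cis (k%:R / N%:R) ^+ j = 0 :> R[i].
Proof.
move=> kN; have := subrX1 (cis (k%:R / N%:R) : R[i]) N.
rewrite -cis_natM mulrCA divff ?mulr1 ?cis_nat ?subrr; last first.
  by rewrite pnatr_eq0; lia.
by move=> /esym/eqP; rewrite mulf_eq0 subr_eq0 (negbTE (cis_neq1 kN)) => /eqP.
Qed.

End norms.

(** * Real-valued norm and series in a normed space *)

Section rnorm.
Variables (R : realType) (Y : normedModType R[i]).
Implicit Types (x y : Y) (u : nat -> Y).

Lemma rnormE y : `|y| = (rnorm y)%:C.
Proof.
by have := normr_ge0 y; rewrite /rnorm; case: `|y| => a b /=; rewrite lecE/= => /andP[/eqP->].
Qed.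

Lemma rnorm_ge0 y : 0 <= rnorm y.
Proof. by rewrite -lecR -rnormE; exact: normr_ge0. Qed.

Lemma rnormD x y : rnorm (x + y) <= rnorm x + rnorm y.
Proof. by rewrite -lecR rmorphD/= -!rnormE ler_normD. Qed.

Lemma rnormN y : rnorm (- y) = rnorm y.
Proof. by rewrite /rnorm normrN. Qed.

Lemma rnormB x y : rnorm (x - y) = rnorm (y - x).
Proof. by rewrite -rnormN opprB. Qed.

Lemma rnormZ (a : R[i]) y : rnorm (a *: y) = cabs a * rnorm y.
Proof. by apply: realC_inj; rewrite -rnormE normrZ rmorphM/= -rnormE cabsE. Qed.

Lemma rnorm0 : rnorm (0 : Y) = 0.
Proof. by rewrite /rnorm normr0. Qed.

Lemma rnorm_eq0 y : rnorm y = 0 -> y = 0.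
Proof. by move=> y0; apply/eqP; rewrite -normr_eq0 rnormE y0. Qed.

Lemma rnorm_sum (I : Type) (s : seq I) (P : pred I) (F : I -> Y) :
  rnorm (\sum_(i <- s | P i) F i) <= \sum_(i <- s | P i) rnorm (F i).
Proof.
elim/big_rec2: _ => [|i a b _ h]; first by rewrite rnorm0.
by rewrite (le_trans (rnormD _ _))// lerD2l.
Qed.

Lemma rnorm_dist x y : `|rnorm x - rnorm y| <= rnorm (x - y).
Proof.
have a := rnormD (x - y) y; have b := rnormD (y - x) x.
rewrite !subrK in a b; rewrite rnormB in b.
move: (rnorm (x - y)) (rnorm x) (rnorm y) a b => c d e a b.
by rewrite ler_norml; apply/andP; split; lra.
Qed.

Lemma cvg_rnormP u l :
  u @ \oo --> l <-> forall e : R, 0 < e ->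
    exists N, forall n, (N <= n)%N -> rnorm (u n - l) <= e.
Proof.
split=> [/cvgrPdist_le ul e e0|H].
- have := ul e%:C; rewrite ltcR => /(_ e0)[N _ HN].
  by exists N => n /HN /=; rewrite rnormE lecR rnormB.
- apply/cvgrPdist_le => e e0; have [r er] : exists r : R, e = r%:C.
    by apply/complex_realP/gtr0_real.
  rewrite er ltcR in e0; have [N HN] := H r e0.
  by exists N => //= n Nn; rewrite /= rnormE er lecR rnormB HN.
Qed.

Lemma cvg_rnorm_le u l (N0 : nat) (M : R) : u @ \oo --> l ->
  (forall n, (N0 <= n)%N -> rnorm (u n) <= M) -> rnorm l <= M.
Proof.
move=> /cvg_rnormP ul uM; apply/ler_addgt0Pr => e e0; have [N HN] := ul e e0.
have := HN _ (leq_maxl N N0); have := uM _ (leq_maxr N N0).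
have := rnormD (u (maxn N N0)) (l - u (maxn N N0)).
by rewrite addrC subrK rnormB; lra.
Qed.

Lemma cvg_rnorm u l : u @ \oo --> l -> (rnorm (u n) @[n --> \oo] --> rnorm l).
Proof.
move=> /cvg_rnormP ul; apply/cvgrPdist_le => e /ul[N HN].
by exists N => // n /HN/=; rewrite distrC; apply: le_trans; exact: rnorm_dist.
Qed.

Definition sums (a : nat -> Y) (l : Y) := series a n @[n --> \oo] --> l.

Lemma sums_unique a l l' : sums a l -> sums a l' -> l = l'.
Proof. by apply: cvg_unique; exact: norm_hausdorff. Qed.

Lemma sums_eq a b l : a =1 b -> sums a l -> sums b l.
Proof. by move=> /funext->. Qed.

Lemma sumsD a b l m : sums a l -> sums b m -> sums (fun n => a n + b n) (l + m).
Proof.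
move=> al bm; have -> : (fun n => a n + b n) = a + b by [].
by rewrite /sums seriesD; exact: cvgD.
Qed.

Lemma sumsZ (c : R[i]) a l : sums a l -> sums (fun n => c *: a n) (c *: l).
Proof.
move=> al; rewrite /sums; have -> : series (fun n => c *: a n) = (fun n => c *: series a n).
  by apply/funext => n; rewrite /series/= scaler_sumr.
exact: cvgZl_tmp al.
Qed.

Lemma sumsN a l : sums a l -> sums (fun n => - a n) (- l).
Proof.
by move=> /(sumsZ (c := -1)); rewrite scaleN1r; apply: sums_eq => n; rewrite scaleN1r.
Qed.

Lemma sums_finite a N : (forall n, (N <= n)%N -> a n = 0) ->
  sums a (\sum_(n < N) a n).
Proof.
move=> aN; apply/cvg_rnormP => e e0; exists N => n Nn.
rewrite /series/= (big_cat_nat (leq0n _) Nn)//= big_mkord.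
rewrite addrAC subrr add0r big_nat_cond big1 ?rnorm0 ?ltW// => i.
by rewrite andbT => /andP[Ni _]; exact: aN.
Qed.

End rnorm.

(** * Numerical series with bounded partial sums *)

Definition bsum (R : realType) (b : nat -> R) :=
  exists B, forall N, \sum_(n < N) b n <= B.

Section bsum.
Variable R : realType.
Implicit Types b c : nat -> R.

Lemma bsum_tail b : (forall n, 0 <= b n) -> bsum b -> forall e : R, 0 < e ->
  exists N, forall M, (N <= M)%N -> \sum_(N <= n < M) b n <= e.
Proof.
move=> b0 [B hB] e e0.
have nd : {homo series b : n m / (n <= m)%N >-> n <= m}.
  move=> n m nm; rewrite /series/= (big_cat_nat (leq0n _) nm)//= lerDl.
  exact: sumr_ge0.
have cb : cvgn (series b).
  apply: nondecreasing_is_cvgn => //; exists B => _ [n _ <-].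
  by rewrite /series/= big_mkord.
have [N _ HN] := (cvgrPdist_le _ _).1 cb e e0.
exists N => M NM; have := HN N (leqnn N); have := nondecreasing_cvgn_le nd cb M.
rewrite /=; set L := lim _; rewrite /series/= (big_cat_nat (leq0n _) NM)//= => h1.
by move=> /(le_trans (ler_norm _)); lra.
Qed.

Lemma bsum_le b c : (forall n, b n <= c n) -> bsum c -> bsum b.
Proof.
move=> bc [B hB]; exists B => N; apply: le_trans (hB N); exact: ler_sum.
Qed.

Lemma bsumZ (k : R) b : 0 <= k -> bsum b -> bsum (fun n => k * b n).
Proof. by move=> k0 [B hB]; exists (k * B) => N; rewrite -mulr_sumr ler_wpM2l. Qed.

Lemma bsumD b c : bsum b -> bsum c -> bsum (fun n => b n + c n).
Proof. by move=> [B hB] [C hC]; exists (B + C) => N; rewrite big_split lerD. Qed.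

Lemma geo_sum_le (s : R) N : 0 <= s < 1 -> \sum_(n < N) s ^+ n <= (1 - s)^-1.
Proof.
move=> /andP[s0 s1]; have s1' : 0 < 1 - s by rewrite subr_gt0.
rewrite -[leRHS]mul1r ler_pdivlMr//.
have := subrX1 s N; have : 0 <= s ^+ N by exact: exprn_ge0.
by move=> h1 h2; move: (\sum_(n < N) s ^+ n) h2 => S h2; nra.
Qed.

Lemma bsum_geo (s : R) : 0 <= s < 1 -> bsum (fun n => s ^+ n).
Proof. by move=> s01; exists (1 - s)^-1 => N; exact: geo_sum_le. Qed.

Lemma bsum_bounded b : (forall n, 0 <= b n) -> bsum b -> exists M, forall n, b n <= M.
Proof.
move=> b0 [B hB]; exists B => n; apply: le_trans (hB n.+1).
by rewrite big_ord_recr/= lerDr sumr_ge0.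
Qed.

(** Bernoulli's inequality. *)
Lemma one_sub_expn m (x : R) : 0 <= x <= 1 -> 1 - x *+ m <= (1 - x) ^+ m.
Proof.
move=> x01; elim: m => [|m IH]; first by rewrite mulr0n subr0.
have := IH; rewrite exprS mulrSr; have : 0 <= x *+ m by rewrite mulrn_wge0; lra.
by move: (x *+ m) ((1 - x) ^+ m) x01 => a b /andP[] *; nra.
Qed.

(* [(n+1)^k r^n = ((n+1) s^n)^k s^n * (r / s^(k+1))^n] with [s < 1], [r <= s^(k+1)] *)
Lemma bsum_poly_geo (k : nat) (r : R) : 0 <= r < 1 ->
  bsum (fun n => n.+1%:R ^+ k * r ^+ n).
Proof.
move=> /andP[r0 r1]; pose s := 1 - (1 - r) / k.+1%:R.
have k0 : 0 < k.+1%:R :> R by rewrite ltr0n.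
have d0 : 0 < (1 - r) / k.+1%:R by rewrite divr_gt0// subr_gt0.
have d1 : (1 - r) / k.+1%:R <= 1.
  by rewrite ler_pdivrMr// mul1r (le_trans (y := 1))// ?ler1n//; lra.
have s01 : 0 <= s < 1 by rewrite /s; move: ((1 - r) / _) d0 d1 => d d0 d1; lra.
have rs : r <= s ^+ k.+1.
  apply: le_trans (one_sub_expn _ _); last by rewrite d1 ltW.
  by rewrite -[_ *+ _]mulr_natr divfK ?gt_eqF//; lra.
case/andP: s01 => s0 s1.
have bd n : n.+1%:R * s ^+ n <= (1 - s)^-1.
  apply: le_trans (geo_sum_le n.+1 _); last by rewrite s0.
  have -> : n.+1%:R = \sum_(i < n.+1) 1 :> R by rewrite sumr_const card_ord.
  rewrite mulr_suml.
  by apply: ler_sum => i _; rewrite mul1r ler_wiXn2l// ?ltW// -ltnS.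
apply: bsum_le (bsumZ (k := (1 - s)^-1 ^+ k) _ (bsum_geo (s := s) _)) => [n||]; last 2 first.
  by rewrite exprn_ge0// invr_ge0 subr_ge0 ltW.
  by rewrite s0.
have : r ^+ n <= (s ^+ n) ^+ k * s ^+ n.
  by rewrite -exprSr exprAC lerXn2r ?nnegrE ?exprn_ge0.
move=> /(ler_wpM2l (exprn_ge0 k (ler0n R n.+1))) /le_trans; apply.
rewrite mulrA -exprMn ler_wpM2r ?exprn_ge0//.
apply: lerXn2r; rewrite ?nnegrE//; first by rewrite mulr_ge0 ?exprn_ge0.
by rewrite invr_ge0 subr_ge0 ltW.
Qed.

End bsum.

Section dominated.
Variables (R : realType) (Y : completeNormedModType R[i]).

Lemma dom_sums (a : nat -> Y) (b : nat -> R) :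
  (forall n, rnorm (a n) <= b n) -> bsum b -> exists l, sums a l.
Proof.
move=> ab sb; have b0 n : 0 <= b n by apply: le_trans (ab n); exact: rnorm_ge0.
suff : cvgn (series a) by move=> h; exists (limn (series a)).
apply/cauchy_cvgP/cauchy_seriesP => e e0.
have [r er] : exists r : R, e = r%:C by apply/complex_realP/gtr0_real.
move: e0; rewrite er ltcR => r0.
have [N HN] := bsum_tail b0 sb (e := r / 2) ltac:(lra).
exists ([set n | (N <= n)%N], [set n | (N <= n)%N]).
  by split; exists N.
move=> [n m] /= [Nn Nm]; rewrite rnormE ltcR.
apply: le_lt_trans (rnorm_sum _ _ _) _.
apply: (@le_lt_trans _ _ (r / 2)); last by lra.
have [nm|/ltnW mn] := leqP n m; last by rewrite big_geq// ltW//; lra.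
apply: le_trans (HN m Nm); rewrite [leRHS](big_cat_nat Nn nm)//=.
by rewrite -[leLHS]add0r lerD ?sumr_ge0// ler_sum.
Qed.

End dominated.

Lemma sums_tail_le (R : realType) (Y : normedModType R[i]) (a : nat -> Y) l (b : nat -> R) N T :
  sums a l -> (forall n, rnorm (a n) <= b n) ->
  (forall M, (N <= M)%N -> \sum_(N <= n < M) b n <= T) ->
  rnorm (l - \sum_(n < N) a n) <= T.
Proof.
move=> al ab bT.
have h : series a n - \sum_(n < N) a n @[n --> \oo] --> l - \sum_(n < N) a n.
  by apply: cvgB al _; exact: cvg_cst.
apply: (cvg_rnorm_le (N0 := N) h) => n Nn.
rewrite /series/= (big_cat_nat (leq0n _) Nn)//= big_mkord addrAC subrr add0r.
apply: le_trans (rnorm_sum _ _ _) _; apply: le_trans (bT n Nn).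
by apply: ler_sum.
Qed.

Lemma sums_le (R : realType) (Y : normedModType R[i]) (a : nat -> Y) l (b : nat -> R) B :
  sums a l -> (forall n, rnorm (a n) <= b n) ->
  (forall M, \sum_(n < M) b n <= B) -> rnorm l <= B.
Proof.
move=> al ab bB; have := sums_tail_le (N := 0) (T := B) al ab.
by rewrite big_ord0 subr0; apply => M _; rewrite big_mkord.
Qed.

(** * Power series in a Banach space *)

Section cis_lipschitz.
Variable R : realType.
Implicit Types (s t : R) (z : R[i]).

Lemma lipschitz_of_derive (u du : R -> R) (M : R) :
  (forall t, is_derive t 1 u (du t)) -> (forall t, `|du t| <= M) ->
  forall s t, `|u s - u t| <= M * `|s - t|.
Proof.
move=> D dM; suff H s t : s < t -> `|u s - u t| <= M * `|s - t|.
  move=> s t; have [/H//|/H|->] := ltgtP s t; first by rewrite distrC [`|t - s|]distrC.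
  by rewrite !subrr normr0 mulr0.
move=> st; have [|c _ E] := @MVT _ u du s t st (fun x _ => D x).
  by apply: derivable_within_continuous => x _; exact: ex_derive.
by rewrite distrC E distrC normrM ler_wpM2r.
Qed.

Lemma cos_lipschitz s t : `|cos s - cos t| <= `|s - t|.
Proof.
rewrite -[leRHS]mul1r; apply: (@lipschitz_of_derive cos (fun t => - sin t)) => x.
by rewrite normrN ler_norml sin_geN1 sin_le1.
Qed.

Lemma sin_lipschitz s t : `|sin s - sin t| <= `|s - t|.
Proof.
rewrite -[leRHS]mul1r; apply: (@lipschitz_of_derive sin cos) => x.
by rewrite ler_norml cos_geN1 cos_le1.
Qed.

Lemma cabs_le_ReIm z : cabs z <= `|complex.Re z| + `|complex.Im z|.
Proof.
case: z => x y /=; have -> : x +i* y = x%:C + 'i * y%:C by simpc.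
apply: le_trans (cabsD _ _) _; rewrite cabsM !cabs_real.
have -> : cabs 'i = 1 :> R by rewrite /cabs normc_def /= expr0n expr1n add0r sqrtr1.
by rewrite mul1r.
Qed.

Lemma cis_lipschitz s t : cabs (cis s - cis t) <= 4 * pi * `|s - t|.
Proof.
apply: le_trans (cabs_le_ReIm _) _ => /=.
have -> : 4 * pi * `|s - t| = `|2 * pi * s - 2 * pi * t| + `|2 * pi * s - 2 * pi * t|.
  by rewrite -mulrBr normrM [`|2 * pi|]ger0_norm ?mulr_ge0 ?pi_ge0//; ring.
by apply: lerD; [exact: cos_lipschitz|exact: sin_lipschitz].
Qed.

(** [acos] determines the angle up to sign, and the sign of the imaginary part decides between [t]
    and [1 - t]. Keeping [t] in [[0, 1]] prepares a compactness argument over the circle. *)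
Lemma polarE z : exists2 t : R, 0 <= t <= 1 & z = (cabs z)%:C * cis t.
Proof.
have [z0|z0] := eqVneq (cabs z) 0.
  exists 0; first by rewrite lexx ler01.
  by rewrite z0 mul0r; apply/eqP; rewrite -normr_eq0 cabsE z0.
have zp : 0 < cabs z by rewrite lt0r z0 cabs_ge0.
pose w := z / (cabs z)%:C.
have zC : (cabs z)%:C != 0 :> R[i] by apply: contraNneq z0 => -[->].
have w1 : cabs w = 1.
  by rewrite /w cabsM -[RHS](mulfV z0); congr (_ * _); rewrite -fmorphV cabs_real ger0_norm// invr_ge0 ltW.
suff [t t01 wt] : exists2 t : R, 0 <= t <= 1 & w = cis t.
  by exists t; rewrite // -wt /w mulrC divfK.
have : (complex.Re w) ^+ 2 + (complex.Im w) ^+ 2 = 1.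
  by apply: realC_inj; rewrite add_Re2_Im2 cabsE w1 expr1n.
case: w {w1} => x y /= xy.
have x1 : -1 <= x <= 1 by have := sqr_ge0 y; nra.
have pi0 : 0 < pi :> R by exact: pi_gt0.
have a0 : 0 <= acos x by exact: acos_ge0.
have a1 : acos x <= pi by exact: acos_lepi.
have sa : sin (acos x) ^+ 2 = y ^+ 2 by rewrite sin2cos2 acosK//; lra.
have sa0 : 0 <= sin (acos x) by apply: sin_ge0_pi; rewrite a0 a1.
pose t := acos x / (2 * pi).
have tE : 2 * pi * t = acos x by rewrite /t mulrC divfK// mulf_neq0// gt_eqF.
have t0 : 0 <= t by rewrite divr_ge0// mulr_ge0// ltW.
have t1 : t <= 1 by rewrite ler_pdivrMr ?mulr_gt0// mul1r; lra.
have [y0|y0] := leP 0 y.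
  exists t; first by rewrite t0 t1.
  by rewrite /cis tE acosK//; congr (_ +i* _); apply/eqP; rewrite -(@eqrXn2 _ 2)//; apply/eqP.
exists (1 - t); first by rewrite subr_ge0 t1 lerBlDr lerDl t0.
rewrite addrC cisD1 /cis mulrN cosN sinN tE acosK//; congr (_ +i* _).
apply/eqP; rewrite eq_sym eqr_oppLR -(@eqrXn2 _ 2)// ?oppr_ge0 ?ltW//.
by rewrite sqrrN; apply/eqP.
Qed.

End cis_lipschitz.

Lemma cvg_sum_nat (R : realType) (f : nat -> nat -> R) (l : nat -> R) K :
  (forall k, f k n @[n --> \oo] --> l k) ->
  \sum_(k < K) f k n @[n --> \oo] --> \sum_(k < K) l k.
Proof.
move=> fl; elim: K => [|K IH].
  by rewrite big_ord0; under eq_cvg do rewrite big_ord0; exact: cvg_cst.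
by rewrite big_ord_recr; under eq_cvg do rewrite big_ord_recr; exact: cvgD.
Qed.

Lemma exprD_binom (A : comNzRingType) (z u : A) n K : (n < K)%N ->
  (z + u) ^+ n = \sum_(k < K) 'C(n, k)%:R * z ^+ (n - k) * u ^+ k.
Proof.
move=> nK; rewrite exprDn (big_ord_widen K (fun k => z ^+ (n - k) * u ^+ k *+ 'C(n, k)))//.
rewrite big_mkcond; apply: eq_bigr => i _.
by case: ltnP => [_|ni]; rewrite -?mulrA ?mulr_natl// bin_small// mul0r.
Qed.

Section power_series.
Variables (R : realType) (Y : completeNormedModType R[i]).
Implicit Types (a b c : nat -> Y) (z h u : R[i]) (r s t : R).

Definition psum a z (l : Y) := sums (fun n => z ^+ n *: a n) l.

Definition absr a s := bsum (fun n => rnorm (a n) * s ^+ n).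

Lemma rnorm_term a z n : rnorm (z ^+ n *: a n) = rnorm (a n) * cabs z ^+ n.
Proof. by rewrite rnormZ cabsX mulrC. Qed.

Lemma absr_le a s r : 0 <= r <= s -> absr a s -> absr a r.
Proof.
move=> /andP[r0 rs]; apply: bsum_le => n; rewrite ler_wpM2l ?rnorm_ge0//.
by rewrite lerXn2r// nnegrE (le_trans r0).
Qed.

Lemma absr_psum a s z : cabs z <= s -> absr a s -> exists l, psum a z l.
Proof.
move=> zs as_; apply: (@dom_sums _ _ _ (fun n => rnorm (a n) * cabs z ^+ n)).
  by move=> n; rewrite rnorm_term.
by apply: absr_le as_; rewrite cabs_ge0.
Qed.

(** Abel's lemma: the terms at radius [r] are at most [M (r / s)^n]. *)
Lemma bounded_absr a s r M : (forall n, rnorm (a n) * s ^+ n <= M) ->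
  0 <= r < s -> absr a r.
Proof.
move=> aM /andP[r0 rs]; have s0 : 0 < s by exact: le_lt_trans rs.
have M0 : 0 <= M by apply: le_trans (aM 0%N); rewrite mulr_ge0 ?rnorm_ge0 ?exprn_ge0// ltW.
apply: bsum_le (bsumZ M0 (bsum_geo (s := r / s) _)) => [n|]; last first.
  by rewrite divr_ge0 ?(ltW s0)//= ltr_pdivrMr// mul1r.
rewrite expr_div_n mulrA ler_pdivlMr ?exprn_gt0//.
by rewrite mulrAC ler_wpM2r ?exprn_ge0.
Qed.

Lemma psum_bounded a z l : psum a z l -> exists M, forall n, rnorm (a n) * cabs z ^+ n <= M.
Proof.
move=> /cvg_rnormP /(_ 1 ltr01) [N HN].
have S0 n : 0 <= \sum_(i < n) rnorm (a i) * cabs z ^+ i.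
  by apply: sumr_ge0 => i _; rewrite mulr_ge0 ?exprn_ge0 ?cabs_ge0 ?rnorm_ge0.
(* The first [N] terms are bounded by their sum; a later term is a difference of two partial sums at
   distance at most 1 from the limit, hence the 2. *)
exists (\sum_(i < N) rnorm (a i) * cabs z ^+ i + 2) => n; rewrite -rnorm_term.
have [nN|Nn] := ltnP n N.
  rewrite rnorm_term (bigD1 (Ordinal nN))//= -addrA lerDl addr_ge0//.
  by apply: sumr_ge0 => i _; rewrite mulr_ge0 ?exprn_ge0 ?cabs_ge0 ?rnorm_ge0.
have := HN _ (leqW Nn); have := HN _ Nn; have := S0 N.
set S := \sum_(i < N) _; rewrite [series _ n.+1]seriesSr.
set T := series _ n; set x := _ *: _ => s0 h1 h2.
have := rnormD (T + x - l) (l - T).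
rewrite [T + x - l]addrAC [rnorm (l - T)]rnormB in h2 *.
have -> : T - l + x + (l - T) = x by rewrite addrAC -[T - l]opprB addNr add0r.
by lra.
Qed.

(** Any truncation [K] is allowed: the terms are nonnegative, and the binomial coefficients vanish
    for [k > n]. *)
Lemma binom_partial_le (x y : R) K n : 0 <= x -> 0 <= y ->
  \sum_(k < K) 'C(n, k)%:R * x ^+ (n - k) * y ^+ k <= (x + y) ^+ n.
Proof.
move=> x0 y0; pose f k := 'C(n, k)%:R * x ^+ (n - k) * y ^+ k.
have f0 k : 0 <= f k by rewrite /f !mulr_ge0 ?exprn_ge0.
have -> : (x + y) ^+ n = \sum_(0 <= k < n.+1) f k.
  rewrite exprDn big_mkord; apply: eq_bigr => i _.
  by rewrite /f -mulr_natl mulrA.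
rewrite -(big_mkord xpredT f).
have [Kn|nK] := leqP K n.+1.
  by rewrite (big_cat_nat (leq0n _) Kn)//= lerDl sumr_ge0.
rewrite (big_cat_nat (leq0n _) (ltnW nK))//= gerDl.
rewrite big_nat_cond big1// => i /andP[/andP[ni _] _].
by rewrite /f bin_small// !mul0r.
Qed.

(** Expanding [(h + u)^n] and exchanging the sums is legitimate because
    [sum_k C(n, k) |h|^(n - k) s'^k <= s^n], so the double series converges absolutely. The same [B]
    bounds the new coefficients at radius [s'], which makes the estimate uniform in the new
    centre. *)
Lemma recenter b s h (s' B : R) : 0 < s' -> cabs h + s' <= s ->
  (forall N, \sum_(n < N) rnorm (b n) * s ^+ n <= B) ->
  exists c, [/\ forall k, sums (fun n => ('C(n, k)%:R * h ^+ (n - k)) *: b n) (c k),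
    forall k, rnorm (c k) * s' ^+ k <= B &
    forall u l, cabs u <= s' -> psum b (h + u) l -> psum c u l].
Proof.
move=> s'0 hs bB.
pose D k n := ('C(n, k)%:R * h ^+ (n - k)) *: b n.
have D0 k n : rnorm (D k n) * s' ^+ k = rnorm (b n) * ('C(n, k)%:R * cabs h ^+ (n - k) * s' ^+ k).
  by rewrite rnormZ cabsM cabs_nat cabsX mulrAC mulrC.
have DK K n : \sum_(k < K) rnorm (D k n) * s' ^+ k <= rnorm (b n) * s ^+ n.
  under eq_bigr do rewrite D0.
  rewrite -mulr_sumr ler_wpM2l ?rnorm_ge0//.
  apply: le_trans (binom_partial_le _ _ (cabs_ge0 _) (ltW s'0)) _.
  by rewrite lerXn2r// nnegrE ?addr_ge0 ?cabs_ge0 ?(le_trans _ hs)// ?addr_ge0 ?cabs_ge0// ltW.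
have D1 k n : rnorm (D k n) <= (s' ^+ k)^-1 * (rnorm (b n) * s ^+ n).
  rewrite ler_pdivlMl ?exprn_gt0// mulrC; apply: le_trans (DK k.+1 n).
  rewrite big_ord_recr/= lerDr sumr_ge0// => i _.
  by rewrite mulr_ge0 ?rnorm_ge0// exprn_ge0// ltW.
have bs : bsum (fun n => rnorm (b n) * s ^+ n) by exists B.
have b0 n : 0 <= rnorm (b n) * s ^+ n.
  by rewrite mulr_ge0 ?rnorm_ge0// exprn_ge0// (le_trans _ hs)// addr_ge0 ?cabs_ge0// ltW.
have /choice[c cD] : forall k, exists l, sums (D k) l.
  move=> k; apply: (dom_sums (D1 k)); apply: bsumZ bs.
  by rewrite invr_ge0 exprn_ge0// ltW.
(* For the partial sums of the inner series the bound follows by exchanging two finite sums; it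
   passes to the limit for each [K], with a [T] that does not depend on [K]. *)
have tail K N T : (forall M, (N <= M)%N -> \sum_(N <= n < M) rnorm (b n) * s ^+ n <= T) ->
    \sum_(k < K) rnorm (c k - \sum_(n < N) D k n) * s' ^+ k <= T.
  move=> HT.
  have L : (\sum_(k < K) rnorm (series (D k) M - \sum_(n < N) D k n) * s' ^+ k) @[M --> \oo]
      --> \sum_(k < K) rnorm (c k - \sum_(n < N) D k n) * s' ^+ k.
    apply: (@cvg_sum_nat _ (fun k M => rnorm (series (D k) M - \sum_(n < N) D k n) * s' ^+ k)
      (fun k => rnorm (c k - \sum_(n < N) D k n) * s' ^+ k)) => k.
    apply: cvgMr_tmp; apply: cvg_rnorm.
    by apply: cvgB (cD k) _; exact: cvg_cst.
  rewrite -(cvg_lim _ L)//; apply: limr_le; first by apply/cvg_ex; eexists; exact: L.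
  exists N => // M /= NM; apply: le_trans (HT M NM).
  apply: (@le_trans _ _ (\sum_(k < K) \sum_(N <= n < M) rnorm (D k n) * s' ^+ k)).
    apply: ler_sum => k _; rewrite -mulr_suml ler_wpM2r ?exprn_ge0 ?(ltW s'0)//.
    rewrite /series/= (big_cat_nat (leq0n _) NM)//= big_mkord addrAC subrr add0r.
    exact: rnorm_sum.
  by rewrite exchange_big/= ler_sum// => n _; exact: DK.
exists c; split=> // [k|u l us bl].
  have := tail k.+1 0%N B; rewrite big_ord_recr/= big_ord0 subr0 => H.
  apply: le_trans (H _) => [|M _]; last by rewrite big_mkord.
  by rewrite lerDr sumr_ge0// => i _; rewrite mulr_ge0 ?rnorm_ge0// exprn_ge0// ltW.
apply/cvg_rnormP => e e0.
have [N1 HN1] := bsum_tail b0 bs (e := e / 2) ltac:(lra).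
have [N2 HN2] := (cvg_rnormP _ _).1 bl (e / 2) ltac:(lra).
pose N := maxn N1 N2; have NN1 : (N1 <= N)%N by exact: leq_maxl.
exists N => K NK.
(* As [N <= K], the binomial expansion of each order [n < N] is complete, so this exchange of finite
   sums is exact. *)
have E : \sum_(k < K) u ^+ k *: \sum_(n < N) D k n = \sum_(n < N) (h + u) ^+ n *: b n.
  under eq_bigr do rewrite scaler_sumr.
  rewrite exchange_big/=; apply: eq_bigr => n _.
  rewrite (exprD_binom _ _ (leq_trans (ltn_ord n) NK)) scaler_suml.
  by apply: eq_bigr => k _; rewrite /D scalerA mulrC.
rewrite /series/= big_mkord.
have -> : \sum_(k < K) u ^+ k *: c k - l =
    \sum_(k < K) u ^+ k *: (c k - \sum_(n < N) D k n) + (\sum_(n < N) (h + u) ^+ n *: b n - l).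
  rewrite addrA; congr (_ - _); rewrite -E -big_split/=.
  by apply: eq_bigr => k _; rewrite -scalerDr subrK.
apply: le_trans (rnormD _ _) _.
have h2 := HN2 N (leq_maxr _ _); rewrite /series/= big_mkord in h2.
have h1 : rnorm (\sum_(k < K) u ^+ k *: (c k - \sum_(n < N) D k n)) <= e / 2.
  apply: le_trans (tail K N (e / 2) _) => [|M NM]; last first.
    apply: le_trans (HN1 M (leq_trans NN1 NM)).
    rewrite [leRHS](big_cat_nat NN1 NM)//= lerDr; exact: sumr_ge0.
  apply: le_trans (rnorm_sum _ _ _) _; apply: ler_sum => k _.
  rewrite rnormZ cabsX mulrC ler_wpM2l ?rnorm_ge0//.
  by rewrite lerXn2r ?nnegrE ?cabs_ge0// ltW.
by lra.
Qed.

(** Orthogonality of the [N]-th roots of unity: for [m < N] with [m != n] the factors sum to 0. The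
    starting angle [t] stays free so that one can later integrate over it. *)
Lemma coef_roots a N n t r : (n < N)%N ->
  N%:R *: ((r ^+ n)%:C *: a n) = \sum_(j < N) cis (- (n%:R * (t + j%:R / N%:R))) *:
    \sum_(m < N) (r%:C * cis (t + j%:R / N%:R)) ^+ m *: a m.
Proof.
move=> nN; have N0 : (0 < N)%N by exact: leq_trans nN.
have N0' : N%:R != 0 :> R by rewrite pnatr_eq0 -lt0n.
under eq_bigr do rewrite scaler_sumr.
rewrite exchange_big/= (bigD1 (Ordinal nN))//= [X in _ + X]big1 ?addr0; last first.
  move=> m mn; under eq_bigr do rewrite scalerA.
  rewrite -scaler_suml.
  suff -> : \sum_(j < N) cis (- (n%:R * (t + j%:R / N%:R))) *
      (r%:C * cis (t + j%:R / N%:R)) ^+ m = 0 by rewrite scale0r.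
  have E j : cis (- (n%:R * (t + j%:R / N%:R))) * (r%:C * cis (t + j%:R / N%:R)) ^+ m =
      r%:C ^+ m * cis ((m%:R - n%:R) * t) * cis (j%:R * ((m%:R - n%:R) / N%:R)).
    rewrite exprMn -cis_natM mulrCA -!mulrA -!cisD; congr (_ * cis _).
    by rewrite mulrBl; ring.
  under eq_bigr do rewrite E.
  rewrite -mulr_sumr; suff -> : \sum_(j < N) cis (j%:R * ((m%:R - n%:R) / N%:R)) = 0 :> R[i].
    by rewrite mulr0.
  have /orP[nm|mn'] : (n < m)%N || (m < n)%N.
    by rewrite -neq_ltn eq_sym; apply: contraNneq mn => nm; apply/eqP/val_inj.
    rewrite -natrB; last exact: ltnW.
    under eq_bigr do rewrite cis_natM.
    by apply: cis_sum; rewrite subn_gt0 nm (leq_ltn_trans (leq_subr _ _)).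
  (* For [m < n] the exponent [m - n] is negative; adding [N] to it changes nothing, because [cis]
     has period 1, and leads back to [cis_sum]. *)
  have E2 j : cis (j%:R * ((m%:R - n%:R) / N%:R)) = cis ((N - (n - m))%N%:R / N%:R) ^+ j :> R[i].
    rewrite -cis_natM !natrB//; [|exact: ltnW|by rewrite (leq_trans (leq_subr _ _))// ltnW].
    have -> : j%:R * ((N%:R - (n%:R - m%:R)) / N%:R) = j%:R * ((m%:R - n%:R) / N%:R) + j%:R :> R.
      rewrite opprB addrC [X in _ * (X / _)]addrC mulrDl divff// mulrDr mulr1.
      by rewrite [in LHS]addrC.
    by rewrite cisD cis_nat mulr1.
  under eq_bigr do rewrite E2.
  apply: cis_sum; rewrite subn_gt0 (leq_ltn_trans (leq_subr _ _))//=.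
  by rewrite ltn_subrL N0 subn_gt0 mn'.
under eq_bigr => j _.
  rewrite scalerA exprMn -cis_natM mulrCA -cisD addNr cis0 mulr1 -rmorphXn.
  over.
by rewrite sumr_const card_ord scaler_nat.
Qed.

(* Cauchy's estimate by averages over roots of unity, which need no Banach-valued integral. *)
Lemma coef_mean a r (G : R -> Y) n : 0 <= r -> absr a r ->
  (forall t, psum a (r%:C * cis t) (G t)) ->
  forall e : R, 0 < e -> exists2 N, (0 < N)%N &
  forall t, rnorm (a n) * r ^+ n <= N%:R^-1 * \sum_(j < N) rnorm (G (t + j%:R / N%:R)) + e.
Proof.
move=> r0 ar aG e e0.
have b0 m : 0 <= rnorm (a m) * r ^+ m by rewrite mulr_ge0 ?rnorm_ge0 ?exprn_ge0.
have [N0 HN0] := bsum_tail b0 ar e0.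
(* [N > n] lets the roots of unity isolate [a n]; [N >= N0] makes the neglected tail at most [e]. *)
pose N := maxn N0 n.+1; have nN : (n < N)%N by exact: leq_maxr.
have N_gt0 : (0 < N)%N by exact: leq_trans nN.
have NR : 0 < N%:R :> R by rewrite ltr0n.
exists N => // t.
rewrite -(ler_pM2l NR) mulrDr [N%:R * (N%:R^-1 * _)]mulrA mulfV ?gt_eqF// mul1r.
have -> : N%:R * (rnorm (a n) * r ^+ n) = rnorm (N%:R *: ((r ^+ n)%:C *: a n) : Y).
  by rewrite !rnormZ cabs_nat cabs_real ger0_norm ?exprn_ge0// [r ^+ n * _]mulrC.
rewrite (coef_roots _ t _ nN); apply: le_trans (rnorm_sum _ _ _) _.
rewrite mulr_natl -[N in X in _ + X]card_ord -sumr_const -big_split/=.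
apply: ler_sum => j _; rewrite rnormZ cabs_cis mul1r.
set x := t + _; have -> : \sum_(m < N) (r%:C * cis x) ^+ m *: a m =
  G x - (G x - \sum_(m < N) (r%:C * cis x) ^+ m *: a m) by rewrite opprB addrC subrK.
apply: le_trans (rnormD _ _) _; rewrite lerD2l rnormN.
apply: (sums_tail_le (b := fun m => rnorm (a m) * r ^+ m) (aG x)) => [m|M NM].
  by rewrite rnorm_term cabs_polar.
have N0N : (N0 <= N)%N by exact: leq_maxl.
apply: le_trans (HN0 M (leq_trans N0N NM)).
by rewrite [leRHS](big_cat_nat N0N NM)//= lerDr sumr_ge0.
Qed.

Lemma coef_bound a r (G : R -> Y) M n : 0 <= r -> absr a r ->
  (forall t, psum a (r%:C * cis t) (G t)) -> (forall t, rnorm (G t) <= M) ->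
  rnorm (a n) * r ^+ n <= M.
Proof.
move=> r0 ar aG GM; apply/ler_addgt0Pr => e e0.
have [N N0 HN] := coef_mean n r0 ar aG e0.
apply: le_trans (HN 0) _; rewrite lerD2r ler_pdivrMl ?ltr0n// mulr_natl.
rewrite -[N in X in _ <= X]card_ord -sumr_const.
by apply: ler_sum => j _; exact: GM.
Qed.

(** Cauchy's estimate for the coefficients [a n - b n], whose series sums to 0 on the circle of
    radius [s]. *)
Lemma psum_unique a b s : 0 < s -> absr a s -> absr b s ->
  (forall z, cabs z = s -> exists l, psum a z l /\ psum b z l) -> a = b.
Proof.
move=> s0 as_ bs H; apply/funext => n.
suff : rnorm (a n - b n) * s ^+ n <= 0.
  rewrite pmulr_lle0 ?exprn_gt0// => ab0; apply/eqP; rewrite -subr_eq0; apply/eqP.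
  by apply: rnorm_eq0; apply/eqP; rewrite eq_le ab0 rnorm_ge0.
apply: (@coef_bound (fun n => a n - b n) s (fun=> 0)); [exact: ltW| | |by move=> t; rewrite rnorm0].
  apply: bsum_le (bsumD as_ bs) => m; rewrite -mulrDl ler_wpM2r ?exprn_ge0 ?(ltW s0)//.
  by rewrite (le_trans (rnormD _ _))// rnormN.
move=> t; have [|l [la lb]] := H (s%:C * cis t); first by rewrite cabs_polar// ltW.
rewrite -(subrr l); apply: sums_eq (sumsD la (sumsN lb)) => m.
by rewrite scalerBr.
Qed.

End power_series.

(** * Analytic functions on the disc *)

Section analytic_continuation.
Variables (R : realType) (Y : completeNormedModType R[i]).
Variable F : R[i] -> Y.
Implicit Types (a b c : nat -> Y) (z w u : R[i]) (r s t : R).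

(** A quantitative expansion about [z]: the radius [d] and the bound [M] are parameters so that
    compactness can make them uniform. The disc of radius [d] may leave the unit disc, where nothing
    is claimed. *)
Definition good_at d M z := exists c, (forall k, rnorm (c k) * d ^+ k <= M) /\
  forall z', cabs z' < 1 -> cabs (z' - z) < d -> psum c (z' - z) (F z').

Definition local_series w := exists (c : nat -> Y) (d : R), 0 < d /\
  forall z, cabs z < 1 -> cabs (z - w) < d -> psum c (z - w) (F z).

Hypothesis F_local : forall w, cabs w < 1 -> local_series w.

Lemma good_at_mono d M d' M' z : 0 < d' -> d' <= d -> M <= M' ->
  good_at d M z -> good_at d' M' z.
Proof.
move=> d'0 dd MM [c [cM cF]]; exists c; split=> [k|z' z1 zz].
  apply: le_trans MM; apply: le_trans (cM k); rewrite ler_wpM2l ?rnorm_ge0//.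
  by rewrite lerXn2r// nnegrE ltW// (lt_le_trans d'0).
by apply: cF => //; exact: lt_le_trans dd.
Qed.

Lemma good_near w : cabs w < 1 -> exists d M, 0 < d /\
  forall z, cabs (z - w) <= d -> good_at d M z.
Proof.
move=> w1; have [c [d [d0 cF]]] := F_local w1.
(* [e] is below [d] and below the distance from [w] to the unit circle, so the series converges at
   [w + e], hence absolutely at radius [e / 2]; this leaves [e / 4] for the shift of the centre and
   [e / 4] for the new radius. *)
pose e := Num.min d (1 - cabs w) / 2.
have m0 : 0 < Num.min d (1 - cabs w) by rewrite lt_min d0 subr_gt0.
have e0 : 0 < e by rewrite /e divr_gt0.
have e2 : e < Num.min d (1 - cabs w) by rewrite /e; lra.
move: e2; rewrite lt_min => /andP[ed ew].
have [B HB] : absr c (e / 2).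
  have ce : psum c (w + e%:C - w) (F (w + e%:C)).
    have ee : cabs e%:C = e :> R by rewrite cabs_real ger0_norm// ltW.
    apply: cF; last by rewrite addrAC subrr add0r ee.
    by apply: le_lt_trans (cabsD _ _) _; rewrite ee; lra.
  rewrite addrAC subrr add0r in ce; have [M HM] := psum_bounded ce.
  by apply: (bounded_absr HM); rewrite cabs_real gtr0_norm//; lra.
exists (e / 4), B; split=> [|z zw]; first by lra.
have [||c' [_ c'B c'F]] := @recenter _ _ c (e / 2) (z - w) (e / 4) B _ _ HB; [lra|lra|].
exists c'; split=> // z' z'1 zz'; apply: c'F; first exact: ltW.
have E : z' - w = z - w + (z' - z) by rewrite [RHS]addrC addrA subrK.
rewrite -E; apply: cF => //; rewrite E.
by apply: le_lt_trans (cabsD _ _) _; lra.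
Qed.

Lemma good_circle r : 0 <= r < 1 -> exists d M, 0 < d /\
  forall t z, 0 <= t <= 1 -> cabs (z - r%:C * cis t) <= d -> good_at d M z.
Proof.
move=> /andP[r0 r1].
(* One integer encodes both the radius [1 / (n + 1)] and the bound [n]. The condition weakens as [n]
   grows, so compactness of [[0, 1]] in its covering form yields a common [n]. *)
pose P (n : nat) t := forall z, cabs (z - r%:C * cis t) <= n.+1%:R^-1 ->
  good_at n.+1%:R^-1 n%:R z.
have /compact_near_coveringP/near_covering_withinP K := @segment_compact R 0 1.
have [|N _ HN] := K nat \oo P _ _.
  move=> t t01; have [|d [M [d0 dM]]] := @good_near (r%:C * cis t).
    by rewrite cabs_polar.
  have pi0 : 0 < pi :> R by exact: pi_gt0.
  (* [4 pi] is a Lipschitz constant of [cis]: changing the angle by [eta] moves the point by at most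
     [d / 2]. *)
  pose eta := d / (8 * pi).
  have eta0 : 0 < eta by rewrite divr_gt0// mulr_gt0.
  have [N1 _ H1] : \forall n \near \oo, (n.+1%:R^-1 : R) <= d / 2.
    have d2 : 0 < d / 2 by lra.
    apply: filterS (near_infty_natSinv_lt (PosNum d2)) => n.
    exact: ltW.
  have [N2 _ H2] := nbhs_infty_ger M.
  exists ([set s | `|t - s| < eta], [set n | (maxn N1 N2 <= n)%N]).
    by split; [exists eta|exists (maxn N1 N2)].
  move=> [s n] /= [st]; rewrite geq_max => /andP[n1 n2] _ z zs.
  have hd : n.+1%:R^-1 <= d / 2 := H1 n n1.
  apply: (good_at_mono (d := d) (M := M)); [by rewrite invr_gt0| |exact: H2|].
    by apply: le_trans hd _; lra.
  apply: dM; have -> : z - r%:C * cis t = (z - r%:C * cis s) + r%:C * (cis s - cis t).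
    by rewrite mulrBr addrA subrK.
  apply: le_trans (cabsD _ _) _; rewrite cabsM cabs_real ger0_norm//.
  have cl := cis_lipschitz s t; rewrite distrC in cl.
  have : 4 * pi * `|t - s| <= d / 2.
    apply: (@le_trans _ _ (4 * pi * eta)); first by rewrite ler_wpM2l ?mulr_ge0 ?pi_ge0// ltW.
    apply: le_of_eq; rewrite /eta; move: (@pi R) pi0 => x x0.
    by field; exact: lt0r_neq0.
  have rx := ler_piMl (cabs_ge0 (cis s - cis t)) (ltW r1).
  have zd := le_trans zs hd.
  move=> h; apply: le_trans (lerD zd (le_trans rx (le_trans cl h))) _.
  by rewrite -splitr.
exists N.+1%:R^-1, N%:R; split=> [|t z t01]; first by rewrite invr_gt0.
apply: (HN N (leqnn _)) => //=.
Qed.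

Definition global a r := forall z, cabs z < r -> psum a z (F z).

Lemma global_absr a r s : r <= 1 -> global a r -> 0 <= s < r -> absr a s.
Proof.
move=> r1 gr /andP[s0 sr]; pose m := (s + r) / 2.
have m0 : 0 <= m by rewrite /m; lra.
have /gr/psum_bounded[M HM] : cabs (m%:C : R[i]) < r.
  by rewrite cabs_real ger0_norm// /m; lra.
apply: (bounded_absr HM); rewrite cabs_real ger0_norm// s0 /m; lra.
Qed.

(* Weierstrass: let [q < r] be close to [r]. At the points [z1] of the circle of radius [q] the
   Taylor coefficients [c_k = sum_n C(n, k) a_n z1^(n - k)] of [F] satisfy [|c_k| d0^k <= M] with
   [d0] independent of [q]. Averaging over [z1] gives [C(n, k) |a_n| q^(n - k) d0^k <= M],
   and the binomial formula bounds [|a_n| (q + d0 / 2)^n], where [q + d0 / 2 > r]. *)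
Lemma global_extend a r : 0 < r < 1 -> global a r ->
  exists r', [/\ r < r', r' <= 1 & global a r'].
Proof.
move=> /andP[r0 r1] ar.
have [|d0 [M [d00 Hgood]]] := @good_circle r; first by rewrite ltW.
(* With [eta] at most [d0 / 4] and [r / 4], the radius [q = r - eta] is positive, the coefficients
   are summable at [q + eta / 2 < r], and [q + d0 / 2 > r]. *)
pose eta := Num.min d0 r / 4.
have mm0 : 0 < Num.min d0 r by rewrite lt_min d00.
have etad : eta <= d0 / 4 by rewrite /eta ler_pM2r ?invr_gt0// ge_min lexx.
have etar : eta <= r / 4 by rewrite /eta ler_pM2r ?invr_gt0// ge_min lexx orbT.
have eta0 : 0 < eta by rewrite /eta divr_gt0.
pose q := r - eta; have q0 : 0 < q by rewrite /q; lra.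
pose D z k n := ('C(n, k)%:R * z ^+ (n - k)) *: a n.
have key t : 0 <= t <= 1 -> exists c, [/\ forall k, sums (D (q%:C * cis t) k) (c k),
    forall k, rnorm (c k) * d0 ^+ k <= M &
    forall z, cabs z < 1 -> cabs (z - q%:C * cis t) < d0 -> psum c (z - q%:C * cis t) (F z)].
  move=> t01; pose z1 := q%:C * cis t.
  have [|c [cM cF]] := Hgood t z1 t01.
    rewrite /z1 -mulrBl -rmorphB/= cabsM cabs_cis mulr1 cabs_real.
    by rewrite /q addrAC subrr add0r normrN ger0_norm ?ltW//; lra.
  have [|B HB] := @global_absr a r (q + eta / 2) (ltW r1) ar; first by rewrite /q; lra.
  have [||c' [c'D c'B c'F]] := @recenter _ _ a (q + eta / 2) z1 (eta / 2) B _ _ HB.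
  - by lra.
  - by rewrite cabs_polar// ltW.
  (* Two expansions about [z1]: [c] comes from compactness with a uniform bound, [c'] from
     recentring with a formula in terms of [a]. They have the same sums on a small circle. *)
  suff E : c = c' by exists c; split=> //; rewrite E.
  apply: (@psum_unique _ _ _ _ (eta / 4)); first by lra.
  - apply: (bounded_absr cM); lra.
  - apply: (bounded_absr c'B); lra.
  move=> u uE; exists (F (z1 + u)).
  have zu : cabs (z1 + u) < r.
    by apply: le_lt_trans (cabsD _ _) _; rewrite uE cabs_polar ?ltW// /q; lra.
  split; last by apply: c'F; [rewrite uE; lra|exact: ar].
  have := cF (z1 + u); rewrite addrAC subrr add0r; apply; first exact: lt_trans r1.
  by rewrite uE; lra.
have bnd n k : (k <= n)%N -> 'C(n, k)%:R * rnorm (a n) * q ^+ (n - k) * d0 ^+ k <= M.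
  move=> kn.
  (* As a function of the centre, the [k]-th coefficient is itself a power series, with coefficients
     [C(m + k, k) a_(m + k)]; Cauchy's estimate is applied to it on the circle of radius [q]. *)
  have /choice[t2c ht2c] : forall t, exists l,
      psum (fun m => 'C(m + k, k)%:R *: a (m + k)%N) (q%:C * cis t) l
      /\ rnorm l <= M / d0 ^+ k.
    move=> t; have [t' t'01] := polarE (q%:C * cis t).
    rewrite cabs_polar ?ltW// => tt'; have [c [cD cM _]] := key t' t'01.
    exists (c k); split; last by rewrite ler_pdivlMr ?exprn_gt0.
    rewrite tt'; have := cD k; rewrite /psum /sums.
    rewrite -(cvg_shiftn k); apply: cvg_trans; apply: near_eq_cvg.
    apply: nearW => m /=.
    rewrite /series/= (big_cat_nat (leq0n k) (leq_addl m k))//= big_nat_cond big1 ?add0r.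
      rewrite -[X in \sum_(X <= _ < _) _]add0n big_addn addnK.
      by apply: eq_bigr => i _; rewrite /D addnK scalerA mulrC.
    by move=> i /andP[/andP[_ ik] _]; rewrite /D bin_small// mul0r scale0r.
  have := @coef_bound _ _ (fun m => 'C(m + k, k)%:R *: a (m + k)%N) q t2c (M / d0 ^+ k) (n - k) (ltW q0).
  rewrite subnK// rnormZ cabs_nat => H.
  rewrite -ler_pdivlMr ?exprn_gt0//; apply: H; [|by move=> t; case: (ht2c t)..].
  have [|B HB] := @global_absr a r (q + eta / 2) (ltW r1) ar; first by rewrite /q; lra.
  exists (B / (eta / 2) ^+ k) => N.
  have e20 : 0 < eta / 2 by lra.
  rewrite ler_pdivlMr ?exprn_gt0// mulr_suml.
  apply: le_trans (HB (N + k)%N).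
  rewrite -[leRHS](big_mkord xpredT (fun n => rnorm (a n) * (q + eta / 2) ^+ n)).
  rewrite (big_cat_nat (leq0n k) (leq_addl N k))//=.
  rewrite -[X in _ <= _ + \sum_(X <= _ < _) _]add0n big_addn addnK !big_mkord.
  rewrite -[leLHS]add0r lerD ?sumr_ge0//.
    by move=> i _; rewrite mulr_ge0 ?rnorm_ge0 ?exprn_ge0//; lra.
  apply: ler_sum => i _; rewrite rnormZ cabs_nat.
  have -> : 'C(i + k, k)%:R * rnorm (a (i + k)%N) * q ^+ i * (eta / 2) ^+ k =
    rnorm (a (i + k)%N) * ('C(i + k, k)%:R * q ^+ i * (eta / 2) ^+ k) by ring.
  rewrite ler_wpM2l ?rnorm_ge0//.
  have := @binom_partial_le _ q (eta / 2) k.+1 (i + k) (ltW q0) (ltW e20).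
  rewrite big_ord_recr/= addnK; apply: le_trans.
  by rewrite lerDr sumr_ge0// => j _; rewrite !mulr_ge0 ?exprn_ge0// ltW.
have an n : rnorm (a n) * (q + d0 / 2) ^+ n <= 2 * M.
  rewrite (exprD_binom _ _ (ltnSn n)) mulr_sumr.
  have M0 : 0 <= M.
    apply: le_trans (bnd 0 0 _)%N => //.
    by rewrite !mulr_ge0 ?rnorm_ge0 ?exprn_ge0// ltW.
  (* The [k]-th term of the binomial formula contributes at most [M / 2^k], hence the factor 2. *)
  apply: (@le_trans _ _ (M * \sum_(k < n.+1) 2^-1 ^+ k)).
    rewrite mulr_sumr; apply: ler_sum => k _.
    have -> : rnorm (a n) * ('C(n, k)%:R * q ^+ (n - k) * (d0 / 2) ^+ k) =
      'C(n, k)%:R * rnorm (a n) * q ^+ (n - k) * d0 ^+ k * 2^-1 ^+ k by rewrite exprMn; ring.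
    apply: ler_wpM2r; first by rewrite exprn_ge0.
    by apply: bnd; rewrite -ltnS.
  rewrite [2 * M]mulrC ler_wpM2l//.
  apply: le_trans (geo_sum_le _ _) _; first by lra.
  by apply/le_of_eq; field.
pose r' := Num.min 1 (q + d0 / 2).
exists r'; split; [by rewrite lt_min r1 /q/=; lra|by rewrite ge_min lexx|].
move=> z; rewrite lt_min => /andP[z1 zq].
have [/ar//|rz] := ltP (cabs z) r.
have az : absr a (cabs z) by apply: (bounded_absr an); rewrite cabs_ge0.
have [l al] := absr_psum (lexx _) az.
(* The centre [w] is taken on the ray through [z], so that [|w| + |z - w| = |z|] and recentring
   requires summability at [|z|] only. *)
have [t t01 zE] := polarE z; have [c [cD cM cF]] := key t t01.
have [B HB] := az; pose w := q%:C * cis t.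
have zw : cabs (z - w) = cabs z - q.
  rewrite [z in LHS]zE /w -mulrBl -rmorphB cabsM cabs_cis mulr1 cabs_real ger0_norm//.
  by rewrite /q; lra.
have [||c' [c'D c'B c'F]] := @recenter _ _ a (cabs z) w (cabs z - q) B _ _ HB.
- by rewrite /q; lra.
- by rewrite (cabs_polar _ (ltW q0)); lra.
have cc' : c = c' by apply/funext => k; exact: sums_unique (cD k) (c'D k).
have : psum c (z - w) (F z) by apply: cF => //; rewrite zw; lra.
rewrite cc' => Fz; have := c'F (z - w) l; rewrite zw [w + _]addrC subrK => /(_ (lexx _) al) lz.
by rewrite (sums_unique Fz lz).
Qed.

(** The supremum of the radii on which the series at 0 represents [F] is itself such a radius, and
    [global_extend] excludes that it is below 1. *)
Lemma global_series : exists a, global a 1.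
Proof.
have [|a [d [d0 ad]]] := @F_local 0; first by rewrite cabs0.
exists a; pose S := [set r : R | 0 < r <= 1 /\ global a r].
have Sm : S (Num.min d 1).
  split; first by rewrite lt_min d0 ltr01 ge_min lexx orbT.
  by move=> z; rewrite lt_min => /andP[zd z1]; have := ad z; rewrite subr0; exact.
have hs : has_sup S by split; [exists (Num.min d 1)|exists 1 => r [/andP[]]].
have m0 : 0 < Num.min d 1 :> R by rewrite lt_min d0 ltr01.
have s0 : 0 < sup S by apply: lt_le_trans m0 _; exact: sup_upper_bound.
have s1 : sup S <= 1 by apply: ge_sup; [exists (Num.min d 1)|move=> r [/andP[]]].
have gs : global a (sup S).
  by move=> z /(sup_gt (ex_intro _ _ Sm)) [r [_ gr] zr]; exact: gr.
have [s1'|s1'] := ltP (sup S) 1; last by have -> : 1 = sup S by apply/le_anti; rewrite s1 s1'.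
have [||r' [rr r1 gr]] := @global_extend a (sup S); [by rewrite s0|exact: gs|].
have : r' <= sup S by apply: sup_upper_bound => //; split=> //; rewrite r1 (lt_trans s0).
by rewrite leNgt rr.
Qed.

End analytic_continuation.

(** * Integrals over a period *)

Section period_integral.
Variable R : realType.
Implicit Types (u v U : R -> R) (s t : R).

Definition pint u : R := \int[lebesgue_measure]_(t in @period_itv R) u t.

Lemma half_lt : - 2^-1 < 2^-1 :> R.
Proof. by lra. Qed.

Lemma period_measurable : measurable (@period_itv R).
Proof. exact: measurable_itv. Qed.
#[local] Hint Resolve period_measurable : core.

Lemma period_measure : lebesgue_measure (@period_itv R) = 1%E.
Proof.
rewrite /period_itv lebesgue_measure_itv/= lte_fin half_lt -EFinB opprK.
by congr (_%:E); lra.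
Qed.

Lemma cont_integrable_cc u (a b : R) : continuous u ->
  lebesgue_measure.-integrable `[a, b] (EFin \o u).
Proof.
move=> cu; apply: continuous_compact_integrable; first exact: segment_compact.
exact: continuous_subspaceT.
Qed.

Lemma cont_integrable u : continuous u ->
  lebesgue_measure.-integrable (@period_itv R) (EFin \o u).
Proof.
move=> cu; apply: (integrableS _ _ _ (cont_integrable_cc (- 2^-1) (2^-1) cu)) => //; first [exact: subset_itv_co_cc|exact: measurable_itv].
Qed.

Lemma integral_pint u : continuous u ->
  (\int[lebesgue_measure]_(t in @period_itv R) (u t)%:E)%E = (pint u)%:E.
Proof.
move=> cu; rewrite /pint /Rintegral fineK//.
by apply: integrable_fin_num => //; exact: cont_integrable.
Qed.

Lemma pint_cc u : continuous u ->
  (\int[lebesgue_measure]_(t in `[(- 2^-1)%R, (2^-1)%R]) (u t)%:E)%E = (pint u)%:E.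
Proof.
move=> cu; rewrite -integral_pint// /period_itv; apply/esym.
apply: integral_itv_bndo_bndc; apply/measurable_realfun.measurable_EFinP.
by apply: measurable_funS (measurable_realfun.continuous_measurable_fun cu).
Qed.

Lemma pintZ (k : R) u : continuous u -> pint (fun t => k * u t) = k * pint u.
Proof. by move=> cu; rewrite /pint RintegralZl//; exact: cont_integrable. Qed.

Lemma pintD u v : continuous u -> continuous v ->
  pint (fun t => u t + v t) = pint u + pint v.
Proof. by move=> cu cv; rewrite /pint RintegralD//; exact: cont_integrable. Qed.

Lemma pint_cst (k : R) : pint (fun=> k) = k.
Proof. by rewrite /pint Rintegral_cst//= period_measure mulr1. Qed.

Lemma continuous_addf u v : continuous u -> continuous v -> continuous (fun t => u t + v t).
Proof. by move=> cu cv x; apply: cvgD; [exact: cu|exact: cv]. Qed.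

Lemma continuous_mulf u v : continuous u -> continuous v -> continuous (fun t => u t * v t).
Proof. by move=> cu cv x; apply: cvgM; [exact: cu|exact: cv]. Qed.

Lemma continuous_cstf (k : R) : continuous (fun _ : R => k).
Proof. by move=> x; exact: cvg_cst. Qed.

Lemma continuous_compf u v : continuous u -> continuous v -> continuous (fun t => u (v t)).
Proof. by move=> cu cv x; apply: continuous_comp; [exact: cv|exact: cu]. Qed.

Lemma continuous_sumf (f : nat -> R -> R) n : (forall i, continuous (f i)) ->
  continuous (fun t => \sum_(i < n) f i t).
Proof.
move=> cf; elim: n => [|n IH].
  by under [X in continuous X]funext do rewrite big_ord0; exact: continuous_cstf.
by under [X in continuous X]funext do rewrite big_ord_recr; exact: continuous_addf.
Qed.

Lemma continuous_shiftf s : continuous (fun t : R => t + s).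
Proof. by move=> x; apply: cvgD; [exact: cvg_id|exact: cvg_cst]. Qed.

Lemma pint_sum (f : nat -> R -> R) n : (forall i, continuous (f i)) ->
  pint (fun t => \sum_(i < n) f i t) = \sum_(i < n) pint (f i).
Proof.
move=> cf; elim: n => [|n IH].
  by under [X in pint X]funext do rewrite big_ord0; rewrite big_ord0 pint_cst.
under [X in pint X]funext do rewrite big_ord_recr.
rewrite pintD//; first by rewrite IH big_ord_recr.
exact: continuous_sumf.
Qed.

Lemma le_pint u v : continuous u -> continuous v -> (forall t, @period_itv R t -> u t <= v t) ->
  pint u <= pint v.
Proof.
move=> cu cv uv; rewrite /pint; apply: le_Rintegral => //; exact: cont_integrable.
Qed.

Lemma pint_le_bound u (M : R) : continuous u ->
  (forall t, `|t| <= 2^-1 -> `|u t| <= M) -> `|pint u| <= M.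
Proof.
move=> cu uM; have uI t : @period_itv R t -> `|u t| <= M.
  by rewrite /period_itv/= in_itv/= => /andP[t1 t2]; apply: uM; rewrite ler_norml t1 ltW.
 rewrite ler_norml -[M]pint_cst -[- pint _]mulN1r -pintZ; last exact: continuous_cstf.
apply/andP; split; apply: le_pint; rewrite ?pint_cst//.
- by apply: continuous_mulf; exact: continuous_cstf.
- by move=> t /uI; rewrite mulN1r; rewrite ler_norml => /andP[].
- exact: continuous_cstf.
- by move=> t /uI; rewrite ler_norml => /andP[].
Qed.

(** The derivative is assumed on a neighbourhood of the closed period, which supplies the one-sided
    continuity of [U] at the end points. *)
Lemma pint_FTC u U : continuous u -> (forall x : R, `|x| < 1 -> is_derive x 1 U (u x)) ->
  pint u = U 2^-1 - U (- 2^-1).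
Proof.
move=> cu dU; apply: EFin_inj; rewrite -pint_cc//.
have D (x : R) : -1 < x < 1 -> is_derive x 1 U (u x) by move=> x1; apply: dU; rewrite ltr_norml.
have C (x : R) : -1 < x < 1 -> {for x, continuous U}.
  move=> /D dx; apply/differentiable_continuous/derivable1_diffP; exact: ex_derive.
rewrite (@continuous_FTC2 _ u U); first by rewrite EFinB.
- exact: half_lt.
- exact: continuous_subspaceT.
- split.
  + move=> x; rewrite in_itv/= => /andP[x1 x2]; have := D x ltac:(lra) => dx; exact: ex_derive.
  + by apply: cvg_at_right_filter; apply: C; lra.
  + by apply: cvg_at_left_filter; apply: C; lra.
- move=> x; rewrite in_itv/= => /andP[x1 x2]; have := D x ltac:(lra) => dx.
  by rewrite derive1E derive_val.
Qed.

Lemma primitive u (A : R) : continuous u ->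
  exists U, forall x : R, `|x| < A -> is_derive x 1 U (u x).
Proof.
move=> cu; exists (fun x0 => \int[lebesgue_measure]_(t in `[- A, x0]) u t) => x.
rewrite ltr_norml => /andP[x1 x2].
have [dx dE] := @continuous_FTC1_closed _ u (- A) x A x2 (cont_integrable_cc _ _ cu) x1 (cu x).
by apply: DeriveDef; [exact: dx|rewrite -derive1E dE].
Qed.

Lemma derive0_eq U (a b : R) : a <= b -> (forall x : R, a <= x <= b -> is_derive x 1 U 0) ->
  U a = U b.
Proof.
rewrite le_eqVlt => /orP[/eqP->//|ab D].
have [||c _] := @MVT _ U (fun=> 0) a b ab.
- by move=> x; rewrite in_itv/= => /andP[x1 x2]; apply: D; rewrite !ltW.
- apply: derivable_within_continuous => x; rewrite in_itv/= => xab.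
  by have := D x xab => dx; exact: ex_derive.
- by rewrite mul0r => /eqP; rewrite subr_eq0 => /eqP.
Qed.

Lemma is_derive_shift1 U (x s d : R) : is_derive (x + s) 1 U d ->
  is_derive x 1 (fun t => U (t + s)) d.
Proof.
move=> dU.
have ds : is_derive x 1 (fun t : R => t + s) (1 + 0) by apply: is_deriveD.
have := @is_derive1_comp _ U (fun t => t + s) x _ _ dU ds.
by rewrite addr0 mulr1.
Qed.

(** For a primitive [U] of [u], periodicity makes the derivative of [U (t + 1) - U t] vanish. *)
Lemma pint_shift_ge0 u s : continuous u -> (forall t, u (t + 1) = u t) -> 0 <= s ->
  pint (fun t => u (t + s)) = pint u.
Proof.
move=> cu pu s0; have [U dU] := primitive (s + 3) cu.
have -> : pint u = U 2^-1 - U (- 2^-1).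
  by apply: pint_FTC => // x x1; apply: dU; rewrite (lt_trans x1)//; lra.
have -> : pint (fun t => u (t + s)) = U (2^-1 + s) - U (- 2^-1 + s).
  apply: (@pint_FTC _ (fun t => U (t + s))).
    by apply: continuous_compf => //; exact: continuous_shiftf.
  move=> x; rewrite ltr_norml => /andP[x1 x2]; apply: is_derive_shift1.
  by apply: dU; rewrite ltr_norml; apply/andP; split; lra.
have : U (- 2^-1 + 1) - U (- 2^-1) = U (- 2^-1 + s + 1) - U (- 2^-1 + s).
  apply: (@derive0_eq (fun t => U (t + 1) - U t)); first by rewrite lerDl.
  move=> x /andP[x1 x2]; rewrite -(subrr (u x)); apply: is_deriveB.
    by rewrite -(pu x); apply: is_derive_shift1; apply: dU; rewrite ltr_norml; apply/andP; split; lra.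
  by apply: dU; rewrite ltr_norml; apply/andP; split; lra.
have -> : - 2^-1 + 1 = 2^-1 :> R by lra.
by have -> : - 2^-1 + s + 1 = 2^-1 + s :> R by lra.
Qed.

Lemma pint_shift u s : continuous u -> (forall t, u (t + 1) = u t) ->
  pint (fun t => u (t + s)) = pint u.
Proof.
move=> cu pu; have [s0|s0] := leP 0 s; first exact: pint_shift_ge0.
rewrite -(@pint_shift_ge0 (fun t => u (t + s)) (- s)) ?oppr_ge0 ?ltW//.
- by congr pint; apply/funext => t; rewrite subrK.
- by apply: continuous_compf => //; exact: continuous_shiftf.
- by move=> t; rewrite addrAC pu.
Qed.

Lemma pint_reflect u : continuous u -> pint (fun t => u (- t)) = pint u.
Proof.
move=> cu; have [U dU] := primitive 1 cu.
rewrite (pint_FTC cu dU).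
have -> : U 2^-1 - U (- 2^-1) = - U (- 2^-1) - - U (- - 2^-1) by rewrite !opprK addrC.
apply: (@pint_FTC _ (fun t => - U (- t))).
  by apply: continuous_compf => // x; exact: oppr_continuous.
move=> x x1; have dx : is_derive (- x) 1 U (u (- x)) by apply: dU; rewrite normrN.
rewrite -[u _]opprK; apply: is_deriveN; rewrite -mulrN1.
exact: (@is_derive1_comp _ U -%R x).
Qed.

Lemma lipschitz_continuous u (L : R) : (forall s t, `|u s - u t| <= L * `|s - t|) -> continuous u.
Proof.
move=> uL x; apply/cvgrPdist_le => e e0.
have L0 : 0 <= L by have := uL 1 0; rewrite subr0 normr1 mulr1; apply: le_trans.
have k0 : 0 < e / (L + 1) by rewrite divr_gt0// ltr_wpDl.
near=> y; apply: le_trans (uL x y) _.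
have xy : `|x - y| <= e / (L + 1) by near: y; exact: (cvgrPdist_le _ _).1 (cvg_id) _ k0.
apply: le_trans (ler_wpM2l L0 xy) _.
by rewrite mulrA ler_pdivrMr ?ltr_wpDl//; lra.
Unshelve. all: by end_near. Qed.

End period_integral.

(** * Powers with exponent at most one *)

Section powR_sub.
Variable R : realType.
Implicit Types x y p : R.

(* [x / (x + y) <= (x / (x + y))^p] since both are at most 1. *)
Lemma powR_subadd x y p : 0 < p <= 1 -> 0 <= x -> 0 <= y ->
  (x + y) `^ p <= x `^ p + y `^ p.
Proof.
move=> /andP[p0 p1] x0 y0.
have [->|xn] := eqVneq x 0; first by rewrite add0r powR0 ?gt_eqF// add0r.
have [->|yn] := eqVneq y 0; first by rewrite addr0 powR0 ?gt_eqF// addr0.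
have {x0 xn}x0 : 0 < x by rewrite lt0r xn.
have {y0 yn}y0 : 0 < y by rewrite lt0r yn.
have s0 : 0 < x + y by rewrite addr_gt0.
have H z : 0 < z -> z <= x + y -> z / (x + y) * (x + y) `^ p <= z `^ p.
  move=> z0 zs; have -> : z `^ p = (z / (x + y)) `^ p * (x + y) `^ p.
    by rewrite -powRM ?divfK ?gt_eqF// ?divr_ge0// ltW.
  rewrite ler_wpM2r ?powR_ge0// ger1_powR//.
  by rewrite divr_gt0//= ler_pdivrMr// mul1r.
have := lerD (H x x0 ltac:(lra)) (H y y0 ltac:(lra)).
by rewrite -mulrDl -mulrDl divff ?mul1r// gt_eqF.
Qed.

(** A Hoelder modulus of continuity, obtained from subadditivity; it covers the point 0 as well. *)
Lemma powR_dist x y p : 0 < p <= 1 -> 0 <= x -> 0 <= y ->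
  `|x `^ p - y `^ p| <= `|x - y| `^ p.
Proof.
move=> p01; wlog xy : x y / x <= y.
  move=> H x0 y0; have [xy|yx] := leP x y; first exact: H.
  by rewrite distrC [`|x - y|]distrC; apply: H => //; exact: ltW.
move=> x0 y0; rewrite distrC [`|x - y|]distrC.
have yx0 : 0 <= y - x by rewrite subr_ge0.
rewrite (ger0_norm yx0) ger0_norm; last first.
  by rewrite subr_ge0 ge0_ler_powR// ?nnegrE//; case/andP: p01 => /ltW.
by rewrite lerBlDr -[in leLHS](subrK x y) powR_subadd.
Qed.

Lemma powR_comp_continuous (u : R -> R) p : 0 < p <= 1 -> continuous u ->
  (forall t, 0 <= u t) -> continuous (fun t => u t `^ p).
Proof.
move=> p01 cu u0 x; have p0 : 0 < p by case/andP: p01.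
apply/cvgrPdist_le => e e0.
have d0 : 0 < e `^ p^-1 by exact: powR_gt0.
near=> y; apply: le_trans (powR_dist p01 (u0 _) (u0 _)) _.
have xy : `|u x - u y| <= e `^ p^-1 by near: y; exact: (cvgrPdist_le _ _).1 (cu x) _ d0.
apply: (@le_trans _ _ ((e `^ p^-1) `^ p)).
  by apply: ge0_ler_powR; rewrite ?nnegrE// ltW.
by rewrite -powRrM mulVf ?gt_eqF// powRr1// ltW.
Unshelve. all: by end_near. Qed.

End powR_sub.

(** * Growth of Taylor coefficients in Hardy spaces *)

Section growth.
Variable R : realType.

(* With [A] the supremum of [B r (S - r)^k] over [r <= S] and [rho := (S + r) / 2],
   the hypothesis gives [A <= 2^k K A^(1-p)] as soon as [k p >= 1],
   uniformly in [S < 1]. *)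
Lemma growth_bound (B : R -> R) (K p : R) : 0 < p <= 1 -> 0 <= K ->
  (forall r, 0 <= r < 1 -> 0 <= B r) ->
  (forall r s, 0 <= r -> r <= s -> s < 1 -> B r <= B s) ->
  (forall r s, 0 <= r -> r < s -> s < 1 -> B r <= K / (s - r) * B s `^ (1 - p)) ->
  exists C k, forall r, 0 <= r < 1 -> B r <= C * (1 - r)^-1 ^+ k.
Proof.
move=> /andP[p0 p1] K0 B0 Bmono BK.
pose k := (Num.trunc p^-1).+1.
have kp : 1 <= k%:R * p.
  have : p^-1 <= k%:R by rewrite ltW// truncnS_gt.
  by move=> h; rewrite -[leLHS](mulVf (lt0r_neq0 p0)) ler_pM2r.
pose D := 2 ^+ k * K.
have D0 : 0 <= D by rewrite mulr_ge0 ?exprn_ge0.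
have main S r : 0 <= r -> r < S -> S < 1 -> B r * (S - r) ^+ k <= D `^ p^-1.
  move=> r0 rS S1; have S0 : 0 < S by exact: le_lt_trans rS.
  (* Stopping at [S < 1] makes the supremum finite a priori; the bound finally obtained does not
     depend on [S]. *)
  pose E := [set B x * (S - x) ^+ k | x in [set x | 0 <= x <= S]].
  have Eub : ubound E (B S).
    move=> _ [x + <-] /= => /andP[x0 xS].
    have Bx : B x <= B S by exact: Bmono.
    have Bx0 : 0 <= B x by apply: B0; rewrite x0 (le_lt_trans xS).
    have : (S - x) ^+ k <= 1 by rewrite exprn_ile1//; lra.
    have : 0 <= (S - x) ^+ k by rewrite exprn_ge0//; lra.
    by move: ((S - x) ^+ k) => y; nra.
  have En : E !=set0 by exists (B 0 * (S - 0) ^+ k), 0 => //=; rewrite lexx ltW.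
  pose A := sup E.
  have hE : has_sup E by split=> //; exists (B S).
  have AE x : 0 <= x -> x <= S -> B x * (S - x) ^+ k <= A.
    by move=> x0 xS; apply: sup_upper_bound => //; exists x => //=; rewrite x0.
  apply: le_trans (AE r r0 (ltW rS)) _.
  have A0 : 0 <= A.
    by apply: le_trans (AE r r0 (ltW rS)); rewrite mulr_ge0 ?B0 ?exprn_ge0 ?r0//; lra.
  have AD : A <= D * A `^ (1 - p).
    apply: ge_sup => // _ [x + <-] /= => /andP[x0].
    rewrite (le_eqVlt x) => /orP[/eqP->|xS].
      by rewrite subrr expr0n mulr0 mulr_ge0 ?powR_ge0.
    pose d := (S - x) / 2; have d0 : 0 < d by rewrite /d; lra.
    have d1 : d <= 1 by rewrite /d; lra.
    have sx : S - x = 2 * d by rewrite /d; field.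
    have := BK x (x + d) x0 ltac:(lra) ltac:(rewrite /d; lra).
    rewrite addrAC subrr add0r => h.
    have Bd : B (x + d) <= A * d ^- k.
      rewrite -[leRHS]/(A / d ^+ k) ler_pdivlMr ?exprn_gt0//.
      have := AE (x + d) ltac:(lra) ltac:(rewrite /d; lra).
      by have -> : S - (x + d) = d by rewrite /d; field.
    have Bp : B (x + d) `^ (1 - p) <= A `^ (1 - p) * (d ^+ k)^-1 `^ (1 - p).
      rewrite -powRM// ?invr_ge0 ?exprn_ge0 ?(ltW d0)//.
      apply: ge0_ler_powR; rewrite ?nnegrE ?subr_ge0// ?mulr_ge0 ?invr_ge0 ?exprn_ge0 ?(ltW d0)//.
      by apply: B0; rewrite /d; lra.
    apply: (@le_trans _ _ (K / d * (A `^ (1 - p) * (d ^+ k)^-1 `^ (1 - p)) * (S - x) ^+ k)).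
      rewrite ler_wpM2r ?exprn_ge0//; first by lra.
      by apply: le_trans h _; rewrite ler_wpM2l// divr_ge0// ltW.
    have -> : (S - x) ^+ k = 2 ^+ k * d ^+ k by rewrite sx; exact: exprMn.
    clearbody d.
    (* The total exponent of [d] is [- k (1 - p) - 1 + k = k p - 1 >= 0], and [d <= 1]. *)
    have E1 : (d ^+ k)^-1 `^ (1 - p) / d * d ^+ k <= 1.
      have -> : (d ^+ k)^-1 `^ (1 - p) / d * d ^+ k = d `^ (- k%:R * (1 - p) + -1 + k%:R).
        have dD v w : d `^ (v + w) = d `^ v * d `^ w by rewrite powRD// (lt0r_neq0 d0) implybT.
        by rewrite [d `^ (_ + k%:R)]dD [d `^ (_ + -1)]dD powRrM !powRN powR_mulrn ?powRr1// ltW.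
      apply: (@le_trans _ _ (d `^ 0)); last by rewrite powRr0.
      apply: ger_powR; first by rewrite d0.
      by rewrite mulrBr mulr1 mulNr opprK; lra.
    apply: (@le_trans _ _ (D * A `^ (1 - p) * ((d ^+ k)^-1 `^ (1 - p) / d * d ^+ k))).
      apply: le_of_eq; rewrite /D; ring.
    by rewrite ler_piMr// mulr_ge0 ?powR_ge0.
  (* If [A > 0], dividing by [A^(1 - p)] leaves [A^p <= D]. *)
  have [A00|An0] := eqVneq A 0; first by rewrite A00 powR_ge0.
  have Ap : 0 < A by rewrite lt0r An0.
  have : A `^ p <= D.
    have : A `^ p * A `^ (1 - p) <= D * A `^ (1 - p).
      by rewrite -powRD ?An0 ?implybT// addrC subrK powRr1.
    by rewrite ler_pM2r ?powR_gt0.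
  move=> /(@ge0_ler_powR _ p^-1 _ _ _); rewrite !nnegrE invr_ge0 ltW// powR_ge0 D0.
  by move=> /(_ isT isT isT); rewrite -powRrM mulfV ?gt_eqF// powRr1.
exists (D `^ p^-1 * 2 ^+ k), k => r /andP[r0 r1].
have := main ((1 + r) / 2) r r0 ltac:(lra) ltac:(lra).
have -> : (1 + r) / 2 - r = (1 - r) / 2 by field.
have r1' : 0 < 1 - r by lra.
rewrite expr_div_n mulrA ler_pdivrMr ?exprn_gt0// => h.
by rewrite exprVn ler_pdivlMr ?exprn_gt0.
Qed.

End growth.

Definition polybdd (R : realType) (Y : normedModType R[i]) (a : nat -> Y) :=
  exists (C : R) k, forall n, rnorm (a n) <= C * n.+1%:R ^+ k.

Section hardy_growth.
Variables (R : realType) (Y : completeNormedModType R[i]).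
Variables (a : nat -> Y) (F : R[i] -> Y).
Hypothesis aF : global F a 1.
Implicit Types (r s t : R) (z w : R[i]).

Lemma absr_lt1 r : 0 <= r < 1 -> absr a r.
Proof. exact: (global_absr (lexx _) aF). Qed.

(** [q ^+ n / q] stands for [q^(n - 1)] and avoids a predecessor at [n = 0]. *)
Lemma cabs_subX (q : R) z w n : 0 < q -> cabs z <= q -> cabs w <= q ->
  cabs (z ^+ n - w ^+ n) <= n%:R * q ^+ n / q * cabs (z - w).
Proof.
move=> q0 zq wq; elim: n => [|n IH].
  by rewrite subrr cabs0 !mulr_ge0 ?invr_ge0 ?exprn_ge0 ?cabs_ge0// ltW.
have -> : z ^+ n.+1 - w ^+ n.+1 = z * (z ^+ n - w ^+ n) + (z - w) * w ^+ n.
  by rewrite !exprS; ring.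
apply: le_trans (cabsD _ _) _; rewrite !cabsM cabsX.
have h1 : cabs z * cabs (z ^+ n - w ^+ n) <= q * (n%:R * q ^+ n / q * cabs (z - w)).
  by apply: ler_pM; rewrite ?cabs_ge0.
have h2 : cabs (z - w) * cabs w ^+ n <= cabs (z - w) * q ^+ n.
  by rewrite ler_wpM2l ?cabs_ge0// lerXn2r ?nnegrE ?cabs_ge0// ltW.
apply: le_trans (lerD h1 h2) _; apply/le_of_eq.
by rewrite -natr1 exprS; field; exact: lt0r_neq0.
Qed.

Lemma global_lipschitz r : 0 <= r < 1 -> exists L, forall z w, cabs z <= r -> cabs w <= r ->
  rnorm (F z - F w) <= L * cabs (z - w).
Proof.
(* With [r < q < s < 1], the coefficients are bounded at radius [s], and the factor [n q^(n - 1)] is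
   absorbed by the ratio [q / s]; [q] is positive even if [r = 0]. *)
move=> /andP[r0 r1]; pose q := (r + 1) / 2; pose s := (q + 1) / 2.
have q0 : 0 < q by rewrite /q; lra.
have rq : r < q by rewrite /q; lra.
have qs : q < s by rewrite /s /q; lra.
have s1 : s < 1 by rewrite /s /q; lra.
have s0 : 0 < s by lra.
have [M HM] : exists M, forall n, rnorm (a n) * s ^+ n <= M.
  apply: bsum_bounded => [n|]; first by rewrite mulr_ge0 ?rnorm_ge0 ?exprn_ge0// ltW.
  by apply: absr_lt1; rewrite (ltW s0).
have M0 : 0 <= M by apply: le_trans (HM 0%N); rewrite mulr_ge0 ?rnorm_ge0 ?exprn_ge0// ltW.
have [B HB] : bsum (fun n => rnorm (a n) * (n%:R * q ^+ n / q)).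
  have h : bsum (fun n => M / q * (n.+1%:R ^+ 1 * (q / s) ^+ n)).
    apply: bsumZ; first by rewrite divr_ge0// ltW.
    by apply: bsum_poly_geo; rewrite divr_ge0 ?(ltW q0) ?(ltW s0)//= ltr_pdivrMr// mul1r.
  apply: bsum_le h => n; rewrite expr1.
  have -> : rnorm (a n) * (n%:R * q ^+ n / q) = rnorm (a n) * s ^+ n * (n%:R * (q / s) ^+ n / q).
    have sn : s ^+ n != 0 by rewrite expf_neq0// gt_eqF.
    rewrite [(q / s) ^+ n]expr_div_n; move: (s ^+ n) (q ^+ n) (q^-1) sn => x y v x0.
    transitivity (rnorm (a n) * (n%:R * y * v) * (x / x)); last by ring.
    by rewrite mulfV// mulr1.
  have -> : M / q * (n.+1%:R * (q / s) ^+ n) = M * (n.+1%:R * (q / s) ^+ n / q) by ring.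
  have qn : 0 <= (q / s) ^+ n by rewrite exprn_ge0// divr_ge0// ltW.
  apply: ler_pM => //.
  - by rewrite mulr_ge0 ?rnorm_ge0 ?exprn_ge0// ltW.
  - by rewrite !mulr_ge0 ?invr_ge0// ltW.
  - by rewrite ler_wpM2r ?invr_ge0 ?(ltW q0)// ler_wpM2r// ler_nat.
exists B => z w zr wr.
have az : psum a z (F z) by apply: aF; lra.
have aw : psum a w (F w) by apply: aF; lra.
apply: (sums_le (b := fun n => rnorm (a n) * (n%:R * q ^+ n / q) * cabs (z - w)) (sumsD az (sumsN aw))) => [n|M'].
  rewrite -scalerBl rnormZ mulrC -mulrA ler_wpM2l ?rnorm_ge0//.
  by apply: cabs_subX; lra.
by rewrite -mulr_suml ler_wpM2r ?cabs_ge0.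
Qed.

Lemma cabs_polar_sub r s t : 0 <= r < 1 ->
  cabs (r%:C * cis s - r%:C * cis t) <= 4 * pi * `|s - t|.
Proof.
move=> /andP[r0 r1]; rewrite -mulrBr cabsM cabs_real ger0_norm//.
apply: le_trans (cis_lipschitz s t).
by rewrite ler_piMl ?cabs_ge0// ltW.
Qed.

Lemma rnorm_circle_continuous r : 0 <= r < 1 -> continuous (fun t => rnorm (F (r%:C * cis t))).
Proof.
move=> r01; have [L HL] := global_lipschitz r01; have /andP[r0 r1] := r01.
apply: (@lipschitz_continuous _ _ (`|L| * (4 * pi))) => s t.
apply: le_trans (rnorm_dist _ _) _.
apply: le_trans (HL _ _ _ _) _; rewrite ?cabs_polar//.
rewrite -mulrA; apply: (@le_trans _ _ (`|L| * cabs (r%:C * cis s - r%:C * cis t))).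
  by rewrite ler_wpM2r ?cabs_ge0// ler_norm.
by rewrite ler_wpM2l// cabs_polar_sub.
Qed.

(** The majorant [B r = sum |a_n| r^n] dominates [|F|] on the circle of radius [r], so
    [|F| <= B(r)^(1 - p) |F|^p] there, and Cauchy's estimate gives [|a_n| r^n <= K B(r)^(1 - p)].
    Using this at radius [s] and summing against [(r / s)^n] gives the hypothesis of
    [growth_bound]. *)
Lemma hardy_coef_polybdd (p K : R) : 0 < p <= 1 ->
  (forall r, 0 <= r < 1 -> pint (fun t => rnorm (F (r%:C * cis t)) `^ p) <= K) ->
  polybdd a.
Proof.
move=> p01 FK; have /andP[p0 p1] := p01.
pose S r N := \sum_(n < N) rnorm (a n) * r ^+ n.
pose B r := sup (range (S r)).
have hS r : 0 <= r < 1 -> has_sup (range (S r)).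
  move=> /absr_lt1[M HM]; split; first by exists (S r 0), 0.
  by exists M => _ [N _ <-]; exact: HM.
have SB r N : 0 <= r < 1 -> S r N <= B r.
  by move=> /hS h; apply: sup_upper_bound => //; exists N.
have Bub r M : (forall N, S r N <= M) -> B r <= M.
  by move=> SM; apply: ge_sup; [exists (S r 0), 0|move=> _ [N _ <-]].
have cF r : 0 <= r < 1 -> continuous (fun t => rnorm (F (r%:C * cis t)) `^ p).
  move=> r01; apply: powR_comp_continuous => // [|t]; last exact: rnorm_ge0.
  exact: rnorm_circle_continuous.
have K0 : 0 <= K.
  apply: le_trans (FK 0 _); last by rewrite lexx ltr01.
  by apply: Rintegral_ge0 => t _; exact: powR_ge0.
have B0 r : 0 <= r < 1 -> 0 <= B r.
  by move=> r01; apply: le_trans (SB r 0 r01); rewrite /S big_ord0.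
have FB r t : 0 <= r < 1 -> rnorm (F (r%:C * cis t)) <= B r.
  move=> r01; have /andP[r0 r1] := r01.
  apply: (sums_le (b := fun n => rnorm (a n) * r ^+ n) (aF _)) => [|n|M]; last exact: SB.
    by rewrite cabs_polar.
  by rewrite rnorm_term cabs_polar.
have coef r n : 0 <= r < 1 -> rnorm (a n) * r ^+ n <= K * B r `^ (1 - p).
  move=> r01; have /andP[r0 r1] := r01.
  apply/ler_addgt0Pr => e e0.
  have [|N N0 HN] := @coef_mean _ _ a r (fun t => F (r%:C * cis t)) n r0 (absr_lt1 r01) _ e e0.
    by move=> t; apply: aF; rewrite cabs_polar.
  (* The estimate [HN] holds for every starting angle. Integrated over [t], the average over roots
     of unity becomes the mean over the circle, since the integral over a period is invariant under
     shifts. *)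
  pose u t := rnorm (F (r%:C * cis t)) `^ p.
  have pu t : u (t + 1) = u t by rewrite /u cisD1.
  pose f (j : nat) t := u (t + j%:R / N%:R).
  have cf j : continuous (f j).
    by apply: continuous_compf (cF r r01) _; exact: continuous_shiftf.
  have NR : 0 < N%:R :> R by rewrite ltr0n.
  have -> : rnorm (a n) * r ^+ n = pint (fun=> rnorm (a n) * r ^+ n) by rewrite pint_cst.
  pose g t := B r `^ (1 - p) * (N%:R^-1 * \sum_(j < N) f j t) + e.
  have cs : continuous (fun t => N%:R^-1 * \sum_(j < N) f j t).
    by apply: continuous_mulf; [exact: continuous_cstf|exact: continuous_sumf].
  have cs' : continuous (fun t => B r `^ (1 - p) * (N%:R^-1 * \sum_(j < N) f j t)).
    by apply: continuous_mulf => //; exact: continuous_cstf.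
  apply: (@le_trans _ _ (pint g)).
    apply: le_pint; first exact: continuous_cstf.
      by apply: continuous_addf => //; exact: continuous_cstf.
    move=> t _; apply: le_trans (HN t) _; rewrite lerD2r mulrCA ler_wpM2l ?invr_ge0 ?(ltW NR)//.
    rewrite mulr_sumr; apply: ler_sum => j _; rewrite /f /u.
    have := FB r (t + j%:R / N%:R) r01; have := rnorm_ge0 (F (r%:C * cis (t + j%:R / N%:R))).
    move: (rnorm _) => x x0 xB.
    have [->|xn] := eqVneq x 0; first by rewrite mulr_ge0 ?powR_ge0.
    rewrite -[leLHS](powRr1 x0) -[in leLHS](subrK p 1) powRD ?xn ?implybT//.
    by rewrite ler_wpM2r ?powR_ge0// ge0_ler_powR ?nnegrE ?subr_ge0// B0.
  rewrite /g pintD//; last exact: continuous_cstf.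
  rewrite pint_cst lerD2r pintZ// pintZ; last exact: continuous_sumf.
  rewrite pint_sum// mulrC ler_wpM2r ?powR_ge0//.
  rewrite ler_pdivrMl// -[N in X in _ <= X * _](card_ord N) -sumr_const mulr_suml.
  apply: ler_sum => j _; rewrite mul1r /f (pint_shift _ (cF r r01) pu); exact: FK.
have [||C [k HC]] := @growth_bound _ B K p p01 K0 B0.
- move=> r s r0 rs s1; apply: Bub => N; have s0 : 0 <= s by exact: le_trans rs.
  apply: le_trans (SB s N _); last by rewrite s0.
  by apply: ler_sum => n _; rewrite ler_wpM2l ?rnorm_ge0// lerXn2r.
- move=> r s r0 rs s1; have s0 : 0 < s by exact: le_lt_trans rs.
  have s01 : 0 <= s < 1 by rewrite (ltW s0).
  have q01 : 0 <= r / s < 1 by rewrite divr_ge0 ?(ltW s0)//= ltr_pdivrMr// mul1r.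
  apply: Bub => N; have T0 : 0 <= K * B s `^ (1 - p) by rewrite mulr_ge0 ?powR_ge0.
  apply: (@le_trans _ _ (K * B s `^ (1 - p) * \sum_(n < N) (r / s) ^+ n)).
    rewrite mulr_sumr; apply: ler_sum => n _.
    have -> : rnorm (a n) * r ^+ n = rnorm (a n) * s ^+ n * (r / s) ^+ n.
      have sn : s ^+ n != 0 by rewrite expf_neq0// gt_eqF.
      by rewrite expr_div_n; field.
    by rewrite ler_wpM2r ?coef// exprn_ge0//; case/andP: q01.
  have -> : K / (s - r) * B s `^ (1 - p) = K * B s `^ (1 - p) * (s - r)^-1 by ring.
  rewrite ler_wpM2l//; apply: le_trans (geo_sum_le N q01) _.
  (* The geometric series contributes [s / (s - r)], at most [1 / (s - r)] because [s < 1]. *)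
  have -> : 1 - r / s = (s - r) / s by field; exact: lt0r_neq0.
  rewrite invf_div ler_pdivrMr ?subr_gt0// mulVf ?gt_eqF ?subr_gt0//.
  exact: ltW.
exists (2 * C * 2 ^+ k), k => n.
have n0 : 0 < n.+1%:R :> R by rewrite ltr0n.
(* At radius [1 - d], Bernoulli's inequality keeps [(1 - d)^n] at least [1 / 2], while the inverse
   distance to the unit circle is only [2 (n + 1)]. *)
pose d : R := (2 * n.+1%:R)^-1; have d0 : 0 < d by rewrite invr_gt0 mulr_gt0.
have d1 : d <= 2^-1.
  by rewrite /d lef_pV2 ?posrE ?mulr_gt0// ler_peMr// ler1n.
have r01 : 0 <= 1 - d < 1 by lra.
have rn : 2^-1 <= (1 - d) ^+ n.
  apply: le_trans (one_sub_expn _ _); last by lra.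
  have : d *+ n <= 2^-1.
    have -> : d *+ n = 2^-1 * (n%:R / n.+1%:R).
      by rewrite -[_ *+ _]mulr_natr /d invfM -mulrA [_^-1 * n%:R]mulrC.
    rewrite ler_piMr ?invr_ge0//.
    by rewrite ler_pdivrMr// mul1r ler_nat.
  by lra.
have := HC _ r01; have := SB _ n.+1 r01; rewrite /S big_ord_recr/= => h1 h2.
have h3 : 0 <= \sum_(i < n) rnorm (a i) * (1 - d) ^+ i.
  by apply: sumr_ge0 => i _; rewrite mulr_ge0 ?rnorm_ge0 ?exprn_ge0//; case/andP: r01.
have dE : (1 - (1 - d))^-1 = 2 * n.+1%:R by rewrite subKr /d invrK.
rewrite dE in h2.
have h4 : rnorm (a n) * 2^-1 <= rnorm (a n) * (1 - d) ^+ n by rewrite ler_wpM2l ?rnorm_ge0.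
rewrite exprMn in h2; move: h1 h2 h3 h4.
set x := \sum_(_ < _) _; set y := _ * (1 - d) ^+ n; set v := B _.
by rewrite -!mulrA; move: (C * _) => w *; lra.
Qed.

End hardy_growth.

(** * Fourier series of smooth periodic functions *)

Section smooth_periodic.
Variable R : realType.
Implicit Types (u v : R -> R) (s t : R).

Lemma smooth_continuous u : smooth u -> continuous u.
Proof.
move=> su t; apply/differentiable_continuous/derivable1_diffP; exact: (su 0%N).
Qed.

Lemma derive1_periodic u : (forall t, u (t + 1) = u t) -> forall t, derive1 u (t + 1) = derive1 u t.
Proof.
move=> pu t; rewrite /derive1.
have -> : (fun h => h^-1 *: (u (h + (t + 1)) - u (t + 1))) = (fun h => h^-1 *: (u (h + t) - u t)).
  by apply/funext => h; rewrite addrA !pu.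
by [].
Qed.

Lemma derive1n_periodic u n : (forall t, u (t + 1) = u t) ->
  forall t, derive1n n u (t + 1) = derive1n n u t.
Proof.
move=> pu; elim: n => [//|n IH] t; rewrite derive1nS.
exact: derive1_periodic.
Qed.

Lemma smooth_derive1n u n : smooth u -> smooth (derive1n n u).
Proof. by move=> su; elim: n => [//|n IH]; rewrite derive1nS; exact: smooth_derive. Qed.

Lemma periodic_nat u t n : (forall t, u (t + 1) = u t) -> u (t + n%:R) = u t.
Proof.
move=> pu; elim: n => [|n IH]; first by rewrite addr0.
by rewrite -natr1 addrA pu.
Qed.

Lemma periodic_reduce u t : (forall t, u (t + 1) = u t) -> exists2 s, 0 <= s <= 1 & u t = u s.
Proof.
move=> pu; exists (t - (Num.floor t)%:~R).
  have := floor_le t; have := floorD1_gt t; rewrite intrD.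
  by move: (_%:~R : R) (1%:~R : R) (erefl : 1%:~R = 1 :> R) => x y ->; lra.
case: (Num.floor t) => n; first by rewrite -[in LHS](subrK n%:R t) periodic_nat.
by rewrite NegzE mulrNz opprK periodic_nat.
Qed.

Lemma periodic_bounded u : continuous u -> (forall t, u (t + 1) = u t) ->
  exists M, forall t, `|u t| <= M.
Proof.
move=> cu pu; have cu' : {within `[0, 1], continuous (fun t => `|u t|)}.
  by apply: continuous_subspaceT => x; apply: cvg_norm; exact: cu.
have [c _ cM] := EVT_max ler01 cu'.
exists `|u c| => t; have [s s01 ->] := periodic_reduce t pu.
by apply: cM; rewrite in_itv.
Qed.

End smooth_periodic.

Section trig.
Variable R : realType.
Implicit Types (u v : R -> R) (s t : R) (n m : nat) (b : bool).

(** The boolean selects the sine, so that differentiation, reflection and integration by parts are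
    stated once, with [~~ b] and signs. *)
Definition trig b n t : R :=
  if b then sin (2 * pi * n%:R * t) else cos (2 * pi * n%:R * t).

Arguments trig : simpl never.

Lemma pint_derive0 u U : continuous u -> (forall x : R, is_derive x 1 U (u x)) ->
  (forall t, U (t + 1) = U t) -> pint u = 0.
Proof.
move=> cu dU pU; rewrite (pint_FTC cu (fun x _ => dU x)).
have E : 2^-1 = - 2^-1 + 1 :> R by lra.
by rewrite [in X in X - _]E pU subrr.
Qed.

Lemma trig_le1 b n t : `|trig b n t| <= 1.
Proof.
by rewrite ler_norml /trig; case: b; rewrite ?sin_geN1 ?sin_le1 ?cos_geN1 ?cos_le1.
Qed.

Lemma trig_periodic b n t : trig b n (t + 1) = trig b n t.
Proof.
have c : cis (n%:R * (t + 1)) = cis (n%:R * t) :> R[i] by rewrite !cis_natM cisD1.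
move: c; rewrite /cis => -[c1 c2]; rewrite /trig -!(mulrA (2 * pi)).
by case: b; rewrite ?c1 ?c2.
Qed.

Lemma trig_reflect b n t : trig b n (- t) = (-1) ^+ b * trig b n t.
Proof.
by rewrite /trig mulrN; case: b; rewrite ?sinN ?cosN ?expr1 ?mulN1r ?mul1r.
Qed.

Lemma trig0 b t : trig b 0 t = (~~ b)%:R.
Proof. by rewrite /trig mulr0 mul0r; case: b; rewrite ?sin0 ?cos0. Qed.

Lemma is_derive_trig b n t :
  is_derive t 1 (trig b n) ((-1) ^+ (~~ b) * (2 * pi * n%:R) * trig (~~ b) n t).
Proof.
have D : is_derive t 1 (fun t : R => 2 * pi * n%:R * t) (2 * pi * n%:R).
  by rewrite -[X in is_derive _ _ _ X]mulr1; apply: is_deriveZ.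
rewrite /trig; case: b.
  have := is_derive1_comp (is_derive_sin _) D.
  by congr is_derive; rewrite expr0 mul1r mulrC.
have := is_derive1_comp (is_derive_cos _) D.
by congr is_derive; rewrite /= expr1; move: (2 * pi * n%:R) => k; ring.
Qed.

Lemma trig_continuous b n : continuous (trig b n).
Proof.
move=> t; apply/differentiable_continuous/derivable1_diffP.
have := is_derive_trig b n t => D; exact: ex_derive.
Qed.

Definition rcoef b n u : R := pint (fun t => trig b n t * u t).

Lemma trig_mul_continuous b n u : continuous u -> continuous (fun t => trig b n t * u t).
Proof. by move=> cu; apply: continuous_mulf => //; exact: trig_continuous. Qed.

(* Integration by parts; there is no boundary term, by periodicity. *)
Lemma rcoef_derive b n u : smooth u -> (forall t, u (t + 1) = u t) ->
  rcoef b n (derive1 u) = (-1) ^+ b * (2 * pi * n%:R) * rcoef (~~ b) n u.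
Proof.
move=> su pu; have cu := smooth_continuous su.
have cu' := smooth_continuous (smooth_derive su).
pose k := (-1) ^+ (~~ b) * (2 * pi * n%:R) : R.
have c1 := trig_mul_continuous (b := ~~ b) (n := n) cu.
have c2 := trig_mul_continuous (b := b) (n := n) cu'.
have c1k : continuous (fun t => k * (trig (~~ b) n t * u t)).
  by apply: continuous_mulf => //; exact: continuous_cstf.
have : pint (fun t => trig b n t * derive1 u t + k * (trig (~~ b) n t * u t)) = 0.
  apply: (@pint_derive0 _ (fun t => trig b n t * u t)); first exact: continuous_addf.
    move=> x; have D1 := is_derive_trig b n x; have D2 := smooth_is_derive x su.
    have := @is_deriveM _ _ _ _ _ _ _ _ D1 D2.
    by congr is_derive; rewrite /GRing.scale/= /k; move: ((-1) ^+ _) (2 * pi * n%:R) => y z; ring.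
  by move=> t; rewrite pu trig_periodic.
rewrite pintD// pintZ// -!/(rcoef _ _ _) => /eqP; rewrite addr_eq0 => /eqP->.
rewrite /k; move: (2 * pi * _) (rcoef _ _ _) => x y.
by case: b {k c1 c2 c1k} => /=; rewrite ?expr0 ?expr1; ring.
Qed.

Lemma rcoef_norm_derive b n u : smooth u -> (forall t, u (t + 1) = u t) ->
  2 * pi * n%:R * `|rcoef b n u| = `|rcoef (~~ b) n (derive1 u)|.
Proof.
move=> su pu; rewrite rcoef_derive// negbK !normrM normrX normrN1 expr1n mul1r.
by rewrite (ger0_norm (pi_ge0 R)) !normr_nat.
Qed.

Lemma rcoef_le b n u (M : R) : continuous u -> (forall t, `|u t| <= M) -> `|rcoef b n u| <= M.
Proof.
move=> cu uM; apply: pint_le_bound => [|t _]; first exact: trig_mul_continuous.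
by rewrite normrM -[M]mul1r ler_pM// trig_le1.
Qed.

(** Each of [k] integrations by parts gains a factor [2 pi n >= n]. *)
Lemma rcoef_decay b n u k (M : R) : smooth u -> (forall t, u (t + 1) = u t) ->
  (forall t, `|derive1n k u t| <= M) -> `|rcoef b n u| * n%:R ^+ k <= M.
Proof.
elim: k b u => [|k IH] b u su pu uM.
  by rewrite expr0 mulr1; apply: rcoef_le => //; exact: smooth_continuous.
have := IH (~~ b) _ (smooth_derive su) (derive1_periodic pu).
rewrite -derive1Sn -rcoef_norm_derive// => /(_ uM); apply: le_trans.
have -> : `|rcoef b n u| * n%:R ^+ k.+1 = 1 * n%:R * `|rcoef b n u| * n%:R ^+ k by rewrite exprS; ring.
do 3![rewrite ler_wpM2r ?exprn_ge0//].
by have := pi_ge2 R; lra.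
Qed.

Lemma pint_trig b n : pint (trig b n) = ((n == 0%N) && ~~ b)%:R.
Proof.
have [->|n0] := eqVneq n 0%N.
  by rewrite (_ : trig b 0 = fun=> (~~ b)%:R) ?pint_cst//; apply/funext => t; exact: trig0.
have k0 : 2 * pi * n%:R != 0 :> R by rewrite !mulf_neq0 ?pnatr_eq0// gt_eqF ?pi_gt0.
rewrite andFb mulr0n; apply: (@pint_derive0 (trig b n) (fun t => (-1) ^+ b * (2 * pi * n%:R)^-1 * trig (~~ b) n t)); last 1 first.
- by move=> t; rewrite trig_periodic.
- exact: trig_continuous.
- move=> x; have D := is_derive_trig (~~ b) n x.
  have : is_derive x 1 (fun t => (-1) ^+ b * (2 * pi * n%:R)^-1 * trig (~~ b) n t)
      ((-1) ^+ b * (2 * pi * n%:R)^-1 * ((-1) ^+ (~~ ~~ b) * (2 * pi * n%:R) * trig (~~ ~~ b) n x)).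
    by apply: is_deriveZ.
  congr is_derive; rewrite negbK /GRing.scale/=.
  move: (2 * pi * n%:R) k0 => k k0.
  by case: b {D}; rewrite /= ?expr0 ?expr1; field.
Qed.

Lemma trig_sub n m t : (m <= n)%N -> forall b,
  trig b (n - m) t = if b then trig true n t * trig false m t - trig false n t * trig true m t
    else trig false n t * trig false m t + trig true n t * trig true m t.
Proof.
move=> mn b; rewrite /trig natrB// mulrBr mulrBl.
by case: b; rewrite ?sinB ?cosB.
Qed.

Lemma trig_add n m t b :
  trig b (n + m) t = if b then trig true n t * trig false m t + trig false n t * trig true m t
    else trig false n t * trig false m t - trig true n t * trig true m t.
Proof.
rewrite /trig natrD mulrDr mulrDl.
by case: b; rewrite ?sinD ?cosD.
Qed.

Lemma pint_trig_lin (k : R) b1 n1 b2 n2 :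
  pint (fun t => 2^-1 * (trig b1 n1 t + k * trig b2 n2 t)) =
  2^-1 * (pint (trig b1 n1) + k * pint (trig b2 n2)).
Proof.
have ck : continuous (fun t => k * trig b2 n2 t).
  by apply: continuous_mulf; [exact: continuous_cstf|exact: trig_continuous].
rewrite pintZ; last by apply: continuous_addf => //; exact: trig_continuous.
by rewrite pintD ?pintZ//; exact: trig_continuous.
Qed.

Lemma rcoef_trig b n b' m : rcoef b n (trig b' m) =
  (if (n == m) && (b == b') then (if n == 0%N then (~~ b)%:R else 2^-1) else 0).
Proof.
have C (x y : bool) : (fun t => trig x n t * trig y m t) = (fun t => trig y m t * trig x n t).
  by apply/funext => t; rewrite mulrC.
wlog mn : n m b b' {C} / (m <= n)%N.
  move=> H; have [mn|/ltnW nm] := leqP m n; first exact: H.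
  have := H m n b' b nm; rewrite /rcoef => E.
  rewrite (_ : (fun _ => _) = fun t => trig b' m t * trig b n t); last first.
    by apply/funext => t; rewrite mulrC.
  rewrite E eq_sym [b' == b]eq_sym.
  by case: andP => // -[/eqP-> /eqP->].
(* Product-to-sum formulas: the product is a combination of cosines if [b = b'], of sines otherwise,
   whence [b (+) b']. [k] is the sign of the second term; for two sines the difference of the
   frequencies comes first. *)
pose k : R := if b && b' then -1 else if b then 1 else if b' then -1 else 1.
pose n1 := if b && b' then (n - m)%N else (n + m)%N.
pose n2 := if b && b' then (n + m)%N else (n - m)%N.
have -> : rcoef b n (trig b' m) = pint (fun t => 2^-1 *
    (trig (b (+) b') n1 t + k * trig (b (+) b') n2 t)).
  congr pint; apply/funext => t; rewrite /k /n1 /n2.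
  case: b {k n1 n2}; case: b' => /=;
    by rewrite trig_sub// trig_add /=; field.
have E1 : (n - m == 0)%N = (n == m) by rewrite subn_eq0 eqn_leq mn andbT.
have E2 : (n + m == 0)%N = (n == m) && (n == 0)%N.
  by rewrite addn_eq0 andbC; case: (n =P 0%N) => [->|]; rewrite ?andbF// !andbT eq_sym.
rewrite pint_trig_lin !pint_trig /k /n1 /n2.
case: b {k n1 n2}; case: b' => /=; rewrite E1 E2;
  by case: (n == m); case: (n == 0)%N => /=; lra.
Qed.

End trig.

Lemma test_predP (R : realType) (g : R -> R[i]) : test_pred g <->
  [/\ smooth (fun t => complex.Re (g t)), smooth (fun t => complex.Im (g t)) &
      forall t, g (t + 1) = g t].
Proof. by split=> [/asboolP|h]; last exact/asboolP. Qed.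

(** * Expansion of the Poisson and conjugate Poisson kernels *)

Section kernel_expansion.
Variable R : realType.
Implicit Types (r s t x y : R) (m n N : nat).

Lemma trigB b m x y : trig b m (x - y) =
  if b then trig true m x * trig false m y - trig false m x * trig true m y
  else trig false m x * trig false m y + trig true m x * trig true m y.
Proof. by rewrite /trig mulrBr; case: b; rewrite ?sinB ?cosB. Qed.

Lemma rcoefD b m (u v : R -> R) : continuous u -> continuous v ->
  rcoef b m (fun t => u t + v t) = rcoef b m u + rcoef b m v.
Proof.
move=> cu cv; rewrite /rcoef -pintD; [|exact: trig_mul_continuous..].
by congr pint; apply/funext => t; rewrite mulrDr.
Qed.

Lemma rcoefZ b m (k : R) (u : R -> R) : continuous u ->
  rcoef b m (fun t => k * u t) = k * rcoef b m u.
Proof.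
move=> cu; rewrite /rcoef -pintZ; last exact: trig_mul_continuous.
by congr pint; apply/funext => t; rewrite mulrCA.
Qed.

Lemma rcoef_cst b m (k : R) : rcoef b m (fun=> k) = k * ((m == 0%N) && ~~ b)%:R.
Proof.
rewrite /rcoef -pint_trig -pintZ; last exact: trig_continuous.
by congr pint; apply/funext => t; rewrite mulrC.
Qed.

(** [1 + (pi / 2)^2] is cruder than the constant [(pi / 2)^2] of Jordan's inequality; it arises from
    [sin^2 y + y^2 sin^2 y] with [|y| <= pi / 2]. *)
Definition jordan : R := 1 + pi ^+ 2 / 4.

Lemma jordan_ge0 : 0 <= jordan.
Proof. by rewrite addr_ge0// divr_ge0// sqr_ge0. Qed.

(** The Taylor coefficients of [(1 + z) / (1 - z)]; also the inverse mean squares of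
    [cos (2 pi m t)]. *)
Definition fweight m : R := if m == 0%N then 1 else 2.

Lemma trigE b m x : trig b m x = if b then complex.Im (cis x ^+ m) else complex.Re (cis x ^+ m).
Proof. by rewrite -cis_natM /trig /cis; case: b => /=; rewrite !mulrA. Qed.

(** The imaginary part, for [b = true], or the real part of [cis x ^+ N * (herglotz r x + 1)]. *)
Definition kernel_rem b N r x : R := if b then trig false N x * cpoisson r x + trig true N x * (poisson r x + 1)
  else trig false N x * (poisson r x + 1) - trig true N x * cpoisson r x.

Definition kernel b := if b then @cpoisson R else @poisson R.

(* [(1 + z) / (1 - z) = 1 + 2 z + ... + 2 z^N + 2 z^(N+1) / (1 - z)], where
   [2 / (1 - z) = (1 + z) / (1 - z) + 1]. *)
Lemma herglotz_expand r x N : 0 <= r < 1 ->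
  herglotz r x = \sum_(m < N.+1) (fweight m * r ^+ m)%:C * cis x ^+ m +
    (r ^+ N.+1)%:C * cis x ^+ N.+1 * (herglotz r x + 1).
Proof.
move=> r01; set z := r%:C * cis x.
have z1 : 1 - z != 0.
  apply/negP => /eqP/eqP; rewrite subr_eq0 => /eqP z1.
  have /andP[r0 r1] := r01.
  have := cabs_polar x r0; rewrite -/z -z1 (_ : 1 = 1%:R)// cabs_nat => r1'.
  by move: r1; rewrite -r1' ltxx.
have E m : (r ^+ m)%:C * cis x ^+ m = z ^+ m by rewrite rmorphXn/= -exprMn.
have -> : \sum_(m < N.+1) (fweight m * r ^+ m)%:C * cis x ^+ m = 2 * \sum_(m < N.+1) z ^+ m - 1.
  rewrite big_ord_recl [in RHS]big_ord_recl /fweight/= !expr0 !mulr1 mulrDr mulr1.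
  rewrite mulr_sumr addrAC (_ : 2 - 1 = 1); last by rewrite -[2]/(1 + 1) addrK.
  by congr (_ + _); apply: eq_bigr => m _; rewrite rmorphM/= -mulrA E rmorph_nat.
rewrite E /herglotz -/z.
have := subrX1 z N.+1; move: (\sum_(m < N.+1) z ^+ m) => S; rewrite -/z.
clear E; clearbody z; move: (z ^+ N.+1) => w h.
have -> : w = 1 - (1 - z) * S by rewrite mulrBl mul1r; move: h; rewrite mulrBl mul1r => /eqP; rewrite subr_eq => /eqP->; ring.
by field.
Qed.

Lemma kernel_expand b r x N : 0 <= r < 1 ->
  kernel b r x = \sum_(m < N.+1) fweight m * r ^+ m * trig b m x + r ^+ N.+1 * kernel_rem b N.+1 r x.
Proof.
move=> r01; have := herglotz_expand x N r01.
have RD (z w : R[i]) : complex.Re (z + w) = complex.Re z + complex.Re w by case: z w => u v [].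
have ID (z w : R[i]) : complex.Im (z + w) = complex.Im z + complex.Im w by case: z w => u v [].
have Rs M (f : 'I_M -> R[i]) : complex.Re (\sum_(m < M) f m) = \sum_(m < M) complex.Re (f m).
  by elim/big_rec2: _ => // i z w _ <-.
have Is M (f : 'I_M -> R[i]) : complex.Im (\sum_(m < M) f m) = \sum_(m < M) complex.Im (f m).
  by elim/big_rec2: _ => // i z w _ <-.
have RM (c : R) (z : R[i]) : complex.Re (c%:C * z) = c * complex.Re z.
  by case: z => u v /=; rewrite mul0r subr0.
have IM (c : R) (z : R[i]) : complex.Im (c%:C * z) = c * complex.Im z.
  by case: z => u v /=; rewrite mul0r addr0.
have P (z w : R[i]) : complex.Re (z * (w + 1)) = complex.Re z * (complex.Re w + 1) - complex.Im z * complex.Im w.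
  by case: z w => u v [u' v'] /=; rewrite addr0.
have Q (z w : R[i]) : complex.Im (z * (w + 1)) = complex.Re z * complex.Im w + complex.Im z * (complex.Re w + 1).
  by case: z w => u v [u' v'] /=; rewrite addr0.
move=> h; rewrite /kernel /kernel_rem /poisson /cpoisson; case: b.
  rewrite {1}h ID Is -mulrA IM Q !trigE; congr (_ + _).
  by apply: eq_bigr => m _; rewrite IM trigE.
rewrite {1}h RD Rs -mulrA RM P !trigE; congr (_ + _).
by apply: eq_bigr => m _; rewrite RM trigE.
Qed.

Lemma kernel_smooth b r t : 0 <= r < 1 -> smooth (fun s => kernel b r (t - s)).
Proof.
move=> r01; case: b.
  by have [h _ _] := (test_predP _).1 (test_pred_cpoisson t r01); exact: h.
by have [h _ _] := (test_predP _).1 (test_pred_poisson t r01); exact: h.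
Qed.

Lemma kernel_periodic b r x : kernel b r (x + 1) = kernel b r x.
Proof. by case: b; rewrite /kernel /cpoisson /poisson /herglotz cisD1. Qed.

Lemma kernel_smooth0 b r : 0 <= r < 1 -> smooth (kernel b r).
Proof.
move=> r01; have := smooth_reflect (@kernel_smooth b r 0 r01).
by congr smooth; apply/funext => s; rewrite opprK add0r.
Qed.

Lemma kernel_bounded b r : 0 <= r < 1 -> exists M, forall x, `|kernel b r x| <= M.
Proof.
move=> r01; apply: periodic_bounded (kernel_periodic b r).
exact/smooth_continuous/kernel_smooth0.
Qed.

(** Independence of [N] matters: the remainder carries a factor [r ^+ N], so it tends to 0. *)
Lemma krem_bounded b r : 0 <= r < 1 -> exists M, forall N x, `|kernel_rem b N r x| <= M.
Proof.
move=> r01; have [M1 H1] := kernel_bounded false r01; have [M2 H2] := kernel_bounded true r01.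
exists (M1 + 1 + M2) => N x; have h1 := H1 x; have h2 := H2 x.
have T (b' : bool) (y v : R) : `|y| <= v -> `|trig b' N x * y| <= v.
  by move=> yv; rewrite normrM -[leRHS]mul1r ler_pM// trig_le1.
have h3 : `|poisson r x + 1| <= M1 + 1.
  by apply: le_trans (ler_normD _ _) _; rewrite normr1 lerD2r.
rewrite /kernel_rem; case: b.
  by apply: le_trans (ler_normD _ _) _; rewrite [leRHS]addrC lerD ?T.
by apply: le_trans (ler_normB _ _) _; rewrite lerD ?T.
Qed.

(* [y^2 = y^2 cos^2 y + y^2 sin^2 y] and [|y cos y| <= |sin y|]. *)
Lemma sqr_le_sin2 y : `|y| <= pi / 2 -> y ^+ 2 <= jordan * sin y ^+ 2.
Proof.
wlog y0 : y / 0 <= y.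
  move=> H; have [y0|/ltW y0] := leP 0 y; first exact: H.
  by rewrite -normrN -sqrrN -[sin y ^+ 2]sqrrN -sinN; apply: H; rewrite oppr_ge0.
rewrite ger0_norm// => y2; have pi0 := pi_gt0 R.
have yc : 0 <= y * cos y.
  by rewrite mulr_ge0// cos_ge0_pihalf// y2 andbT; lra.
have ysin : y * cos y <= sin y.
  move: y0; rewrite le_eqVlt => /orP[/eqP<-|y0]; first by rewrite mul0r sin0.
  have D (x : R) : is_derive x 1 (fun x => sin x - x * cos x) (x * sin x).
    have D1 : is_derive x 1 (fun x : R => x * cos x) (x * - sin x + cos x * 1).
      by apply: is_deriveM.
    have := @is_deriveB _ _ _ _ _ _ _ _ _ (is_derive_sin x) D1.
    by congr is_derive; ring.
  have [|c c0] := @MVT _ _ _ 0 y y0 (fun x _ => D x).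
    by apply: derivable_within_continuous => x _; have := D x => Dx; exact: ex_derive.
  rewrite in_itv/= in c0; rewrite sin0 mul0r !subr0 => E.
  rewrite -subr_ge0 E !mulr_ge0//; [lra| |lra].
  by apply: sin_ge0_pi; lra.
have s2 : (y * cos y) ^+ 2 <= sin y ^+ 2.
  by rewrite lerXn2r ?nnegrE// (le_trans yc).
have -> : y ^+ 2 = (y * cos y) ^+ 2 + y ^+ 2 * sin y ^+ 2.
  by rewrite exprMn -mulrDr cos2Dsin2 mulr1.
rewrite /jordan mulrDl mul1r lerD// ler_wpM2r ?sqr_ge0//.
have -> : pi ^+ 2 / 4 = (pi / 2) ^+ 2 :> R by rewrite expr_div_n -natrX.
by rewrite lerXn2r ?nnegrE// divr_ge0// ltW.
Qed.

(** The denominator of the kernel is [(1 - r)^2 + 4 r sin^2 (pi s)], and [s^2] is at most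
    [jordan * sin^2 (pi s)]. The bound tends to 0 as [r] tends to 1: this is the
    approximate-identity property for functions that are [O(s^2)]. *)
Lemma poisson_sqr_le r s : 0 < r < 1 -> `|s| <= 2^-1 ->
  `|poisson r s| * s ^+ 2 <= jordan * ((1 - r ^+ 2) / (4 * r)).
Proof.
move=> /andP[r0 r1] s2; have r01 : 0 <= r < 1 by rewrite ltW.
have pi0 := pi_gt0 R.
have r2 : 0 <= 1 - r ^+ 2 by rewrite subr_ge0 exprn_ile1// ltW.
have D0 := kernel_den_gt0 s r01.
rewrite /poisson herglotzE//= ger0_norm; last by rewrite divr_ge0// ltW.
have dE : kernel_den r s = (1 - r) ^+ 2 + 4 * r * sin (pi * s) ^+ 2.
  rewrite /kernel_den -mulrA mulr_natl cos_mulr2n sin_mulr2n -mulr_natl.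
  have := cos2Dsin2 (pi * s); move: (cos _) (sin _) => c v h.
  have c2 : c ^+ 2 = 1 - v ^+ 2 by rewrite -h addrK.
  by rewrite -mulr_natl; ring: c2.
have s2' : s ^+ 2 <= jordan * sin (pi * s) ^+ 2.
  apply: le_trans (sqr_le_sin2 _); last first.
    by rewrite normrM (ger0_norm (ltW pi0)) ler_wpM2l// ltW.
  rewrite exprMn ler_peMl ?sqr_ge0// exprn_ege1//.
  by have := pi_ge2 R; lra.
have C0 := jordan_ge0; move: s2' C0; move: jordan => C s2' C0.
rewrite mulrAC ler_pdivrMr// dE.
apply: le_trans (ler_wpM2l r2 s2') _.
move: (sin _ ^+ 2) => v.
have -> : (1 - r ^+ 2) * (C * v) = C * ((1 - r ^+ 2) / (4 * r)) * (4 * r * v).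
  by field; exact: lt0r_neq0.
apply: ler_wpM2l; last by rewrite lerDr sqr_ge0.
by apply: mulr_ge0 => //; apply: divr_ge0 => //; rewrite mulr_ge0// ltW.
Qed.

End kernel_expansion.

(** * Fourier inversion for smooth periodic functions *)

Section inversion.
Variable R : realType.
Implicit Types (u v : R -> R) (r s t x : R) (m n N : nat).

(** As a function of [s], the difference vanishes at 0 and has derivative
    [(u'(t + s) - u'(t - s)) / 2], of size at most [M |s|]. *)
Lemma second_difference_le u (M : R) t s : smooth u -> (forall x, `|derive1n 2 u x| <= M) ->
  `|(u (t + s) + u (t - s)) / 2 - u t| <= M * s ^+ 2.
Proof.
move=> su uM.
pose w x := (u (t + x) + u (t - x)) / 2 - u t.
pose dw x := (derive1 u (t + x) - derive1 u (t - x)) / 2.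
have Dw (x : R) : is_derive x 1 w (dw x).
  have Dp : is_derive x 1 (fun x => u (t + x)) (derive1 u (t + x)).
    under eq_fun do rewrite addrC.
    by rewrite addrC; apply: is_derive_shift1; exact: smooth_is_derive.
  have Dm : is_derive x 1 (fun x => u (t - x)) (- derive1 u (t - x)).
    have ds : is_derive x 1 (fun x : R => t - x) (0 - 1) by apply: is_deriveB.
    have := @is_derive1_comp _ u (fun x => t - x) x _ _ (smooth_is_derive _ su) ds.
    by congr is_derive; ring.
  have D2 : is_derive x 1 (fun x => 2^-1 * (u (t + x) + u (t - x))) (2^-1 * (derive1 u (t + x) + - derive1 u (t - x))).
    by apply: is_deriveZ; exact: is_deriveD.
  have D3 := is_deriveB D2 (is_derive_cst (u t) x 1).
  move: D3; rewrite /w /dw; congr is_derive; last by rewrite subr0 mulrC.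
  by apply/funext => y /=; rewrite mulrC.
have dwM x : `|dw x| <= M * `|x|.
  have := lipschitz_of_derive (fun y => smooth_is_derive y (smooth_derive su)) uM.
  move=> /(_ (t + x) (t - x)).
  have -> : t + x - (t - x) = 2 * x by ring.
  rewrite /dw !normrM normfV normr_nat [2 * `|x|]mulrC mulrA => h.
  by rewrite ler_pdivrMr.
have w0 : w 0 = 0 by rewrite /w addr0 subr0; field.
rewrite -/(w s); have [s0|s0|->] := ltgtP s 0.
- have [|c c0] := @MVT _ w dw s 0 s0 (fun x _ => Dw x).
    by apply: derivable_within_continuous => x _; have := Dw x => Dx; exact: ex_derive.
  rewrite in_itv/= in c0; case/andP: c0 => c1 c2.
  rewrite w0 !sub0r => /eqP; rewrite eqr_oppLR => /eqP->.
  rewrite normrN normrM normrN; apply: le_trans (ler_wpM2r _ (dwM c)) _ => //.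
  rewrite -mulrA ler_wpM2l ?(le_trans _ (uM 0))//.
  by rewrite (ltr0_norm s0) (ltr0_norm c2); nra.
- have [|c c0] := @MVT _ w dw 0 s s0 (fun x _ => Dw x).
    by apply: derivable_within_continuous => x _; have := Dw x => Dx; exact: ex_derive.
  rewrite in_itv/= in c0; case/andP: c0 => c1 c2.
  rewrite w0 !subr0 => ->.
  rewrite normrM; apply: le_trans (ler_wpM2r _ (dwM c)) _ => //.
  rewrite -mulrA ler_wpM2l ?(le_trans _ (uM 0))//.
  by rewrite (gtr0_norm s0) (gtr0_norm c1); nra.
- by rewrite w0 normr0 expr0n mulr0.
Qed.

Definition fourier_sum N u t : R := \sum_(m < N) fweight R m *
  (rcoef false m u * trig false m t + rcoef true m u * trig true m t).

(* The Poisson means of the even part of [x |-> u (t + x) - u t] tend to [0] because that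
   function is [O(x^2)]; the sum of the Fourier series of [u] is therefore [u]. *)
Lemma fpart_dist u (b : nat -> R) N t (T : R) : smooth u -> (forall t, u (t + 1) = u t) ->
  (forall m, fweight R m * (`|rcoef false m u| + `|rcoef true m u|) <= b m) ->
  (forall M, (N < M)%N -> \sum_(N.+1 <= m < M) b m <= T) ->
  `|u t - fourier_sum N.+1 u t| <= T.
Proof.
move=> su pu ub bT; have cu := smooth_continuous su.
have [M2 HM2] := periodic_bounded (smooth_continuous (smooth_derive1n (n := 2) su)) (derive1n_periodic 2 pu).
pose w s := (u (t + s) + u (t - s)) / 2 - u t.
have cp : continuous (fun s => u (t + s)).
  by under [X in continuous X]funext do rewrite addrC; apply: continuous_compf => //; exact: continuous_shiftf.
have cm : continuous (fun s => u (t - s)).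
  by apply: (@continuous_compf _ (fun s => u (t + s)) -%R) => // x; exact: oppr_continuous.
have cw : continuous w.
  apply: continuous_addf; last exact: continuous_cstf.
  by apply: continuous_mulf; [exact: continuous_addf|exact: continuous_cstf].
pose c m := fweight R m * (rcoef false m u * trig false m t + rcoef true m u * trig true m t).
pose d m := c m - (m == 0%N)%:R * u t.
have cb m : `|c m| <= b m.
  apply: le_trans (ub m); rewrite normrM.
  have k0 : 0 <= fweight R m by rewrite /fweight; case: ifP.
  rewrite (ger0_norm k0) ler_wpM2l//; apply: le_trans (ler_normD _ _) _.
  by rewrite !normrM lerD// ler_piMr// trig_le1.
(* The weighted cosine coefficients of [w] are the terms of the Fourier sum of [u] at [t]; the
   subtracted constant [u t] contributes to [m = 0] only. *)
have dE m : fweight R m * rcoef false m w = d m.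
  have E1 : rcoef false m (fun s => u (t + s)) = rcoef false m u * trig false m t + rcoef true m u * trig true m t.
    pose g x := trig false m t * (trig false m x * u x) + trig true m t * (trig true m x * u x).
    have cg b' : continuous (fun x => trig b' m t * (trig b' m x * u x)).
      by apply: continuous_mulf; [exact: continuous_cstf|exact: trig_mul_continuous].
    have pg x : g (x + 1) = g x by rewrite /g !trig_periodic pu.
    transitivity (pint (fun s => g (s + t))).
      congr pint; apply/funext => s; rewrite /g -{1}(addrK t s) (trigB false) [t + s]addrC.
      by move: (trig _ _ _) => *; ring.
    rewrite (pint_shift _ _ pg); last exact: continuous_addf.
    rewrite pintD// !pintZ; [|exact: trig_mul_continuous..].
    by rewrite /rcoef; ring.
  have E2 : rcoef false m (fun s => u (t - s)) = rcoef false m (fun s => u (t + s)).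
    rewrite /rcoef -[RHS]pint_reflect; last exact: trig_mul_continuous.
    by congr pint; apply/funext => s; rewrite trig_reflect expr0 mul1r.
  have E3 : rcoef false m (fun=> u t) = (m == 0%N)%:R * u t.
    by rewrite rcoef_cst andbT mulrC.
  have -> : w = fun s => 2^-1 * (u (t + s) + u (t - s)) + (-1) * u t.
    by apply/funext => s; rewrite /w mulrC mulN1r.
  rewrite rcoefD; [|by apply: continuous_mulf; [exact: continuous_cstf|exact: continuous_addf]|].
    rewrite rcoefZ ?rcoefD//; last exact: continuous_addf.
    rewrite rcoefZ; last exact: continuous_cstf.
    rewrite E2 E1 E3 /d /c; move: (rcoef false m u * _ + _) => y; rewrite /fweight.
    by case: (m == 0%N) => /=; field.
  by apply: continuous_mulf; exact: continuous_cstf.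
have d0 m : (0 < m)%N -> d m = c m by rewrite /d lt0n => /negbTE->; rewrite mul0r subr0.
(* The integral [I] of the Poisson kernel against [w] is small by [IM]. Expanding it to an order
   [M >= N], the terms between [N] and [M] cost at most [T], and the remainder falls below any [e]
   for large [M]. *)
have key r : 0 < r < 1 -> `|\sum_(m < N.+1) r ^+ m * d m| <= T + M2 * (jordan R * ((1 - r ^+ 2) / (4 * r))).
  move=> rr; have /andP[r0 r1] := rr; have r01 : 0 <= r < 1 by rewrite ltW.
  pose I := pint (fun s => poisson r s * w s).
  have ck : continuous (kernel false r) by exact/smooth_continuous/kernel_smooth0.
  have ck' : continuous (kernel true r) by exact/smooth_continuous/kernel_smooth0.
  have M20 : 0 <= M2 by apply: le_trans (HM2 0).
  have IM : `|I| <= M2 * (jordan R * ((1 - r ^+ 2) / (4 * r))).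
    apply: pint_le_bound => [|s s2]; first exact: continuous_mulf.
    rewrite normrM; apply: le_trans (ler_wpM2l _ (second_difference_le t s su HM2)) _ => //.
    by rewrite mulrCA ler_wpM2l// poisson_sqr_le.
  have [B HB] := krem_bounded false r01.
  have [W HW] := periodic_bounded cw (fun s : R => ltac:(by rewrite /w opprD !addrA pu -(pu (t - s - 1)) subrK)).
  have B0 : 0 <= B by apply: le_trans (HB 0%N 0).
  have W0 : 0 <= W by apply: le_trans (HW 0).
  have ckr M : continuous (kernel_rem false M r).
    rewrite /kernel_rem; apply: continuous_addf.
      by apply: continuous_mulf; [exact: trig_continuous|apply: continuous_addf => //; exact: continuous_cstf].
    under [X in continuous X]funext do rewrite -mulN1r.
    by apply: continuous_mulf; [exact: continuous_cstf|apply: continuous_mulf => //; exact: trig_continuous].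
  have IE M : I = \sum_(m < M.+1) r ^+ m * d m + r ^+ M.+1 * pint (fun s => kernel_rem false M.+1 r s * w s).
    rewrite /I; have -> : (fun s => poisson r s * w s) = (fun s =>
        \sum_(m < M.+1) (fweight R m * r ^+ m) * (trig false m s * w s) + r ^+ M.+1 * (kernel_rem false M.+1 r s * w s)).
      apply/funext => s; rewrite -[poisson r s]/(kernel false r s) (kernel_expand false s M r01) mulrDl mulr_suml mulrA.
      by congr (_ + _); apply: eq_bigr => m _; rewrite mulrA.
    have cs (m : nat) : continuous (fun s => fweight R m * r ^+ m * (trig false m s * w s)).
      by apply: continuous_mulf; [exact: continuous_cstf|exact: trig_mul_continuous].
    rewrite pintD; [|exact: (@continuous_sumf _ (fun m s => fweight R m * r ^+ m * (trig false m s * w s)))|].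
      rewrite (@pint_sum _ (fun m s => fweight R m * r ^+ m * (trig false m s * w s)))// pintZ; last exact: continuous_mulf.
      congr (_ + _); apply: eq_bigr => m _; rewrite pintZ; last exact: trig_mul_continuous.
      by rewrite -/(rcoef _ _ _) mulrAC dE mulrC.
    by apply: continuous_mulf; [exact: continuous_cstf|exact: continuous_mulf].
  apply/ler_addgt0Pr => e e0.
  have [M NM hM] : exists2 M, (N <= M)%N & r ^+ M.+1 * (B * W) <= e.
    have h : bsum (fun n => B * W * r ^+ n) by apply: bsumZ (bsum_geo r01); exact: mulr_ge0.
    have [|M HM] := bsum_tail _ h e0.
      by move=> n; rewrite !mulr_ge0 ?exprn_ge0// ltW.
    exists (maxn N M); first exact: leq_maxl.
    have := HM (maxn N M).+2 (leq_trans (leq_maxr N M) (leqW (leqnSn _))).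
    rewrite big_nat_recr/=; last exact: leq_trans (leq_maxr N M) (leqnSn _).
    move=> h'; apply: le_trans h'; rewrite [X in X <= _]mulrC lerDr sumr_ge0// => n _.
    by rewrite !mulr_ge0 ?exprn_ge0// ltW.
  have := IE M; rewrite -(big_mkord xpredT (fun m => r ^+ m * d m)).
  rewrite (big_cat_nat (leq0n N.+1) _)//= big_mkord => IE'.
  have h1 : `|\sum_(N.+1 <= m < M.+1) r ^+ m * d m| <= T.
    apply: le_trans (bT M.+1 _); last by rewrite ltnS.
    apply: le_trans (ler_norm_sum _ _ _) _; rewrite big_nat [leRHS]big_nat.
    apply: ler_sum => m /andP[Nm _]; rewrite normrM d0; last exact: leq_trans Nm.
    rewrite -[leRHS]mul1r ler_pM// ger0_norm ?exprn_ge0 ?exprn_ile1//; by [exact: ltW|case/andP: r01].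
  have h2 : `|r ^+ M.+1 * pint (fun s => kernel_rem false M.+1 r s * w s)| <= e.
    rewrite normrM ger0_norm ?exprn_ge0 ?(ltW r0)//; apply: le_trans hM.
    rewrite ler_wpM2l ?exprn_ge0 ?(ltW r0)//; apply: pint_le_bound => [|s _]; first exact: continuous_mulf.
    by rewrite normrM ler_pM.
  move: IE' IM h1 h2; move: (\sum_(m < N.+1) _) (\sum_(_ <= _ < _) _) (_ * pint _) (M2 * _) => x1 x2 x3 x4.
  move=> ->; rewrite !ler_norml => /andP[a1 a2] /andP[b1 b2] /andP[c1 c2].
  by apply/andP; split; lra.
have D : u t - fourier_sum N.+1 u t = - \sum_(m < N.+1) d m.
  rewrite /d sumrB opprB; congr (_ - _).
  by rewrite big_ord_recl/= mul1r big1 ?addr0// => i _; rewrite mul0r.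
rewrite D normrN; apply/ler_addgt0Pr => e e0.
pose C := M2 * jordan R; pose L := C + \sum_(m < N.+1) m%:R * `|d m|.
have C0 : 0 <= C.
  by rewrite mulr_ge0 ?(le_trans _ (HM2 0))// jordan_ge0.
have L0 : 0 <= L by rewrite addr_ge0// sumr_ge0// => m _; rewrite mulr_ge0.
(* The limit [r = 1 - h] to 1, made quantitative: [h <= 1 / 2] gives [(1 - r^2) / (4 r) <= h], and
   Bernoulli's inequality bounds the change from [r^m d_m] to [d_m] by [h m |d_m|]. *)
pose h := Num.min 2^-1 (e / (L + 1)).
have h0 : 0 < h by rewrite lt_min invr_gt0 ltr0n/= divr_gt0// ltr_wpDl.
have h2 : h <= 2^-1 by rewrite ge_min lexx.
have hL : h * L <= e.
  apply: (@le_trans _ _ (e / (L + 1) * L)); first by rewrite ler_wpM2r// ge_min lexx orbT.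
  by rewrite mulrAC ler_pdivrMr ?ltr_wpDl// ler_wpM2l ?(ltW e0)// lerDl.
clearbody h; have := key (1 - h) ltac:(lra).
have hC : M2 * (jordan R * ((1 - (1 - h) ^+ 2) / (4 * (1 - h)))) <= C * h.
  rewrite mulrA ler_wpM2l// ler_pdivrMr; last by lra.
  by nra.
have hd : \sum_(m < N.+1) (1 - (1 - h) ^+ m) * `|d m| <= h * \sum_(m < N.+1) m%:R * `|d m|.
  rewrite mulr_sumr; apply: ler_sum => m _; rewrite mulrA ler_wpM2r//.
  have := @one_sub_expn _ m h ltac:(lra); rewrite -[h *+ m]mulr_natr; move: (h * _) (_ ^+ m) => y v; lra.
have -> : \sum_(m < N.+1) d m = \sum_(m < N.+1) (1 - h) ^+ m * d m + \sum_(m < N.+1) (1 - (1 - h) ^+ m) * d m.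
  by rewrite -big_split/=; apply: eq_bigr => m _; rewrite -mulrDl addrC subrK mul1r.
move=> k1; apply: le_trans (ler_normD _ _) _.
have k2 : `|\sum_(m < N.+1) (1 - (1 - h) ^+ m) * d m| <= \sum_(m < N.+1) (1 - (1 - h) ^+ m) * `|d m|.
  apply: le_trans (ler_norm_sum _ _ _) _; apply: ler_sum => m _.
  rewrite normrM ger0_norm// subr_ge0 exprn_ile1//; lra.
apply: le_trans (lerD k1 (le_trans k2 hd)) _.
rewrite -addrA lerD2l; apply: le_trans (lerD hC (lexx _)) _.
by rewrite [C * h]mulrC -mulrDr.
Qed.

End inversion.

(** Telescoping: [1 / x^2 <= 2 / x - 2 / (x + 1)] for [x >= 1]. *)
Lemma bsum_inv_sqr (R : realType) : bsum (fun n => (n.+1%:R ^+ 2)^-1 : R).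
Proof.
have H N : \sum_(n < N) (n.+1%:R ^+ 2)^-1 <= 2 - 2 / N.+1%:R :> R.
  elim: N => [|N IH]; first by rewrite big_ord0 divr1 subrr.
  rewrite big_ord_recr/=; apply: le_trans (lerD IH (lexx _)) _.
  have n0 : 0 < N.+1%:R :> R by rewrite ltr0n.
  have n1 : 1 <= N.+1%:R :> R by rewrite ler1n.
  rewrite -[N.+2%:R]natr1; move: (N.+1%:R : R) n0 n1 => x x0 x1.
  have -> : 2 - 2 / x + (x ^+ 2)^-1 = 2 - (2 * x - 1) / x ^+ 2 by field; exact: lt0r_neq0.
  rewrite lerD2l lerN2 ler_pdivlMr ?exprn_gt0// mulrAC ler_pdivrMr ?addr_gt0//.
  by nra.
exists 2 => N; apply: le_trans (H N) _.
by rewrite gerBl divr_ge0.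
Qed.

(** * Test functions and distributions *)

Section families.
Variable R : realType.
Implicit Types (u v : nat -> R -> R).

(** Families whose derivatives of every order grow at most polynomially in [N], uniformly in [t].
    The closure is syntactic so that derivatives stay in the class; [PNat] absorbs the frequency
    that each differentiation of [trig b N] produces. *)
Inductive poly_family : (nat -> R -> R) -> Prop :=
| PNat : poly_family (fun N _ => N%:R)
| PTrig b s : poly_family (fun N t => trig b N (s - t))
| PSmooth w : smooth w -> (forall t, w (t + 1) = w t) -> poly_family (fun _ => w)
| PAdd u v : poly_family u -> poly_family v -> poly_family (fun N t => u N t + v N t)
| PMul u v : poly_family u -> poly_family v -> poly_family (fun N t => u N t * v N t).

Lemma pfam_cst (c : R) : poly_family (fun _ _ => c).
Proof. by apply: PSmooth => //; exact: smooth_cst. Qed.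

Lemma pfam_derive u : poly_family u -> exists2 du, poly_family du &
  forall N (t : R), is_derive t 1 (u N) (du N t).
Proof.
elim=> {u} [|b s|w sw pw|u v _ [du pdu Du] _ [dv pdv Dv]|u v pu [du pdu Du] pv [dv pdv Dv]].
- by exists (fun _ _ => 0); [exact: pfam_cst|move=> N t; exact: is_derive_cst].
- exists (fun N t => (- ((-1) ^+ (~~ b) * (2 * pi))) * N%:R * trig (~~ b) N (s - t)).
    apply: (PMul (u := fun N t => (- ((-1) ^+ (~~ b) * (2 * pi))) * N%:R)); last exact: PTrig.
    by apply: (PMul (pfam_cst _) PNat).
  move=> N t; have ds : is_derive t 1 (fun t : R => s - t) (0 - 1) by apply: is_deriveB.
  have := @is_derive1_comp _ (trig b N) (fun t => s - t) t _ _ (is_derive_trig b N (s - t)) ds.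
  congr is_derive; move: (2 * pi) (trig _ _ _) ((-1) ^+ _) => x y z; ring.
- exists (fun _ => derive1 w).
    by apply: PSmooth; [exact: smooth_derive|exact: derive1_periodic].
  by move=> N t; exact: smooth_is_derive.
- exists (fun N t => du N t + dv N t); first exact: PAdd.
  by move=> N t; exact: is_deriveD.
- exists (fun N t => u N t * dv N t + v N t * du N t).
    by apply: PAdd; exact: PMul.
  by move=> N t; exact: is_deriveM.
Qed.

Lemma pfam_bounded u : poly_family u ->
  exists C k, 0 <= C /\ forall N t, `|u N t| <= C * N.+1%:R ^+ k.
Proof.
have mono (C C' : R) k k' N : 0 <= C -> C <= C' -> (k <= k')%N ->
    C * N.+1%:R ^+ k <= C' * N.+1%:R ^+ k'.
  by move=> C0 CC kk; apply: ler_pM; rewrite ?exprn_ge0// ler_weXn2l// ler1n.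
elim=> {u} [|b s|w sw pw|u v _ [C [k [C0 HC]]] _ [D [l [D0 HD]]]|u v _ [C [k [C0 HC]]] _ [D [l [D0 HD]]]].
- by exists 1, 1%N; split=> // N t; rewrite mul1r expr1 normr_nat ler_nat.
- by exists 1, 0%N; split=> // N t; rewrite mul1r expr0 trig_le1.
- have [M HM] := periodic_bounded (smooth_continuous sw) pw.
  exists M, 0%N; split=> [|N t]; first exact: le_trans (HM 0).
  by rewrite expr0 mulr1.
- exists (C + D), (k + l)%N; split=> [|N t]; first exact: addr_ge0.
  apply: le_trans (ler_normD _ _) _; rewrite mulrDl lerD//.
    by apply: le_trans (HC N t) _; apply: mono => //; exact: leq_addr.
  by apply: le_trans (HD N t) _; apply: mono => //; exact: leq_addl.
- exists (C * D), (k + l)%N; split=> [|N t]; first exact: mulr_ge0.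
  by rewrite normrM exprD mulrACA ler_pM.
Qed.

Lemma pfam_derive1n u j : poly_family u -> exists2 w, poly_family w & forall N, derive1n j (u N) = w N.
Proof.
move=> pu; elim: j => [|j [w pw wE]]; first by exists u.
have [dw pdw Dw] := pfam_derive pw; exists dw => // N.
by rewrite derive1nS wE; have [_ ->] := is_derive_ext (Dw N).
Qed.

Lemma pfam_smooth u N : poly_family u -> smooth (u N).
Proof.
move=> pu; apply: (@smooth_coind _ (fun w => exists2 v, poly_family v & w = v N)); last by exists u.
move=> _ [v pv ->]; have [dv pdv Dv] := pfam_derive pv.
by have [? ->] := is_derive_ext (Dv N); split=> //; exists dv.
Qed.

Lemma pfam_periodic u : poly_family u -> forall N t, u N (t + 1) = u N t.
Proof.
elim=> {u} [|b s|w sw pw|u v _ Hu _ Hv|u v _ Hu _ Hv] N t //=; rewrite ?Hu ?Hv//.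
by rewrite opprD addrA -(trig_periodic b N (s - t - 1)) subrK.
Qed.

End families.

Section test_functions.
Variable R : realType.
Implicit Types (g h : test_fun R) (u v : R -> R) (s t d : R).

Definition test_le k d g := forall j t, (j <= k)%N -> cabs (test_derive j g t) <= d.

Definition rpart g t := complex.Re (val g t).
Definition ipart g t := complex.Im (val g t).

Lemma smooth_rpart g : smooth (rpart g).
Proof. by have [] := (test_predP _).1 (valP g). Qed.
Arguments smooth_rpart : clear implicits.

Lemma smooth_ipart g : smooth (ipart g).
Proof. by have [] := (test_predP _).1 (valP g). Qed.
Arguments smooth_ipart : clear implicits.

Lemma test_periodic g t : val g (t + 1) = val g t.
Proof. by have [] := (test_predP _).1 (valP g). Qed.

Lemma rpart_periodic g t : rpart g (t + 1) = rpart g t.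
Proof. by rewrite /rpart test_periodic. Qed.

Lemma ipart_periodic g t : ipart g (t + 1) = ipart g t.
Proof. by rewrite /ipart test_periodic. Qed.

Definition real_test u : test_fun R := to_test (fun t => (u t)%:C).

Lemma val_real_test u : smooth u -> (forall t, u (t + 1) = u t) ->
  val (real_test u) = fun t => (u t)%:C.
Proof.
move=> su pu; rewrite val_to_test//; apply/test_predP; split=> //=.
  exact: smooth_cst.
by move=> t; rewrite pu.
Qed.

Lemma test_le_exists k g : exists2 d, 0 <= d & test_le k d g.
Proof.
have H w : smooth w -> (forall t, w (t + 1) = w t) ->
    exists2 d, 0 <= d & forall j t, (j <= k)%N -> `|derive1n j w t| <= d.
  move=> sw pw; elim: k => [|k [d d0 Hd]].
    have [M HM] := periodic_bounded (smooth_continuous sw) pw.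
    by exists M => [|j t]; [exact: le_trans (HM 0)|rewrite leqn0 => /eqP->].
  have [M HM] := periodic_bounded (smooth_continuous (smooth_derive1n (n := k.+1) sw)) (derive1n_periodic k.+1 pw).
  have M0 : 0 <= M by exact: le_trans (HM 0).
  exists (d + M) => [|j t]; first exact: addr_ge0.
  rewrite leq_eqVlt => /orP[/eqP->|jk]; first by apply: le_trans (HM t) _; rewrite lerDr.
  by apply: le_trans (Hd j t jk) _; rewrite lerDl.
have [d1 d10 H1] := H _ (smooth_rpart g) (rpart_periodic g).
have [d2 d20 H2] := H _ (smooth_ipart g) (ipart_periodic g).
exists (d1 + d2) => [|j t jk]; first exact: addr_ge0.
by apply: le_trans (cabs_le_ReIm _) _; rewrite lerD ?H1 ?H2.
Qed.

Lemma Re_le_cabs (z : R[i]) : `|complex.Re z| <= cabs z.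
Proof. by rewrite -lecR -cabsE normc_ge_Re. Qed.

Lemma Im_le_cabs (z : R[i]) : `|complex.Im z| <= cabs z.
Proof.
have := Re_le_cabs ('i * z); rewrite cabsM; case: z => x y /=.
have -> : cabs 'i = 1 :> R by rewrite /cabs normc_def /= expr0n expr1n add0r sqrtr1.
by rewrite !mul0r mul1r sub0r normrN mul1r.
Qed.

Definition tcoef b n g : R[i] := periodic_integral (fun t => (trig b n t)%:C * val g t).

Lemma tcoefE b n g : tcoef b n g = rcoef b n (rpart g) +i* rcoef b n (ipart g).
Proof.
rewrite /tcoef /periodic_integral /rcoef /pint; congr (_ +i* _); apply: eq_Rintegral => t _;
  by rewrite /rpart /ipart; case: (val g t) => x y /=; rewrite mul0r ?subr0 ?addr0.
Qed.

Lemma val_testD g h t : val (g + h) t = val g t + val h t.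
Proof. by []. Qed.

Lemma val_testZ (a : R[i]) g t : val (a *: g) t = a * val g t.
Proof. by []. Qed.

Lemma val_test_sum (F : nat -> test_fun R) N t : val (\sum_(m < N) F m) t = \sum_(m < N) val (F m) t.
Proof.
elim: N => [|N IH]; first by rewrite !big_ord0.
by rewrite !big_ord_recr/= -IH.
Qed.

Lemma val_lin (a : R[i]) g h t : val (a *: g + h) t = a * val g t + val h t.
Proof. by []. Qed.

Lemma tcoef_linear b n (a : R[i]) g h : tcoef b n (a *: g + h) = a * tcoef b n g + tcoef b n h.
Proof.
have cr g' := smooth_continuous (smooth_rpart g').
have ci g' := smooth_continuous (smooth_ipart g').
have cM (c : R) u : continuous u -> continuous (fun t => c * u t).
  by move=> cu; apply: continuous_mulf => //; exact: continuous_cstf.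
rewrite !tcoefE; case: a => x y.
have -> : rpart ((x +i* y) *: g + h) = fun t => x * rpart g t + (- y * ipart g t + rpart h t).
  apply/funext => t; rewrite /rpart /ipart val_lin; case: (val g t) (val h t) => p q [p' q'] /=; ring.
have -> : ipart ((x +i* y) *: g + h) = fun t => x * ipart g t + (y * rpart g t + ipart h t).
  apply/funext => t; rewrite /rpart /ipart val_lin; case: (val g t) (val h t) => p q [p' q'] /=; ring.
rewrite !(rcoefD, rcoefZ)//; do ?[exact: cM|apply: continuous_addf => //; exact: cM].
simpc; congr (_ +i* _); ring.
Qed.

(** [n + 1 <= 2 n] for [n > 0] costs [2^k]; real and imaginary parts cost another 2. *)
Lemma tcoef_le b n k d g : test_le k d g -> cabs (tcoef b n g) * n.+1%:R ^+ k <= 2 ^+ k.+1 * d.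
Proof.
move=> gd.
have H w : smooth w -> (forall t, w (t + 1) = w t) ->
    (forall j t, (j <= k)%N -> `|derive1n j w t| <= d) -> `|rcoef b n w| * n.+1%:R ^+ k <= 2 ^+ k * d.
  move=> sw pw wd; have [->|n0] := posnP n.
    rewrite expr1n mulr1; apply: le_trans (rcoef_le _ _ (smooth_continuous sw) (fun t => wd 0%N t _)) _ => //.
    by rewrite ler_peMl ?exprn_ege1 ?ler1n// (le_trans _ (wd 0%N 0 _)).
  apply: (@le_trans _ _ (`|rcoef b n w| * (2 ^+ k * n%:R ^+ k))).
    rewrite ler_wpM2l// -exprMn lerXn2r ?nnegrE// -natrM ler_nat mul2n -addnn.
    by rewrite -addn1 leq_add2l.
  by rewrite mulrCA ler_wpM2l ?exprn_ge0// rcoef_decay// => t; exact: wd.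
have h1 := H _ (smooth_rpart g) (rpart_periodic g) (fun j t jk => le_trans (Re_le_cabs _) (gd j t jk)).
have h2 := H _ (smooth_ipart g) (ipart_periodic g) (fun j t jk => le_trans (Im_le_cabs _) (gd j t jk)).
apply: (@le_trans _ _ ((`|rcoef b n (rpart g)| + `|rcoef b n (ipart g)|) * n.+1%:R ^+ k)).
  by rewrite ler_wpM2r ?exprn_ge0// tcoefE; exact: cabs_le_ReIm.
by rewrite mulrDl exprS -mulrA mulr_natl mulr2n lerD.
Qed.

Lemma tcoef_reflect b n g : tcoef b n (reflect_fun g) = (-1) ^+ b * tcoef b n g.
Proof.
have E w : continuous w -> rcoef b n (fun t => w (- t)) = (-1) ^+ b * rcoef b n w.
  move=> cw; rewrite /rcoef -pint_reflect; last first.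
    by apply: trig_mul_continuous; apply: continuous_compf => // x; exact: oppr_continuous.
  rewrite -pintZ; last exact: trig_mul_continuous.
  by congr pint; apply/funext => t; rewrite opprK trig_reflect mulrA.
have V : val (reflect_fun g) = fun t => val g (- t) by rewrite val_to_test//; exact: test_pred_reflect.
rewrite !tcoefE; have -> : rpart (reflect_fun g) = fun t => rpart g (- t) by rewrite /rpart V.
have -> : ipart (reflect_fun g) = fun t => ipart g (- t) by rewrite /ipart V.
rewrite !E; [|exact/smooth_continuous/smooth_ipart|exact/smooth_continuous/smooth_rpart].
by case: b {E}; rewrite ?expr1 ?expr0 ?mul1r ?mulN1r; simpc.
Qed.

Lemma tcoef_real b n u : smooth u -> (forall t, u (t + 1) = u t) ->
  tcoef b n (real_test u) = (rcoef b n u)%:C.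
Proof.
move=> su pu; rewrite tcoefE /rpart /ipart val_real_test//=; congr (_ +i* _).
by rewrite rcoef_cst mul0r.
Qed.

Definition trig_test b m : test_fun R := real_test (trig b m).

Lemma smooth_trig b m : smooth (@trig R b m).
Proof.
have -> : @trig R b m = fun t => trig b m (0 - - t) by apply/funext => t; rewrite opprK add0r.
exact: (smooth_reflect (pfam_smooth (N := m) (PTrig b 0))).
Qed.

Lemma val_trig_test b m t : val (trig_test b m) t = (trig b m t)%:C.
Proof. by rewrite val_real_test//; [exact: smooth_trig|exact: trig_periodic]. Qed.

Lemma reflect_trig_test b m : reflect_fun (trig_test b m) = (-1) ^+ b *: trig_test b m.
Proof.
apply/val_inj; rewrite val_to_test; last exact: test_pred_reflect.
apply/funext => t; rewrite val_trig_test trig_reflect.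
transitivity ((-1) ^+ b * val (trig_test b m) t); last by [].
by rewrite val_trig_test rmorphM rmorph_sign.
Qed.

(** Differentiating the trigonometric functions and integrating their coefficients by parts produce
    the same factor. So partial sums commute with derivatives, and [fpart_dist] applied to the
    derivatives gives convergence of all orders. *)
Lemma is_derive_fpart N u (t : R) : smooth u -> (forall t, u (t + 1) = u t) ->
  is_derive t 1 (fourier_sum N u) (fourier_sum N (derive1 u) t).
Proof.
move=> su pu; rewrite /fourier_sum.
have D (m : nat) : is_derive t 1 (fun t => fweight R m * (rcoef false m u * trig false m t + rcoef true m u * trig true m t))
    (fweight R m * (rcoef false m (derive1 u) * trig false m t + rcoef true m (derive1 u) * trig true m t)).
  have D1 b : is_derive t 1 (fun t => rcoef b m u * trig b m t)
      (rcoef b m u * ((-1) ^+ (~~ b) * (2 * pi * m%:R) * trig (~~ b) m t)).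
    by apply: is_deriveZ; exact: is_derive_trig.
  have := is_deriveZ (fweight R m) (is_deriveD (D1 false) (D1 true)).
  congr is_derive; rewrite !rcoef_derive// /GRing.scale/=; congr (_ * _).
  by rewrite expr0 expr1; move: (2 * pi * _) => x; ring.
elim: N => [|N IH].
  rewrite big_ord0; have := is_derive_cst (0 : R) t 1.
  by congr is_derive; apply/funext => s; rewrite big_ord0.
rewrite big_ord_recr/=; have := is_deriveD IH (D N).
by congr is_derive; apply/funext => s; rewrite big_ord_recr.
Qed.

Lemma derive1n_fpart_sub N u j : smooth u -> (forall t, u (t + 1) = u t) ->
  derive1n j (fun t => fourier_sum N u t - u t) = fun t => fourier_sum N (derive1n j u) t - derive1n j u t.
Proof.
move=> su pu; elim: j => [//|j IH]; rewrite derive1nS IH derive1nS.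
have sj := smooth_derive1n (n := j) su.
have [|_ ->//] := @is_derive_ext _ (fun t => fourier_sum N (derive1n j u) t - derive1n j u t)
  (fun t => fourier_sum N (derive1 (derive1n j u)) t - derive1 (derive1n j u) t).
move=> t; apply: is_deriveB; last exact: smooth_is_derive.
by apply: is_derive_fpart => //; exact: derive1n_periodic.
Qed.

Lemma fpart_cvg u j (e : R) : smooth u -> (forall t, u (t + 1) = u t) -> 0 < e ->
  exists N0, forall N t, (N0 <= N)%N -> `|derive1n j (fun t => fourier_sum N.+1 u t - u t) t| <= e.
Proof.
move=> su pu e0; pose v := derive1n j u.
have sv : smooth v by exact: smooth_derive1n.
have pv t : v (t + 1) = v t by exact: derive1n_periodic.
have [M HM] := periodic_bounded (smooth_continuous (smooth_derive1n (n := 2) sv)) (derive1n_periodic 2 pv).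
have [M' HM'] := periodic_bounded (smooth_continuous sv) pv.
have M0 : 0 <= M by exact: le_trans (HM 0).
have M'0 : 0 <= M' by exact: le_trans (HM' 0).
(* Two derivatives bound a coefficient by [4 (M + M') / (m + 1)^2], where [(m + 1)^2 <= 4 m^2] for
   [m > 0] and [M'] covers [m = 0]; two coefficients and a weight of at most 2 make 16. *)
pose c := 16 * (M + M').
have c0 : 0 <= c by rewrite mulr_ge0// addr_ge0.
have cb b m : `|rcoef b m v| <= 4 * (M + M') * (m.+1%:R ^+ 2)^-1.
  rewrite ler_pdivlMr ?exprn_gt0//; have [->|m0] := posnP m.
    rewrite expr1n mulr1; apply: le_trans (rcoef_le _ _ (smooth_continuous sv) HM') _; lra.
  have h := rcoef_decay b m sv pv HM.
  have h2 : m.+1%:R ^+ 2 <= 4 * m%:R ^+ 2 :> R.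
    by rewrite -!natrX -natrM ler_nat; nia.
  have h3 := ler_wpM2l (normr_ge0 (rcoef b m v)) h2.
  by move: h h3; move: (_ ^+ 2) (_ ^+ 2) (`|_|) => x y z; nra.
have sb : bsum (fun m => c * (m.+1%:R ^+ 2)^-1) by apply: bsumZ c0 (bsum_inv_sqr R).
have b0 m : 0 <= c * (m.+1%:R ^+ 2)^-1 by rewrite mulr_ge0// invr_ge0 exprn_ge0.
have [N0 HN0] := bsum_tail b0 sb e0.
exists N0 => N t NN; rewrite derive1n_fpart_sub// -/v distrC.
apply: (fpart_dist (b := fun m => c * (m.+1%:R ^+ 2)^-1)) => // [m|K NK].
  have k2 : 0 <= fweight R m <= 2 by rewrite /fweight; case: ifP => _; lra.
  case/andP: k2 => k0 k2.
  apply: (@le_trans _ _ (2 * (4 * (M + M') * (m.+1%:R ^+ 2)^-1 + 4 * (M + M') * (m.+1%:R ^+ 2)^-1))).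
    by apply: ler_pM => //; do ?[exact: addr_ge0|exact: lerD].
  by apply: le_of_eq; rewrite /c; move: (_^-1) => x; ring.
apply: le_trans (HN0 K (leq_trans (leqW NN) NK)).
rewrite [leRHS](big_cat_nat (leqW NN) NK)//= lerDr sumr_ge0// => i _.
Qed.

End test_functions.

(** * Fourier coefficients and Poisson means of a distribution *)

Section distributions.
Variables (R : realType) (Y : normedModType R[i]).
Variable f : test_fun R -> Y.
Hypothesis fdist : test_distribution f.
Implicit Types (g h : test_fun R).

Let flin : linear f. Proof. by case: fdist. Qed.

Lemma distD g h : f (g + h) = f g + f h.
Proof. by have := flin 1 g h; rewrite !scale1r. Qed.

Lemma dist0 : f 0 = 0.
Proof. by apply: (@addrI _ (f 0)); rewrite -distD !addr0. Qed.

Lemma distZ (a : R[i]) g : f (a *: g) = a *: f g.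
Proof. by have := flin a g 0; rewrite dist0 !addr0. Qed.

Lemma distB g h : f (g - h) = f g - f h.
Proof. by rewrite distD -scaleN1r distZ scaleN1r. Qed.

Lemma dist_sum (u : nat -> test_fun R) N : f (\sum_(m < N) u m) = \sum_(m < N) f (u m).
Proof.
by elim: N => [|N IH]; rewrite ?big_ord0 ?dist0// !big_ord_recr/= distD IH.
Qed.

Lemma dist_cont g (e : R) : 0 < e -> exists k (d : R), 0 < d /\
  forall h, test_le k d (h - g) -> rnorm (f h - f g) < e.
Proof.
move=> e0; case: fdist => _ /(_ g e e0)[k [d [d0 H]]]; exists k, d; split=> // h hd.
by apply: H => j t jk; rewrite cabsE lecR; exact: hd.
Qed.

Lemma dist_cvg (u : nat -> test_fun R) g :
  (forall k (d : R), 0 < d -> exists N0, forall N, (N0 <= N)%N -> test_le k d (u N - g)) ->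
  f (u N) @[N --> \oo] --> f g.
Proof.
move=> H; apply/cvg_rnormP => e e0; have [k [d [d0 Hd]]] := dist_cont g e0.
have [N0 HN] := H k d d0; exists N0 => N /HN/Hd; exact: ltW.
Qed.

(** Continuity at 0 bounds [f] on a neighbourhood given by finitely many derivatives. Dividing [v N]
    by a power of [N + 1] brings it inside, and linearity undoes the scaling. *)
Lemma dist_pfam (v : nat -> R -> R) : poly_family v -> polybdd (fun N => f (real_test (v N))).
Proof.
move=> pv; have [k [d [d0 Hd]]] := dist_cont 0 ltr01.
have [C [m [C0 HC]]] : exists C m, 0 <= C /\ forall j N t, (j <= k)%N ->
    `|derive1n j (v N) t| <= C * N.+1%:R ^+ m.
  elim: k {Hd} => [|k [C [m [C0 HC]]]].
    have [C [m [C0 HC]]] := pfam_bounded pv; exists C, m; split=> // j N t.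
    by rewrite leqn0 => /eqP->; exact: HC.
  have [w pw wE] := pfam_derive1n k.+1 pv.
  have [D [l [D0 HD]]] := pfam_bounded pw.
  exists (C + D), (m + l)%N; split=> [|j N t]; first exact: addr_ge0.
  have N1 : 1 <= N.+1%:R :> R by rewrite ler1n.
  have P i i' : (i <= i')%N -> N.+1%:R ^+ i <= N.+1%:R ^+ i' :> R by exact: ler_weXn2l.
  rewrite leq_eqVlt mulrDl => /orP[/eqP->|jk].
    rewrite wE; apply: le_trans (HD N t) _; apply: le_trans (ler_wpM2l D0 (P _ _ (leq_addl m l))) _.
    by rewrite lerDr mulr_ge0 ?exprn_ge0.
  apply: le_trans (HC j N t jk) _; apply: le_trans (ler_wpM2l C0 (P _ _ (leq_addr l m))) _.
  by rewrite lerDl mulr_ge0 ?exprn_ge0.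
exists ((C + 1) / d), m => N.
have sv := pfam_smooth (N := N) pv; have qv := pfam_periodic pv N.
have C1 : 0 < C + 1 by rewrite ltr_wpDl.
have Nm : 0 < N.+1%:R ^+ m :> R by rewrite exprn_gt0// ltr0n.
pose c := d / ((C + 1) * N.+1%:R ^+ m).
have c0 : 0 < c by rewrite divr_gt0// mulr_gt0.
have cE : c * ((C + 1) * N.+1%:R ^+ m) = d by rewrite divfK// gt_eqF// mulr_gt0.
clearbody c.
have pc : poly_family (fun n t => c * v n t) by exact: (PMul (pfam_cst c) pv).
have Zj j : derive1n j (fun t => c * v N t) = fun t => c * derive1n j (v N) t.
  elim: j => [//|j IH]; rewrite derive1nS IH derive1nS.
  have [|_ ->//] := @is_derive_ext _ (fun t => c * derive1n j (v N) t)
    (fun t => c * derive1 (derive1n j (v N)) t).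
  by move=> t; apply: is_deriveZ; apply: smooth_is_derive; exact: smooth_derive1n.
have E : real_test (fun t => c * v N t) = c%:C *: real_test (v N).
  apply/val_inj; rewrite val_real_test; [|exact: (pfam_smooth (N := N) pc)|exact: (pfam_periodic pc)].
  apply/funext => t; transitivity (c%:C * val (real_test (v N)) t); last by [].
  by rewrite val_real_test// rmorphM.
have := Hd (real_test (fun t => c * v N t)); rewrite dist0 !subr0 => /(_ _)/ltW.
rewrite E distZ rnormZ cabs_real gtr0_norm// => h.
rewrite mulrAC ler_pdivlMr// -cE.
have {}h : c * rnorm (f (real_test (v N))) <= 1.
  apply: h => j t jk; rewrite /test_derive.
  have -> : (fun s => complex.Re (val (c%:C *: real_test (v N)) s)) = fun t => c * v N t.
    by rewrite -E val_real_test; [|exact: (pfam_smooth (N := N) pc)|exact: (pfam_periodic pc)].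
  have -> : (fun s => complex.Im (val (c%:C *: real_test (v N)) s)) = fun=> 0.
    by rewrite -E val_real_test; [|exact: (pfam_smooth (N := N) pc)|exact: (pfam_periodic pc)].
  have Z0 : derive1n j (fun _ : R => 0 : R) = fun=> 0.
    elim: j {jk} => [//|j IH]; rewrite derive1nS IH.
    by have [_ ->] := is_derive_ext (fun t => is_derive_cst (0 : R) t 1).
  rewrite Z0 -[_ +i* 0]/((_)%:C) cabs_real Zj normrM gtr0_norm// -cE ler_wpM2l// ?(ltW c0)//.
  apply: le_trans (HC j N t jk) _; rewrite ler_wpM2r ?(ltW Nm)//.
  by rewrite lerDl.
have K0 : 0 <= (C + 1) * N.+1%:R ^+ m by rewrite mulr_ge0// ltW.
move: (rnorm _) (_ * _ ^+ _) h K0 => x K h K0.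
have -> : x * (c * K) = c * x * K by ring.
by rewrite ler_piMl.
Qed.

(** The weight makes [a_m] the coefficient of the series [sum a_m cos (2 pi m t)]; likewise for the
    sines. *)
Definition ccoef m : Y := (fweight R m)%:C *: f (trig_test R false m).
Definition scoef m : Y := (fweight R m)%:C *: f (trig_test R true m).

Lemma trig_polybdd b : polybdd (fun m => (fweight R m)%:C *: f (trig_test R b m)).
Proof.
have [C [k HC]] := dist_pfam (PTrig b 0).
exists (2 * C), k => m; rewrite rnormZ cabs_real.
have -> : `|fweight R m| = fweight R m by rewrite ger0_norm// /fweight; case: ifP.
rewrite -mulrA; apply: ler_pM; rewrite ?rnorm_ge0//.
- by rewrite /fweight; case: ifP.
- by rewrite /fweight; case: ifP => _; lra.
apply: le_trans (HC m); apply: le_of_eq.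
(* The family in use is the reflected [trig b m (0 - t)], hence a sign, of modulus 1. *)
have -> : trig_test R b m = (-1) ^+ b *: real_test (fun t => trig b m (0 - t)).
  apply/val_inj; apply/funext => t; rewrite val_trig_test.
  transitivity ((-1) ^+ b * val (real_test (fun t => trig b m (0 - t))) t); last by [].
  rewrite val_real_test; [|exact: (pfam_smooth (N := m) (PTrig b 0))|exact: (pfam_periodic (PTrig b 0) m)].
  by rewrite sub0r trig_reflect -(rmorph_sign (real_complex R)) -rmorphM mulrA -expr2 sqrr_sign mul1r.
have c1 : cabs ((-1) ^+ b : R[i]) = 1 by rewrite cabsX cabsN (cabs_nat R 1) expr1n.
by rewrite distZ rnormZ c1 mul1r.
Qed.

(** The displayed sum is [f] applied to a partial Fourier sum of [g], by linearity, and these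
    partial sums converge to [g] as test functions. *)
Lemma dist_fourier g : (\sum_(m < N.+1) (tcoef false m g *: ccoef m + tcoef true m g *: scoef m))
  @[N --> \oo] --> f g.
Proof.
pose S N : test_fun R := \sum_(m < N.+1) (fweight R m)%:C *:
  (tcoef false m g *: trig_test R false m + tcoef true m g *: trig_test R true m).
have fS N : f (S N) = \sum_(m < N.+1) (tcoef false m g *: ccoef m + tcoef true m g *: scoef m).
  rewrite /S (dist_sum (fun m => (fweight R m)%:C *: (tcoef false m g *: trig_test R false m + tcoef true m g *: trig_test R true m))).
  apply: eq_bigr => m _; rewrite distZ distD !distZ scalerDr !scalerA.
  by rewrite /ccoef /scoef ?scalerA ![_ * (fweight R m)%:C]mulrC.
under eq_cvg do rewrite -fS.
have vS N t : val (S N - g) t = (fourier_sum N.+1 (rpart g) t - rpart g t) +i* (fourier_sum N.+1 (ipart g) t - ipart g t).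
  transitivity (val (S N) t - val g t); first by [].
  rewrite /S (val_test_sum (fun m => (fweight R m)%:C *: (tcoef false m g *: trig_test R false m + tcoef true m g *: trig_test R true m))).
  have -> : \sum_(m < N.+1) val ((fweight R m)%:C *: (tcoef false m g *: trig_test R false m + tcoef true m g *: trig_test R true m)) t
      = fourier_sum N.+1 (rpart g) t +i* fourier_sum N.+1 (ipart g) t.
    have csum M (p q : 'I_M -> R) : \sum_(m < M) (p m +i* q m) = (\sum_(m < M) p m) +i* (\sum_(m < M) q m).
      by elim/big_rec3: _ => // i x y z _ ->; simpc.
    rewrite /fourier_sum -csum; apply: eq_bigr => m _.
    rewrite val_testZ val_testD !val_testZ !val_trig_test !tcoefE; simpc; congr (_ +i* _); ring.
  by rewrite /rpart /ipart; case: (val g t).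
apply: dist_cvg => k d d0.
have d20 : 0 < d / 2 by rewrite divr_gt0.
elim: k => [|k [N1 H1]].
  have [N1 H1] := fpart_cvg 0%N (@smooth_rpart _ g) (rpart_periodic g) d20.
  have [N2 H2] := fpart_cvg 0%N (@smooth_ipart _ g) (ipart_periodic g) d20.
  exists (maxn N1 N2) => N; rewrite geq_max => /andP[n1 n2] j t; rewrite leqn0 => /eqP->.
  rewrite /test_derive; under eq_fun do rewrite vS; under [X in _ +i* derive1n _ X _]funext do rewrite vS.
  apply: le_trans (cabs_le_ReIm _) _; rewrite [leRHS]splitr lerD//; [exact: H1|exact: H2].
have [N2 H2] := fpart_cvg k.+1 (@smooth_rpart _ g) (rpart_periodic g) d20.
have [N3 H3] := fpart_cvg k.+1 (@smooth_ipart _ g) (ipart_periodic g) d20.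
exists (maxn N1 (maxn N2 N3)) => N; rewrite !geq_max => /and3P[n1 n2 n3] j t.
rewrite leq_eqVlt => /orP[/eqP->|jk]; last exact: H1.
rewrite /test_derive; under eq_fun do rewrite vS; under [X in _ +i* derive1n _ X _]funext do rewrite vS.
by apply: le_trans (cabs_le_ReIm _) _; rewrite [leRHS]splitr lerD//; [exact: H2|exact: H3].
Qed.

(** [kernel_expand] is an identity between test functions of [s], to which [f] applies. The
    remainder is [r^(N + 1)] times the value of [f] on a family in [poly_family]; this value grows
    at most polynomially, so the product tends to 0. *)
Lemma dist_kernel b r t : 0 <= r < 1 ->
  sums (fun m => (r ^+ m)%:C *: (if b then (trig true m t)%:C *: ccoef m - (trig false m t)%:C *: scoef m
    else (trig false m t)%:C *: ccoef m + (trig true m t)%:C *: scoef m))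
  (convol (kernel b r) f t).
Proof.
move=> r01; have /andP[r0 r1] := r01.
pose V N s := kernel_rem b N r (t - s).
have pk b' : poly_family (fun _ s => kernel b' r (t - s)).
  apply: PSmooth; first exact: kernel_smooth.
  by move=> s; rewrite opprD addrA -(kernel_periodic b' r (t - s - 1)) subrK.
have pV : poly_family V.
  rewrite /V /kernel_rem; case: b {V}.
    apply: PAdd; apply: PMul; [exact: PTrig|exact: (pk true)|exact: PTrig|].
    exact: (PAdd (pk false) (pfam_cst 1)).
  apply: PAdd; first by apply: PMul; [exact: PTrig|exact: (PAdd (pk false) (pfam_cst 1))].
  have := PMul (pfam_cst (-1)) (PMul (PTrig true t) (pk true)).
  by congr poly_family; apply/funext => N; apply/funext => s; rewrite mulN1r.
pose W m s := trig b m (t - s) : R.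
have pW : poly_family W by exact: PTrig.
have fW m : (fweight R m)%:C *: f (real_test (W m)) = if b then (trig true m t)%:C *: ccoef m - (trig false m t)%:C *: scoef m
    else (trig false m t)%:C *: ccoef m + (trig true m t)%:C *: scoef m.
  have -> : real_test (W m) = if b then (trig true m t)%:C *: trig_test R false m - (trig false m t)%:C *: trig_test R true m
      else (trig false m t)%:C *: trig_test R false m + (trig true m t)%:C *: trig_test R true m.
    apply/val_inj/funext => s; rewrite val_real_test; [|exact: (pfam_smooth (N := m) pW)|exact: (pfam_periodic pW)].
    rewrite /W trigB; case: b {V pV W pW} => /=.
      transitivity ((trig true m t)%:C * val (trig_test R false m) s - (trig false m t)%:C * val (trig_test R true m) s); last by [].
      by rewrite !val_trig_test rmorphB !rmorphM.
    transitivity ((trig false m t)%:C * val (trig_test R false m) s + (trig true m t)%:C * val (trig_test R true m) s); last by [].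
    by rewrite !val_trig_test rmorphD !rmorphM.
  by case: b {V pV W pW}; rewrite ?distB ?distD !distZ ?scalerBr ?scalerDr /ccoef /scoef ?scalerA ![_ * (fweight R m)%:C]mulrC.
have E N : convol (kernel b r) f t = \sum_(m < N.+1) (r ^+ m)%:C *: ((fweight R m)%:C *: f (real_test (W m))) +
    (r ^+ N.+1)%:C *: f (real_test (V N.+1)).
  have -> : \sum_(m < N.+1) (r ^+ m)%:C *: ((fweight R m)%:C *: f (real_test (W m))) =
      \sum_(m < N.+1) f ((fweight R m * r ^+ m)%:C *: real_test (W m)).
    by apply: eq_bigr => m _; rewrite distZ scalerA -rmorphM mulrC.
  rewrite -(dist_sum (fun m => (fweight R m * r ^+ m)%:C *: real_test (W m))) -distZ -distD.
  rewrite /convol; congr f; apply/val_inj/funext => s.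
  rewrite val_real_test; last first.
  - exact: (pfam_periodic (pk b) 0).
  - exact: (pfam_smooth (N := 0%N) (pk b)).
  have vs M : val (\sum_(m < M) (fweight R m * r ^+ m)%:C *: real_test (W m)) s = (\sum_(m < M) fweight R m * r ^+ m * W m s)%:C.
    rewrite (val_test_sum (fun m => (fweight R m * r ^+ m)%:C *: real_test (W m))) rmorph_sum.
    apply: eq_bigr => m _; rewrite val_testZ [in RHS]rmorphM.
    by rewrite val_real_test; [|exact: (pfam_smooth (N := m) pW)|exact: (pfam_periodic pW)].
  transitivity (val (\sum_(m < N.+1) (fweight R m * r ^+ m)%:C *: real_test (W m)) s + (r ^+ N.+1)%:C * val (real_test (V N.+1)) s); last by [].
  rewrite vs val_real_test; [|exact: (pfam_smooth (N := N.+1) pV)|exact: (pfam_periodic pV)].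
  by rewrite (kernel_expand b (t - s) N r01) rmorphD !rmorphM.
have [C [k HC]] := dist_pfam pV.
apply: (@sums_eq _ _ (fun m => (r ^+ m)%:C *: ((fweight R m)%:C *: f (real_test (W m))))).
  by move=> m; rewrite fW.
apply/cvg_rnormP => e e0.
have C0 : 0 <= C by have := HC 0%N; rewrite expr1n mulr1; apply: le_trans; exact: rnorm_ge0.
have b0 n : 0 <= C * (n.+1%:R ^+ k * r ^+ n) by rewrite !mulr_ge0 ?exprn_ge0.
have [N0 HN0] := bsum_tail b0 (bsumZ C0 (bsum_poly_geo k r01)) e0.
exists N0.+1 => -[//|N] NN; rewrite rnormB (E N) /series/= big_mkord addrAC subrr add0r.
rewrite rnormZ cabs_real ger0_norm ?exprn_ge0//.
have := HN0 N.+2 (leqW (ltnW NN)); rewrite big_nat_recr/=; last exact: ltnW.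
apply: le_trans; rewrite -[leLHS]add0r lerD ?sumr_ge0//.
by rewrite mulrC mulrA ler_wpM2r ?exprn_ge0.
Qed.

End distributions.

(** * The isomorphism *)

Section trigonometric_series.
Variables (R : realType) (Y : completeNormedModType R[i]).
Implicit Types (a : nat -> Y) (g h : test_fun R) (b : bool).

(** The limit exists as soon as [a] has polynomial growth, by [tsumP]. *)
Definition tsum b a g : Y := limn (series (fun n => tcoef b n g *: a n)).

Lemma tsum_eq b a g l : sums (fun n => tcoef b n g *: a n) l -> tsum b a g = l.
Proof. by apply: cvg_lim; exact: norm_hausdorff. Qed.

(** [k] derivatives of [g] compensate the growth of [a], two more make the terms summable. *)
Lemma tsum_term_le b a : polybdd a -> exists k (D : R), 0 <= D /\ forall g (d : R),
  test_le k d g -> forall n, rnorm (tcoef b n g *: a n) <= D * d * (n.+1%:R ^+ 2)^-1.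
Proof.
move=> [C [k HC]].
have C0 : 0 <= C by have := HC 0%N; rewrite expr1n mulr1; apply: le_trans; exact: rnorm_ge0.
exists (k + 2)%N, (C * 2 ^+ (k + 2).+1); split=> [|g d gd n]; first by rewrite mulr_ge0 ?exprn_ge0.
have n0 : 0 < n.+1%:R ^+ 2 :> R by rewrite exprn_gt0// ltr0n.
rewrite rnormZ ler_pdivlMr//.
have h := tcoef_le b n gd; rewrite exprD mulrA in h.
apply: (@le_trans _ _ (cabs (tcoef b n g) * (C * n.+1%:R ^+ k) * n.+1%:R ^+ 2)).
  by rewrite ler_wpM2r ?(ltW n0)// ler_wpM2l ?cabs_ge0.
have -> : cabs (tcoef b n g) * (C * n.+1%:R ^+ k) * n.+1%:R ^+ 2 =
  C * (cabs (tcoef b n g) * n.+1%:R ^+ k * n.+1%:R ^+ 2) by ring.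
by rewrite -[leRHS]mulrA ler_wpM2l.
Qed.

Lemma tsumP b a g : polybdd a -> sums (fun n => tcoef b n g *: a n) (tsum b a g).
Proof.
move=> /(tsum_term_le b)[k [D [D0 HD]]]; have [d d0 gd] := test_le_exists k g.
have [l al] := dom_sums (HD g d gd) (bsumZ (mulr_ge0 D0 d0) (bsum_inv_sqr R)).
by rewrite (tsum_eq al).
Qed.

Lemma tsum_linear b a : polybdd a -> linear (tsum b a).
Proof.
move=> pa c g h; apply: tsum_eq.
apply: sums_eq (sumsD (sumsZ (c := c) (@tsumP b a g pa)) (@tsumP b a h pa)) => n.
by rewrite tcoef_linear scalerDl scalerA.
Qed.

Lemma tsum_distribution b a : polybdd a -> test_distribution (tsum b a).
Proof.
move=> pa; split=> [|g e e0]; first exact: tsum_linear.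
have [k [D [D0 HD]]] := tsum_term_le b pa; have [B HB] := bsum_inv_sqr R.
have B0 : 0 <= B by have := HB 0%N; rewrite big_ord0.
have DB : 0 < D * B + 1 by rewrite ltr_wpDl// mulr_ge0.
have d0 : 0 < e / (D * B + 1) by rewrite divr_gt0.
exists k, (e / (D * B + 1)); split=> // h hg.
have hg' : test_le k (e / (D * B + 1)) (h - g).
  by move=> j t jk; rewrite -lecR -cabsE; exact: hg.
have -> : tsum b a h - tsum b a g = tsum b a (h - g).
  by have := @tsum_linear b a pa (-1) g h; rewrite !scaleN1r [- g + h]addrC [- _ + _]addrC.
apply: (@le_lt_trans _ _ (D * (e / (D * B + 1)) * B)).
  apply: (sums_le (@tsumP b a (h - g) pa) (HD _ _ hg')) => M.
  by rewrite -mulr_sumr ler_wpM2l// mulr_ge0// ltW.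
rewrite mulrAC mulrA ltr_pdivrMr// [e * _]mulrC ltr_pM2r//.
by rewrite ltrDl.
Qed.

Lemma tsum_reflect b a g : polybdd a -> tsum b a (reflect_fun g) = (-1) ^+ b *: tsum b a g.
Proof.
move=> pa; apply: tsum_eq; apply: sums_eq (sumsZ (c := (-1) ^+ b) (@tsumP b a g pa)) => n.
by rewrite tcoef_reflect scalerA.
Qed.

Lemma tsum_trig b a b' m :
  tsum b a (trig_test R b' m) =
  (if b == b' then (if m == 0%N then (~~ b)%:R else 2^-1) else 0)%:C *: a m.
Proof.
have E n : tcoef b n (trig_test R b' m) *: a n = if n == m then
    (if b == b' then (if m == 0%N then (~~ b)%:R else 2^-1) else 0)%:C *: a m else 0.
  rewrite tcoef_real ?rcoef_trig; [|exact: smooth_trig|exact: trig_periodic].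
  by case: eqP => [->|]/=; rewrite ?scale0r.
apply: tsum_eq; have := @sums_finite _ _ (fun n => tcoef b n (trig_test R b' m) *: a n) m.+1.
rewrite big_ord_recr/= big1 ?add0r => [|i _]; last first.
  by rewrite E ltn_eqF.
by rewrite E eqxx; apply=> n mn; rewrite E gtn_eqF.
Qed.

(** The sine of frequency 0 vanishes, so a sine series does not see [a 0]; this is the origin of the
    condition on it. *)
Lemma tsum_coef b a b' m : (b -> a 0%N = 0) ->
  (fweight R m)%:C *: tsum b a (trig_test R b' m) = if b == b' then a m else 0.
Proof.
move=> a0; rewrite tsum_trig /fweight; case: ifP => [/eqP->|m0].
  by rewrite scale1r; case: eqP => [_|]; rewrite ?scale0r//; case: b a0 => a0; rewrite ?scale1r// scale0r a0.
case: eqP => [_|]; last by rewrite scale0r scaler0.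
by rewrite scalerA -rmorphM mulfV ?scale1r// pnatr_eq0.
Qed.

End trigonometric_series.

(** * Poisson means in terms of the analytic function *)

Section poisson_parts.
Variables (R : realType) (Y : completeNormedModType R[i]).
Variables (a : nat -> Y) (F : R[i] -> Y).
Hypothesis aF : global F a 1.
Implicit Types (r s t : R).

(** [evenp] and [oddp] are the means [A] and [B]: replacing [t] by [- t] conjugates the point, and
    [- 'i * 2^-1] is [1 / (2 i)]. *)
Definition evenp r t : Y := (2^-1)%:C *: (F (r%:C * cis t) + F (r%:C * cis (- t))).
Definition oddp r t : Y := (- 'i * (2^-1)%:C) *: (F (r%:C * cis t) - F (r%:C * cis (- t))).

Lemma polar_pow b r t n : (r%:C * cis (if b then - t else t)) ^+ n =
  (r ^+ n)%:C * ((trig false n t)%:C + (-1) ^+ b * 'i * (trig true n t)%:C) :> R[i].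
Proof.
rewrite exprMn -rmorphXn; congr (_ * _); rewrite -cis_natM /trig /cis.
case: b; last by rewrite mul1r !mulrA; simpc.
by rewrite expr1 !mulrN cosN sinN !mulrA; simpc.
Qed.

Lemma half2 : (2^-1)%:C * 2%:R = 1 :> R[i].
Proof. by rewrite -(rmorph_nat (real_complex R)) -rmorphM mulVf. Qed.

Lemma mulii : 'i * 'i = -1 :> R[i].
Proof. by simpc. Qed.

Lemma evenp_sums r t : 0 <= r < 1 ->
  sums (fun m => (r ^+ m)%:C *: ((trig false m t)%:C *: a m)) (evenp r t).
Proof.
move=> /andP[r0 r1].
have h s : psum a (r%:C * cis s) (F (r%:C * cis s)) by apply: aF; rewrite cabs_polar.
apply: sums_eq (sumsZ (c := (2^-1)%:C) (sumsD (h t) (h (- t)))) => m.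
rewrite (polar_pow false) (polar_pow true) -scalerDl !scalerA; congr (_ *: _).
rewrite -mulrDr expr1 expr0; have := half2.
move: (trig false m t)%:C (trig true m t)%:C (r ^+ m)%:C (2^-1)%:C ('i : R[i]) => x y v h2 w E.
by transitivity (h2 * 2%:R * (v * x)); [ring|rewrite E mul1r].
Qed.

Lemma oddp_sums r t : 0 <= r < 1 ->
  sums (fun m => (r ^+ m)%:C *: ((trig true m t)%:C *: a m)) (oddp r t).
Proof.
move=> /andP[r0 r1].
have h s : psum a (r%:C * cis s) (F (r%:C * cis s)) by apply: aF; rewrite cabs_polar.
apply: sums_eq (sumsZ (c := - 'i * (2^-1)%:C) (sumsD (h t) (sumsN (h (- t))))) => m.
rewrite (polar_pow false) (polar_pow true) -scalerBl !scalerA; congr (_ *: _).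
rewrite -mulrBr expr1 expr0; have := half2; have := mulii.
move: (trig false m t)%:C (trig true m t)%:C (r ^+ m)%:C (2^-1)%:C ('i : R[i]) => x y v h2 w E1 E2.
by transitivity (- (w * w) * (h2 * 2%:R) * (v * y)); [ring|rewrite E1 E2 opprK !mul1r].
Qed.

Lemma even_oddp r t : F (r%:C * cis t) = evenp r t + 'i *: oddp r t.
Proof.
rewrite /evenp /oddp scalerA; have -> : 'i * (- 'i * (2^-1)%:C) = (2^-1)%:C :> R[i].
  by rewrite mulNr mulrN mulrA mulii mulN1r opprK.
rewrite -scalerDr addrACA subrr addr0 scalerDr -scalerDl.
by have -> : (2^-1)%:C + (2^-1)%:C = 1 :> R[i]; rewrite ?scale1r// -half2 mulr_natr mulr2n.
Qed.

Lemma cabs_half : cabs ((2^-1)%:C : R[i]) = 2^-1.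
Proof. by rewrite cabs_real ger0_norm. Qed.

Lemma cabs_i : cabs ('i : R[i]) = 1.
Proof. by rewrite /cabs normc_def /= expr0n expr1n add0r sqrtr1. Qed.

Lemma parts_le r t : rnorm (evenp r t) <= rnorm (F (r%:C * cis t)) + rnorm (F (r%:C * cis (- t))) /\
  rnorm (oddp r t) <= rnorm (F (r%:C * cis t)) + rnorm (F (r%:C * cis (- t))).
Proof.
have H (x y : R) : 0 <= x -> y <= x -> 2^-1 * y <= x by move=> *; lra.
split; rewrite rnormZ ?cabsM ?cabsN ?cabs_i ?mul1r cabs_half; apply: H; rewrite ?addr_ge0 ?rnorm_ge0 ?rnormD//.
by rewrite (le_trans (rnormD _ _))// rnormN.
Qed.

Lemma le_parts r t : rnorm (F (r%:C * cis t)) <= rnorm (evenp r t) + rnorm (oddp r t).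
Proof. by rewrite even_oddp (le_trans (rnormD _ _))// [rnorm ('i *: _)]rnormZ cabs_i mul1r. Qed.

Lemma parts_continuous r : 0 <= r < 1 ->
  continuous (fun t => rnorm (evenp r t)) /\ continuous (fun t => rnorm (oddp r t)).
Proof.
move=> r01; have [L HL] := global_lipschitz aF r01; have /andP[r0 r1] := r01.
have K s t : rnorm (F (r%:C * cis s) - F (r%:C * cis t)) <= `|L| * (4 * pi) * `|s - t|.
  apply: le_trans (HL _ _ _ _) _; rewrite ?cabs_polar// -mulrA.
  apply: (@le_trans _ _ (`|L| * cabs (r%:C * cis s - r%:C * cis t))).
    by rewrite ler_wpM2r ?cabs_ge0// ler_norm.
  by rewrite ler_wpM2l// cabs_polar_sub.
have K2 s t : rnorm (F (r%:C * cis (- s)) - F (r%:C * cis (- t))) <= `|L| * (4 * pi) * `|s - t|.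
  by apply: le_trans (K _ _) _; rewrite -opprD normrN.
have H (x y : R) : y <= x + x -> 2^-1 * y <= x by move=> *; lra.
split; apply: (@lipschitz_continuous _ _ (`|L| * (4 * pi))) => s t;
  apply: le_trans (rnorm_dist _ _) _.
  rewrite -scalerBr rnormZ cabs_half; apply: H; rewrite opprD addrACA.
  by apply: le_trans (rnormD _ _) _; apply: lerD.
rewrite -scalerBr rnormZ cabsM cabsN cabs_i mul1r cabs_half; apply: H; rewrite opprD addrACA.
by apply: le_trans (rnormD _ _) _; rewrite -opprD rnormN; apply: lerD.
Qed.

Variables (f : test_fun R -> Y) (b : bool).
Hypotheses (fdist : test_distribution f)
  (fc : forall m, ccoef f m = if b then 0 else a m)
  (fs : forall m, scoef f m = if b then a m else 0).

(** The conjugate kernel exchanges the two parts; the minus sign that it produces on a sine series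
    disappears in the norm. *)
Lemma convol_parts k r t : 0 <= r < 1 ->
  rnorm (convol (kernel k r) f t) = if b (+) k then rnorm (oddp r t) else rnorm (evenp r t).
Proof.
move=> r01; have := @dist_kernel _ _ f fdist k r t r01.
have He := @evenp_sums r t r01; have Ho := @oddp_sums r t r01.
move: fc fs; case: b; case: k => /= fc' fs' H.
- rewrite -rnormN; congr rnorm; apply: sums_unique (sumsN H) _.
  by apply: sums_eq He => m; rewrite fc' fs' scaler0 sub0r scalerN opprK.
- by congr rnorm; apply: sums_unique H _; apply: sums_eq Ho => m; rewrite fc' fs' scaler0 add0r.
- by congr rnorm; apply: sums_unique H _; apply: sums_eq Ho => m; rewrite fc' fs' scaler0 subr0.
- by congr rnorm; apply: sums_unique H _; apply: sums_eq He => m; rewrite fc' fs' scaler0 addr0.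
Qed.

End poisson_parts.

(** * Comparison of the two Hardy norms *)

Section hardy_norms.
Variables (R : realType) (Y : completeNormedModType R[i]) (p : R).
Hypotheses (p_gt0 : 0 < p) (p_le1 : p <= 1).
Implicit Types (F : disc R -> Y) (a : nat -> Y) (r t : R).

(** Outside the disc the value is [F disc0]; the extension lets power series be handled on [R[i]],
    and [global _ a 1] only looks inside the disc. *)
Definition disc_ext F (z : R[i]) : Y := F (insubd (disc0 R) z).

Lemma dext_val F (z : disc R) : disc_ext F (val z) = F z.
Proof. by rewrite /disc_ext valKd. Qed.

Lemma disc_lt1 (z : disc R) : cabs (val z) < 1.
Proof. by rewrite -normc_lt1; exact: (valP z). Qed.

Lemma val_insub_disc (z : R[i]) : cabs z < 1 -> val (insubd (disc0 R) z) = z.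
Proof. by move=> z1; rewrite val_insubd normc_lt1 z1. Qed.

Lemma analytic_global F : analytic F -> exists a, global (disc_ext F) a 1.
Proof.
move=> aF; apply: global_series => w w1.
have [c [d [d0 cF]]] := aF (insubd (disc0 R) w).
exists c, d; split=> // z z1 zw.
have := cF (insubd (disc0 R) z); rewrite !val_insub_disc// cabsE ltcR; exact.
Qed.

Lemma global_analytic F a : global (disc_ext F) a 1 -> analytic F.
Proof.
move=> aF z0; have z01 := disc_lt1 z0; have z00 := cabs_ge0 (val z0).
have [s zs s1] : exists2 s, cabs (val z0) < s & s < 1 by exists ((cabs (val z0) + 1) / 2); rewrite midf_lt.
have s0 : 0 <= s by exact: le_trans (ltW zs).
have [|B HB] := absr_lt1 aF (r := s); first by rewrite s0.
have d0 : 0 < s - cabs (val z0) by rewrite subr_gt0.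
have [|c [_ _ cF]] := @recenter _ _ a s (val z0) (s - cabs (val z0)) B d0 _ HB.
  by rewrite addrC subrK.
exists c, (s - cabs (val z0)); split=> // z.
rewrite cabsE ltcR => zz; apply: cF; first exact: ltW.
rewrite [val z0 + _]addrC subrK -(dext_val F z); apply: aF; exact: disc_lt1.
Qed.

Lemma global_unique (F : R[i] -> Y) a a' : global F a 1 -> global F a' 1 -> a = a'.
Proof.
move=> aF aF'; have h : 0 <= (2^-1 : R) < 1 by lra.
apply: (@psum_unique _ _ _ _ 2^-1); [lra|exact: (absr_lt1 aF)|exact: (absr_lt1 aF')|].
by move=> z zE; exists (F z); split; [apply: aF|apply: aF']; rewrite zE; lra.
Qed.

Lemma global_fun_unique F G a : global (disc_ext F) a 1 -> global (disc_ext G) a 1 -> F = G.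
Proof.
move=> aF aG; apply/funext => z; rewrite -(dext_val F) -(dext_val G).
by apply: sums_unique (aF _ _) (aG _ _); exact: disc_lt1.
Qed.

Lemma global0 (F : R[i] -> Y) a : global F a 1 -> F 0 = a 0%N.
Proof.
move=> aF; apply: (sums_unique (aF 0 _)); first by rewrite cabs0.
have := @sums_finite _ _ (fun n => (0 : R[i]) ^+ n *: a n) 1.
rewrite big_ord_recl big_ord0 addr0 expr0 scale1r; apply=> -[//|n] _.
by rewrite expr0n scale0r.
Qed.

Let p01 : 0 < p <= 1. Proof. by rewrite p_gt0. Qed.

Definition circ F r t : R := rnorm (disc_ext F (r%:C * cis t)) `^ p.

Lemma circ_continuous F a r : global (disc_ext F) a 1 -> 0 <= r < 1 -> continuous (circ F r).
Proof.
move=> aF r01; apply: powR_comp_continuous => // [|t]; last exact: rnorm_ge0.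
exact: rnorm_circle_continuous aF _ r01.
Qed.

Lemma hardyD_normE F a : global (disc_ext F) a 1 ->
  hardyD_norm p F = ereal_sup [set (pint (circ F r) `^ p^-1)%:E | r in `[0, 1[%classic].
Proof.
move=> aF; rewrite /hardyD_norm; congr ereal_sup; apply: eq_imagel => r /=.
rewrite in_itv/= => r01; rewrite -poweR_EFin -integral_pint//.
exact: circ_continuous aF r01.
Qed.

Lemma pint_ge0 (u : R -> R) : (forall t, 0 <= u t) -> 0 <= pint u.
Proof. by move=> u0; apply: Rintegral_ge0 => t _; exact: u0. Qed.

Lemma pint_symm (u : R -> R) : continuous u -> pint (fun t => 2 * (u t + u (- t))) = 4 * pint u.
Proof.
move=> cu; have cr : continuous (fun t => u (- t)).
  by apply: continuous_compf => // x; exact: oppr_continuous.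
have cs : continuous (fun t => u t + u (- t)) by exact: continuous_addf.
by rewrite (pintZ _ cs) (pintD cu cr) (pint_reflect cu); ring.
Qed.

Lemma hardyD_polybdd F a : global (disc_ext F) a 1 -> (hardyD_norm p F < +oo)%E -> polybdd a.
Proof.
move=> aF; rewrite (hardyD_normE aF) => Foo.
set S := ereal_sup _ in Foo.
have Sub r : 0 <= r < 1 -> ((pint (circ F r) `^ p^-1)%:E <= S)%E.
  by move=> r01; apply: ereal_sup_ubound; exists r => //=; rewrite in_itv.
have [M SM] : exists M, S = M%:E.
  have := Sub 0 ltac:(lra); move: Foo; case: S Sub => [M|//|//] _ _ _; by exists M.
apply: (@hardy_coef_polybdd _ _ a (disc_ext F) aF p (M `^ p)) => // r r01.
have u0 : 0 <= pint (circ F r) by apply: pint_ge0 => t; exact: powR_ge0.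
have := Sub r r01; rewrite SM lee_fin => h.
have := ge0_ler_powR (ltW p_gt0) _ _ h; rewrite !nnegrE powR_ge0.
rewrite (le_trans (powR_ge0 _ _) h) => /(_ isT isT).
by rewrite -powRrM mulVf ?gt_eqF// powRr1.
Qed.

Variables (f : test_fun R -> Y) (b : bool) (F : disc R -> Y) (a : nat -> Y).
Hypotheses (aF : global (disc_ext F) a 1) (fdist : test_distribution f)
  (fc : forall m, ccoef f m = if b then 0 else a m)
  (fs : forall m, scoef f m = if b then a m else 0).

Definition parts r t : R := rnorm (evenp (disc_ext F) r t) `^ p + rnorm (oddp (disc_ext F) r t) `^ p.

Lemma parts_cont r : 0 <= r < 1 -> continuous (parts r).
Proof.
move=> r01; have [ce co] := parts_continuous aF r01.
by apply: continuous_addf; apply: powR_comp_continuous => // t; exact: rnorm_ge0.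
Qed.

Lemma hardyT_normE :
  hardyT_norm p f = ereal_sup [set (pint (parts r) `^ p^-1)%:E | r in `[0, 1[%classic].
Proof.
rewrite /hardyT_norm; congr ereal_sup; apply: eq_imagel => r /=.
rewrite in_itv/= => r01.
have E t : rnorm (convol (poisson r) f t) `^ p + rnorm (convol (cpoisson r) f t) `^ p = parts r t.
  rewrite -[poisson r]/(kernel false r) -[cpoisson r]/(kernel true r) !(convol_parts aF fdist fc fs)//.
  by rewrite /parts; case: (b) => //=; rewrite addrC.
have -> : (\int[lebesgue_measure]_(t in @period_itv R) (rnorm (convol (poisson r) f t) `^ p
    + rnorm (convol (cpoisson r) f t) `^ p)%:E)%E = (pint (parts r))%:E.
  by rewrite -(integral_pint (parts_cont r01)); apply: eq_integral => t _; rewrite E.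
by rewrite poweR_EFin.
Qed.

Lemma hardyD_le_hardyT : (hardyD_norm p F <= hardyT_norm p f)%E.
Proof.
rewrite (hardyD_normE aF) hardyT_normE; apply: ge_ereal_sup => _ [r /= + <-].
rewrite in_itv/= => r01.
apply: (@le_trans _ _ (pint (parts r) `^ p^-1)%:E); last first.
  by apply: ereal_sup_ubound; exists r => //=; rewrite in_itv.
rewrite lee_fin; apply: ge0_ler_powR; rewrite ?nnegrE ?invr_ge0 ?(ltW p_gt0)//.
- by apply: pint_ge0 => t; exact: powR_ge0.
- by apply: pint_ge0 => t; rewrite addr_ge0// powR_ge0.
apply: le_pint; [exact: circ_continuous aF r01|exact: parts_cont|move=> t _].
apply: le_trans (powR_subadd p01 (rnorm_ge0 _) (rnorm_ge0 _)).
apply: ge0_ler_powR; rewrite ?nnegrE ?addr_ge0 ?rnorm_ge0 ?(ltW p_gt0)//.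
exact: le_parts.
Qed.

(** Each part is at most [|F(z)| + |F(conj z)|], so the two [p]-th powers add up to at most
    [2 (|F(z)|^p + |F(conj z)|^p)], whose mean is 4 times that of [|F|^p]. *)
Lemma hardyT_le_hardyD : (hardyT_norm p f <= (4 `^ p^-1)%:E * hardyD_norm p F)%E.
Proof.
rewrite (hardyD_normE aF) hardyT_normE; apply: ge_ereal_sup => _ [r /= + <-].
rewrite in_itv/= => r01.
apply: (@le_trans _ _ ((4 `^ p^-1)%:E * (pint (circ F r) `^ p^-1)%:E)%E); last first.
  apply: lee_wpmul2l; first by rewrite lee_fin powR_ge0.
  by apply: ereal_sup_ubound; exists r => //=; rewrite in_itv.
have c0 : 0 <= pint (circ F r) by apply: pint_ge0 => t; exact: powR_ge0.
rewrite -EFinM lee_fin -powRM//; apply: ge0_ler_powR; rewrite ?nnegrE ?invr_ge0 ?(ltW p_gt0) ?mulr_ge0//.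
  by apply: pint_ge0 => t; rewrite addr_ge0// powR_ge0.
have cc := circ_continuous aF r01.
have cr : continuous (fun t => circ F r (- t)).
  by apply: continuous_compf => // x; exact: oppr_continuous.
have cs : continuous (fun t => circ F r t + circ F r (- t)) by exact: continuous_addf.
rewrite -(pint_symm cc).
apply: le_pint; [exact: parts_cont|by apply: continuous_mulf => //; exact: continuous_cstf|move=> t _].
have [h1 h2] := parts_le (disc_ext F) r t.
have H (x : R) : 0 <= x -> x <= rnorm (disc_ext F (r%:C * cis t)) + rnorm (disc_ext F (r%:C * cis (- t))) ->
    x `^ p <= circ F r t + circ F r (- t).
  move=> x0 xF; apply: le_trans (powR_subadd p01 (rnorm_ge0 _) (rnorm_ge0 _)).
  by apply: ge0_ler_powR; rewrite ?nnegrE ?addr_ge0 ?rnorm_ge0 ?(ltW p_gt0).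
by rewrite mulr_natl mulr2n; apply: lerD; apply: H; rewrite ?rnorm_ge0.
Qed.

End hardy_norms.

(** * The transform and its inverse *)

Section isomorphism.
Variables (R : realType) (Y : completeNormedModType R[i]) (p : R).
Hypotheses (p_gt0 : 0 < p) (p_le1 : p <= 1).
Implicit Types (F : disc R -> Y) (f : test_fun R -> Y) (a : nat -> Y) (b : bool).

(* [taylor_coef F] is the zero sequence when [F] is not analytic. *)
Definition taylor_coef F : nat -> Y :=
  if pselect (exists a, global (disc_ext F) a 1) is left e then projT1 (cid e) else fun=> 0.

Lemma acoefP F a : global (disc_ext F) a 1 -> taylor_coef F = a.
Proof.
move=> aF; rewrite /taylor_coef; case: pselect => [e|]; last by case; exists a.
by case: cid => a' /= aF'; exact: global_unique aF' aF.
Qed.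

Definition trig_transform b F : test_fun R -> Y := tsum b (taylor_coef F).

(** [b = true] is the sine case; with the sign [(-1) ^+ b] in [hardyTb], one statement covers both
    assertions. *)
Definition hardyDb b : set (disc R -> Y) :=
  [set F | hardyD p F /\ (b -> F (disc0 R) = 0)].

Definition hardyTb b : set (test_fun R -> Y) :=
  [set f | hardyT p f /\ forall g, f (reflect_fun g) = (-1) ^+ b *: f g].

Lemma smapP b F : hardyDb b F ->
  [/\ global (disc_ext F) (taylor_coef F) 1, polybdd (taylor_coef F), test_distribution (trig_transform b F),
     forall m, ccoef (trig_transform b F) m = if b then 0 else taylor_coef F m &
     forall m, scoef (trig_transform b F) m = if b then taylor_coef F m else 0].
Proof.
move=> [[aF Foo] F0]; have [a ha] := analytic_global aF; rewrite /trig_transform (acoefP ha).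
have pa := hardyD_polybdd p_gt0 p_le1 ha Foo.
have a0 : b -> a 0%N = 0.
  by move=> /F0; rewrite -(dext_val F) /= (global0 ha).
split=> //; first exact: tsum_distribution.
  by move=> m; rewrite /ccoef (tsum_coef _ _ a0); case: b {F0 a0}.
by move=> m; rewrite /scoef (tsum_coef _ _ a0); case: b {F0 a0}.
Qed.

Lemma smap_isomorphism b :
  is_isomorphism (hardyDb b) (hardyD_norm p) (hardyTb b) (hardyT_norm p) (trig_transform b).
Proof.
have le_hT F : hardyDb b F -> (hardyT_norm p (trig_transform b F) <= (4 `^ p^-1)%:E * hardyD_norm p F)%E.
  by move=> /smapP[aF _ df fc fs]; exact: (hardyT_le_hardyD p_gt0 p_le1 aF df fc fs).
split.
- move=> c u v /smapP[au pu _ _ _] /smapP[av pv _ _ _].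
  have auv : global (disc_ext (c *: u + v)) (fun n => c *: taylor_coef u n + taylor_coef v n) 1.
    move=> z z1; apply: sums_eq (sumsD (sumsZ (c := c) (au z z1)) (av z z1)) => n.
    by rewrite scalerDr !scalerA mulrC.
  apply/funext => g; rewrite -[RHS]/(c *: tsum b (taylor_coef u) g + tsum b (taylor_coef v) g).
  rewrite /trig_transform (acoefP auv); apply: tsum_eq.
  apply: sums_eq (sumsD (sumsZ (c := c) (@tsumP _ _ b _ g pu)) (@tsumP _ _ b _ g pv)) => n.
  by rewrite scalerDr !scalerA mulrC.
- split.
  + move=> F hF; have [aF pa df fc fs] := smapP hF; split; last by move=> g; exact: tsum_reflect.
    split=> //; apply: le_lt_trans (le_hT F hF) _.
    case: hF => -[_ Foo] _; by apply: lte_mul_pinfty.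
  (* Injectivity: the Taylor coefficients can be read off from the Fourier coefficients of the
     image. *)
  + move=> u v; rewrite !inE => /smapP[au _ _ uc us] /smapP[av _ _ vc vs] uv.
    apply: (global_fun_unique au); suff -> : taylor_coef u = taylor_coef v by [].
    apply/funext => m; have := uc m; have := us m; have := vc m; have := vs m.
    by rewrite uv; case: b {uc us vc vs uv le_hT} => h1 h2 h3 h4; congruence.
  + move=> f [[df foo] fb].
    (* Surjectivity: the preimage has as Taylor coefficients the Fourier coefficients of [f] of the
       matching parity. *)
    pose a m : Y := (fweight R m)%:C *: f (trig_test R b m).
    have pa : polybdd a by exact: trig_polybdd.
    (* An even distribution vanishes on sines and an odd one on cosines, since its value there
       equals its own opposite. *)
    have f0 b' m : b' != b -> f (trig_test R b' m) = 0.
      move=> bb; have := fb (trig_test R b' m); rewrite reflect_trig_test distZ//.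
      have : 2 *: f (trig_test R b' m) = 0 -> f (trig_test R b' m) = 0.
        by move=> /eqP; rewrite scaler_eq0 pnatr_eq0/= => /eqP.
      move=> H E; apply: H; rewrite scaler_nat mulr2n.
      by move: bb E; case: b'; case: (b) => //= _;
        rewrite expr1 expr0 scaleN1r scale1r => E; [rewrite -[X in X + _]E|rewrite [X in X + _]E]; rewrite addNr.
    have fc m : ccoef f m = if b then 0 else a m.
      by rewrite /ccoef /a; case: (b) (f0 false m) => [->//|//]; rewrite scaler0.
    have fs m : scoef f m = if b then a m else 0.
      by rewrite /scoef /a; case: (b) (f0 true m) => [//|->//]; rewrite scaler0.
    have a0 : b -> a 0%N = 0.
      move=> bt; rewrite /a bt; have -> : trig_test R true 0 = 0.
        by apply/val_inj/funext => t; rewrite val_trig_test trig0.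
      by rewrite dist0// scaler0.
    have absa r : 0 <= r < 1 -> absr a r.
      move=> r01; have [C [k HC]] := pa.
      have C0 : 0 <= C by have := HC 0%N; rewrite expr1n mulr1; apply: le_trans; exact: rnorm_ge0.
      apply: bsum_le (bsumZ C0 (bsum_poly_geo k r01)) => n.
      by rewrite mulrA ler_wpM2r// exprn_ge0//; case/andP: r01.
    pose F (z : disc R) : Y := limn (series (fun n => val z ^+ n *: a n)).
    have aF : global (disc_ext F) a 1.
      move=> z z1; have [l zl] : exists l, psum a z l.
        by apply: (absr_psum (s := cabs z)) => //; apply: absa; rewrite cabs_ge0.
      rewrite /disc_ext /F val_insub_disc//.
      by rewrite (cvg_lim (@norm_hausdorff _ _) zl).
    have hF : hardyDb b F.
      split; last by move=> bt; rewrite -(dext_val F) (global0 aF) a0.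
      split; first exact: global_analytic aF.
      (* The comparison of norms relies on coefficients only, so it applies before [f] is known to
         be the image of [F]. *)
      exact: le_lt_trans (hardyD_le_hardyT p_gt0 p_le1 aF df fc fs) foo.
    exists F => //; apply/funext => g; rewrite /trig_transform (acoefP aF).
    have h1 := @tsumP _ _ b _ g pa; have h2 := @dist_fourier _ _ f df g.
    have h3 : (\sum_(m < N.+1) (tcoef false m g *: ccoef f m + tcoef true m g *: scoef f m))
        @[N --> \oo] --> tsum b a g.
      move: h1; rewrite /sums -cvg_shiftS; apply: cvg_trans; apply: near_eq_cvg; apply: nearW => N /=.
      rewrite /series/= big_mkord; apply: eq_bigr => m _.
      by rewrite fc fs; case: (b); rewrite scaler0 ?add0r ?addr0.
    exact: cvg_unique h3 h2.
- by exists (4 `^ p^-1) => F hF; exact: le_hT.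
- exists 1 => F /smapP[aF _ df fc fs]; rewrite mul1e.
  exact: (hardyD_le_hardyT p_gt0 p_le1 aF df fc fs).
Qed.

Lemma smap_monomial b n (x : Y) g : trig_transform b (monomial n x) g = tcoef b n g *: x.
Proof.
have am : global (disc_ext (monomial n x)) (fun m => if m == n then x else 0) 1.
  move=> z z1; rewrite /disc_ext /monomial val_insub_disc//.
  have := @sums_finite _ _ (fun m => z ^+ m *: (if m == n then x else 0)) n.+1.
  rewrite big_ord_recr/= eqxx big1 ?add0r => [|i _]; last by rewrite ltn_eqF// scaler0.
  by apply=> m mn; rewrite gtn_eqF// scaler0.
rewrite /trig_transform (acoefP am); apply: tsum_eq.
have := @sums_finite _ _ (fun m => tcoef b m g *: (if m == n then x else 0)) n.+1.
rewrite big_ord_recr/= eqxx big1 ?add0r => [|i _]; last by rewrite ltn_eqF// scaler0.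
by apply=> m mn; rewrite gtn_eqF// scaler0.
Qed.

End isomorphism.

Theorem proposition3p10 (R : realType) (Y : completeNormedModType R[i]) (p : R)
    (p_gt0 : 0 < p) (p_le1 : p <= 1) (Yreg : regular_banach Y) :
  (exists Se : (disc R -> Y) -> (test_fun R -> Y),
     is_isomorphism (@hardyD R Y p) (hardyD_norm p)
                    (@hardyTe R Y p) (hardyT_norm p) Se /\
     forall (n : nat) (x : Y), Se (monomial n x) = cos_monomial n x) /\
  (exists So : (disc R -> Y) -> (test_fun R -> Y),
     is_isomorphism (@hardyD0 R Y p) (hardyD_norm p)
                    (@hardyTo R Y p) (hardyT_norm p) So /\
     forall (n : nat) (x : Y), (0 < n)%N ->
       So (monomial n x) = sin_monomial n x).
Proof.
split.
  exists (trig_transform false); split=> [|n x]; last by apply/funext => g; rewrite smap_monomial.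
  have -> : hardyD p = hardyDb p false :> set (disc R -> Y).
    by apply/seteqP; split=> [F hF|F []].
  have -> : hardyTe p = hardyTb p false :> set (test_fun R -> Y).
    by apply/seteqP; split=> f [hf fe]; split=> // g; have := fe g; rewrite expr0 scale1r.
  exact: smap_isomorphism.
exists (trig_transform true); split=> [|n x _]; last by apply/funext => g; rewrite smap_monomial.
have -> : hardyD0 p = hardyDb p true :> set (disc R -> Y).
  by apply/seteqP; split=> F [hF F0]; split=> //; exact: F0.
have -> : hardyTo p = hardyTb p true :> set (test_fun R -> Y).
  by apply/seteqP; split=> f [hf fo]; split=> // g; have := fo g; rewrite expr1 scaleN1r.
exact: smap_isomorphism.
Qed.
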